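(* Let $0<\alpha<1$, let $\gamma$ be the random sequence of decreasingly ordered atoms in $[0,1]$ of the $\alpha$-stable random measure $\rho$ described in the context, and let $Y$ be, given $\gamma$, the K-process with parameters $\gamma$ and $c=0$. Let $\Phi$ be a function satisfying assumptions (A1)–(A6) listed in the context, with associated functions $\Psi_1$, $\Xi$, $\Psi_2$. Then, for almost every $\gamma$ such that $$\lim_{t\to0}\mathbb{E}_\infty\big[1\{Y(s)=Y(t),\,s\in[t,t+\theta t]\}\,\big|\,\gamma\big]=\Lambda(\theta)\quad\text{for every }\theta>0,$$ we have, for every $\theta>0$, $$\lim_{t\to0}\mathbb{E}_\infty[\Phi(t,\theta t;Y)|\gamma]=\Psi_2(0,\theta)+[\Psi_1(\theta)-\Psi_2(\theta,\theta)]\Lambda(\theta)+\int_0^\theta\Psi_2'(s,\theta)\Lambda(s)\,ds .$$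
   Context: $\mathbb{N}^*=\{1,2,\ldots\}$ and $\bar{\mathbb{N}}^*=\mathbb{N}^*\cup\{\infty\}$ is its one-point compactification, with metric $d(x,y)=|x^{-1}-y^{-1}|$ ($\infty^{-1}=0$). The random $\gamma$. Let $V_x$, $x\in\mathbb{R}$, $V_0=0$, be the increasing Lévy process with stationary independent increments given by $\mathbb{E}[e^{ir(V_{x+x_0}-V_{x_0})}]=\exp\{\alpha x\int_0^\infty(e^{irw}-1)w^{-1-\alpha}\,dw\}$ for $x_0\in\mathbb{R}$, $x\ge0$, and let $\rho$ be the random measure on $\mathbb{R}$ with $\rho((a,b])=V_b-V_a$ (it is purely atomic). Then $\gamma=\{\gamma(i),i\in\mathbb{N}^*\}$ denotes the weights of the atoms of $\rho$ in $[0,1]$ in decreasing order. Almost surely $\gamma(i)>0$ for all $i$ and $\sum_i\gamma(i)<\infty$; set $\gamma(\infty)=0$. K-process with parameters $\gamma$ and $c\ge0$: Let $\{(N^{(x)}_t)_{t\ge0},x\in\mathbb{N}^*\}$ be i.i.d. Poisson processes of rate 1, with $\sigma^{(x)}_j$ the $j$th event time of $N^{(x)}$, and let $\{T_0;T^{(x)}_i,i\ge1,x\in\mathbb{N}^*\}$ be i.i.d. rate 1 exponentials, all independent (and independent of $\gamma$). For $y\in\bar{\mathbb{N}}^*$ put $\Gamma(t)=\gamma(y)T_0+\sum_{x=1}^\infty\gamma(x)\sum_{i=1}^{N^{(x)}_t}T^{(x)}_i+ct$. The K-process started at $y$ equals $y$ at $t$ if $0\le t<\gamma(y)T_0$; equals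 $x$ if $\Gamma(\sigma^{(x)}_j-)\le t<\Gamma(\sigma^{(x)}_j)$ for some $x\in\mathbb{N}^*$, $j\ge1$; and equals $\infty$ otherwise. $\mathbb{E}_\infty[\,\cdot\,|\gamma]$ denotes expectation for $Y$ started at $\infty$ with parameters fixed at $\gamma$. The function $\Lambda$ is $$\Lambda(\theta)=\frac{1}{\mathcal{G}(\alpha)}\,\frac{\int_0^\infty e^{-\theta/w}w^{-(1+\alpha)}\,dw-\int_0^1\int_0^\infty s^\alpha e^{-((1+\theta)-s)/w}w^{-(2+\alpha)}\,dw\,ds}{\int_0^\infty \frac{w}{1+w}\,w^{-(1+\alpha)}\,dw},\qquad \mathcal{G}(a)=\int_0^\infty t^ae^{-t}\,dt .$$ Assumptions on $\Phi$. Let $\Pi$ be the space of càdlàg paths on $\bar{\mathbb{N}}^*$ and $\Phi:\mathbb{R}^+\times\mathbb{R}^+\times\Pi\to\mathbb{R}$ (measurable in the path). (A1) $\Phi(t,t';\zeta)$ depends on $\zeta$ only through its restriction $\zeta([t,t+t'])$ to $[t,t+t']$. (A2) For all $t,t'>0$, $\Phi(t,t';\zeta)=\Phi(1,t'/t;\zeta^t)$, where $\zeta^t(\cdot)=\zeta(t\,\cdot)$. (A3) For $\theta>0$ and all $x\in\mathbb{N}^*$, $\Phi(1,\theta;\bar\eta_{x,\theta})=\Psi_1(\theta)$ for some real function $\Psi_1$ (not depending on $x$), where $\bar\eta_{x,\theta}$ is the path segment on $[1,1+\theta]$ identically equal to $x$. (A4) For $0<s<\theta$ and all $x\in\mathbb{N}^*$,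 $\Phi(1,\theta;\eta_{x,s}\circ\eta)=\Xi(x,s,\eta)$ for every càdlàg path segment $\eta$ on $[1+s,1+\theta]$ with $\eta(1+s)\ne x$, where $\eta_{x,s}$ is the segment on $[1,1+s)$ identically equal to $x$, and $\circ$ is concatenation. (A5) Here, with $\Pi_u$ the space of càdlàg paths in $\bar{\mathbb{N}}^*$ of length $u$ (segments are identified up to time shift), for each fixed $\theta>0$, $\Xi:\bar{\mathbb{N}}^*\times\bigcup_{u\in[0,\theta]}(\{u\}\times\Pi_{\theta-u})\to\mathbb{R}$ is a function such that: (i) $\Xi$ is uniformly bounded; (ii) for all $\eta\in\Pi_{\theta-s}$, $\Xi(x,s,\eta)=\Xi(y,s,\eta)$ whenever $x,y\in\mathbb{N}^*$ are not visited by $\eta$; (iii) for all $x\in\mathbb{N}^*$, the function $\eta\mapsto\Xi(x,s,\eta)$ is continuous in the sup norm (with respect to $d$) on $\Pi_{\theta-s}$ at $\eta=\hat\eta_{\infty,\theta-s}$, the path in $\Pi_{\theta-s}$ identically equal to $\infty$, uniformly in $0<s<\theta$. (A6) For $x\in\mathbb{N}^*$ and $0<s<\theta$ let $\Psi_2(s,\theta)=\Xi(x,s,\hat\eta_{\infty,\theta-s})$ (independent of $x\in\mathbb{N}^*$ by (ii)). For all $\theta>0$, the limits $\Psi_2(0,\theta):=\lim_{s\downarrow0}\Psi_2(s,\theta)$ and $\Psi_2(\theta,\theta):=\lim_{s\uparrow\theta}\Psi_2(s,\theta)$ exist, and $\Psi_2'(s,\theta):=\frac{d}{ds}\Psi_2(s,\theta)\in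 L_1([0,\theta],ds)$. *)

(* Defs.v *)
From HB Require Import structures.
From mathcomp Require Import all_boot all_order all_algebra finmap.
From mathcomp Require Import all_classical all_reals all_analysis.
From mathcomp Require Import complex.
Set Implicit Arguments.
Unset Strict Implicit.
Unset Printing Implicit Defensive.
Import Order.TTheory GRing.Theory Num.Theory.
Import numFieldNormedType.Exports.
Local Open Scope classical_set_scope.
Local Open Scope ring_scope.

Section Independence.
Context d (T : measurableType d) (R : realType) (P : probability T R).

Definition mutually_indep (I : choiceType) (F : I -> set (set T)) : Prop :=
  forall (J : {fset I}) (A : I -> set T), (forall i, i \in J -> F i (A i)) ->
    P (\bigcap_(i in [set` J]) A i) = (\prod_(i <- J) P (A i))%E.

Definition sigma_generated d' (T' : measurableType d') (J : Type) (D : set J)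
    (X : J -> T -> T') : set (set T) :=
  <<s \bigcup_(j in D) preimage_set_system setT (X j) measurable >>.

End Independence.

Section ComplexAnalysis.
Context (R : realType).

Definition cexp (z : R[i]) : R[i] :=
  ((expR (complex.Re z) * cos (complex.Im z))
    +i* (expR (complex.Re z) * sin (complex.Im z)))%C.

Definition cintegral d (T : measurableType d) (mu : {measure set T -> \bar R})
    (D : set T) (f : T -> R[i]) : R[i] :=
  ((\int[mu]_(x in D) complex.Re (f x))
    +i* (\int[mu]_(x in D) complex.Im (f x)))%C.

End ComplexAnalysis.

Section RandomWeights.
Context (R : realType).

(* Nondecreasing, right-continuous paths are built into [cumulative R R];
   stationarity of the increments is contained in the last clause, whose
   right-hand side does not depend on [x0]. *)
Definition stable_subordinator d (Omega : measurableType d)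
    (P : probability Omega R) (alpha : R) (V : Omega -> cumulative R R) : Prop :=
  [/\ forall w, V w 0 = 0,
      forall x, measurable_fun setT (fun w => V w x),
      forall u : nat -> R, (forall i, u i <= u i.+1) ->
        mutually_indep P (fun i : nat =>
          sigma_generated [set: unit] (fun _ w => V w (u i.+1) - V w (u i)))
    & forall x0 x r : R, 0 <= x ->
        cintegral P setT
          (fun w => cexp ('i%C * (r * (V w (x + x0) - V w x0))%:C%C)) =
        cexp ((alpha * x)%:C%C *
          cintegral lebesgue_measure `]0, +oo[
            (fun w : R => (cexp ('i%C * (r * w)%:C%C) - 1) *
                            (w `^ (-1 - alpha))%:C%C)) ].

(* [rho V] is the measure with rho (a, b] = V b - V a. *)
Definition rho (V : cumulative R R) : {measure set _ -> \bar R} :=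
  lebesgue_stieltjes_measure V.

(* [g i] is the weight of the (i+1)-st heaviest atom of [rho V] in [0, 1]. *)
Definition decreasing_atom_weights (V : cumulative R R) (g : nat -> R) : Prop :=
  exists z : nat -> R,
    [/\ injective z,
        range z = [set y | 0 <= y <= 1 /\ (0 < rho V [set y])%E],
        forall i, rho V [set z i] = (g i)%:E
      & forall i, g i.+1 <= g i].

(* The value 0 is only used on the null event that [rho V] has finitely many
   atoms in [0, 1]. *)
Definition gamma (V : cumulative R R) : nat -> R :=
  xget (fun _ => 0) (decreasing_atom_weights V).

End RandomWeights.

(* The state space: [Some n] stands for the positive integer n+1 and [None] for
   the point at infinity.  Accordingly all sequences indexed by the positive
   integers are shifted by one. *)
Definition nbar := option nat.

Section Paths.
Context (R : realType).

Definition nbar_inv (x : nbar) : R := if x is Some n then n.+1%:R^-1 else 0.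

Definition nbar_dist (x y : nbar) : R := `|nbar_inv x - nbar_inv y|.

(* Only the restriction of [f] to the half-line [0, +oo[ matters. *)
Definition cadlag (f : R -> nbar) : Prop :=
  (forall t, 0 <= t -> nbar_dist (f s) (f t) @[s --> t^'+] --> (0 : R)) /\
  (forall t, 0 < t ->
     exists l : nbar, nbar_dist (f s) l @[s --> t^'-] --> (0 : R)).

(* Cadlag segments of length [u], parametrized by [0, u]; the values of [f]
   outside of [0, u] are irrelevant. *)
Definition cadlag_seg (u : R) (f : R -> nbar) : Prop :=
  (forall t, 0 <= t < u -> nbar_dist (f s) (f t) @[s --> t^'+] --> (0 : R)) /\
  (forall t, 0 < t <= u ->
     exists l : nbar, nbar_dist (f s) l @[s --> t^'-] --> (0 : R)).

Definition sup_dist (u : R) (f h : R -> nbar) : R :=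
  sup [set nbar_dist (f r) (h r) | r in `[0, u]].

Definition infty_path : R -> nbar := fun _ => None.

Lemma cadlag_infty_path : cadlag infty_path.
Proof.
have E : nbar_dist None None = 0 by rewrite /nbar_dist subrr normr0.
split=> [t _|t _]; last exists None; rewrite /infty_path E; exact: cvg_cst.
Qed.

Record path_space := Path { path_fun :> R -> nbar; _ : cadlag path_fun }.

Definition to_path (f : R -> nbar) : path_space :=
  if pselect (cadlag f) is left h then Path h else Path cadlag_infty_path.

(* The sigma-algebra on the path space generated by the coordinate maps at
   nonnegative times. *)
Definition path_sigma : set (set path_space) :=
  <<s [set A | exists t x, 0 <= t /\ A = [set zeta | path_fun zeta t = x]] >>.

End Paths.

Section KProcess.
Context (R : realType) d (Omega : measurableType d) (P : probability Omega R).

(* The case s = t is excluded from the last clause because [poisson_pmf 0 k]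
   is 1 for every [k] by convention. *)
Definition poisson_process (rate : R) (N : R -> {RV P >-> nat}) : Prop :=
  [/\ forall w, N 0 w = 0%N,
      forall w s t, 0 <= s <= t -> (N s w <= N t w)%N,
      forall w t, 0 <= t -> \forall s \near t^'+, N s w = N t w,
      forall u : nat -> R, 0 <= u 0%N -> (forall i, u i <= u i.+1) ->
        mutually_indep P (fun i : nat =>
          sigma_generated [set: unit]
            (fun _ w => (N (u i.+1) w - N (u i) w)%N))
    & forall s t k, 0 <= s < t ->
        P [set w | (N t w - N s w)%N = k] =
          (poisson_pmf (rate * (t - s)) k)%:E].

(* [event_time N j w] is the time of the j-th event, j >= 1. *)
Definition event_time (N : R -> {RV P >-> nat}) (j : nat) (w : Omega) : R :=
  inf [set t | 0 <= t /\ (j <= N t w)%N].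

Definition driving_sigma (N : nat -> R -> {RV P >-> nat}) (T0 : {RV P >-> R})
    (T : nat -> nat -> {RV P >-> R}) (i : nat + option (nat * nat)) :
    set (set Omega) :=
  match i with
  | inl x => sigma_generated [set t : R | 0 <= t] (fun t => N x t : Omega -> nat)
  | inr None => sigma_generated [set: unit] (fun _ => T0 : Omega -> R)
  | inr (Some (x, k)) =>
      sigma_generated [set: unit] (fun _ => T x k : Omega -> R)
  end.

(* [T x i] is the (i+1)-st exponential variable attached to the state [x]. *)
Definition driving_variables (N : nat -> R -> {RV P >-> nat})
    (T0 : {RV P >-> R}) (T : nat -> nat -> {RV P >-> R}) : Prop :=
  [/\ forall x, poisson_process 1 (N x),
      forall A, measurable A -> distribution P T0 A = exponential_prob 1 A,
      forall x i A, measurable A ->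
        distribution P (T x i) A = exponential_prob 1 A
    & mutually_indep P (driving_sigma N T0 T)].

Definition weight_at (g : nat -> R) (y : nbar) : R :=
  if y is Some n then g n else 0.

Definition clock (g : nat -> R) (c : R) (y : nbar)
    (N : nat -> R -> {RV P >-> nat}) (T0 : {RV P >-> R})
    (T : nat -> nat -> {RV P >-> R}) (w : Omega) (t : R) : \bar R :=
  ((weight_at g y * T0 w)%:E
    + \sum_(0 <= x <oo) (g x * \sum_(i < N x t w) T x i w)%:E
    + (c * t)%:E)%E.

(* Almost surely at most one state [x] qualifies in the [xget] below. *)
Definition Kprocess (g : nat -> R) (c : R) (y : nbar)
    (N : nat -> R -> {RV P >-> nat}) (T0 : {RV P >-> R})
    (T : nat -> nat -> {RV P >-> R}) (w : Omega) (t : R) : nbar :=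
  let Gamma := clock g c y N T0 T w in
  if 0 <= t < weight_at g y * T0 w then y else
  xget None [set Some x | x in [set x : nat | exists j : nat,
    [/\ (1 <= j)%N,
        (lim (Gamma s @[s --> (event_time (N x) j w)^'-]) <= t%:E)%E
      & (t%:E < Gamma (event_time (N x) j w))%E]]].

(* For positive summable [g] the trajectories are almost surely cadlag, so
   that [to_path] only modifies them on a null event. *)
Definition Kpath (g : nat -> R) (c : R) (y : nbar)
    (N : nat -> R -> {RV P >-> nat}) (T0 : {RV P >-> R})
    (T : nat -> nat -> {RV P >-> R}) (w : Omega) : path_space R :=
  to_path (Kprocess g c y N T0 T w).

End KProcess.

Section Lambda.
Context (R : realType).
Local Notation mu := (@lebesgue_measure R).

Definition Gfun (a : R) : R := \int[mu]_(t in `]0, +oo[) (t `^ a * expR (- t)).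

Definition Lambda (alpha theta : R) : R :=
  (Gfun alpha)^-1 *
  ((\int[mu]_(w in `]0, +oo[) (expR (- theta / w) * w `^ (- (1 + alpha)))
    - \int[mu]_(s in `[0, 1]) (\int[mu]_(w in `]0, +oo[)
        (s `^ alpha * expR (- (1 + theta - s) / w) * w `^ (- (2 + alpha)))))
   / \int[mu]_(w in `]0, +oo[) (w / (1 + w) * w `^ (- (1 + alpha)))).

End Lambda.

Section Assumptions.
Context (R : realType).
Variables (Phi : R -> R -> path_space R -> R) (Psi1 : R -> R).
(* [Xi theta x s eta], with [eta] a segment of length [theta - s]. *)
Variable Xi : R -> nbar -> R -> (R -> nbar) -> R.
Variable Psi2 : R -> R -> R.

Definition path_measurable : Prop :=
  forall t t', 0 <= t -> 0 <= t' ->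
    forall B : set R, measurable B -> path_sigma (Phi t t' @^-1` B).

Definition assumption_A1 : Prop :=
  forall (t t' : R) (zeta zeta' : path_space R), 0 <= t -> 0 <= t' ->
    (forall s, t <= s <= t + t' -> zeta s = zeta' s) ->
    Phi t t' zeta = Phi t t' zeta'.

Definition assumption_A2 : Prop :=
  forall (t t' : R) (zeta zeta_t : path_space R), 0 < t -> 0 < t' ->
    (forall s, 0 <= s -> zeta_t s = zeta (t * s)) ->
    Phi t t' zeta = Phi 1 (t' / t) zeta_t.

Definition assumption_A3 : Prop :=
  forall (theta : R) (x : nat) (zeta : path_space R), 0 < theta ->
    (forall r, 1 <= r <= 1 + theta -> zeta r = Some x) ->
    Phi 1 theta zeta = Psi1 theta.

Definition assumption_A4 : Prop :=
  forall (theta s : R) (x : nat) (eta : R -> nbar) (zeta : path_space R),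
    0 < s < theta -> cadlag_seg (theta - s) eta -> eta 0 <> Some x ->
    (forall r, 1 <= r < 1 + s -> zeta r = Some x) ->
    (forall r, 1 + s <= r <= 1 + theta -> zeta r = eta (r - (1 + s))) ->
    Phi 1 theta zeta = Xi theta (Some x) s eta.

(* [Xi theta x s] is a function of the segment on [0, theta - s] only. *)
Definition Xi_on_segments : Prop :=
  forall (theta s : R) (x : nbar) (eta eta' : R -> nbar),
    0 < theta -> 0 <= s <= theta ->
    cadlag_seg (theta - s) eta -> cadlag_seg (theta - s) eta' ->
    (forall r, 0 <= r <= theta - s -> eta r = eta' r) ->
    Xi theta x s eta = Xi theta x s eta'.

Definition assumption_A5i : Prop :=
  forall theta : R, 0 < theta -> exists M : R,
    forall (x : nbar) (s : R) (eta : R -> nbar), 0 <= s <= theta ->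
      cadlag_seg (theta - s) eta -> `|Xi theta x s eta| <= M.

Definition assumption_A5ii : Prop :=
  forall (theta s : R) (x y : nat) (eta : R -> nbar),
    0 < theta -> 0 <= s <= theta -> cadlag_seg (theta - s) eta ->
    (forall r, 0 <= r <= theta - s -> eta r <> Some x /\ eta r <> Some y) ->
    Xi theta (Some x) s eta = Xi theta (Some y) s eta.

Definition assumption_A5iii : Prop :=
  forall (theta : R) (x : nat), 0 < theta ->
    forall e : R, 0 < e -> exists2 delta : R, 0 < delta &
      forall (s : R) (eta : R -> nbar), 0 < s < theta ->
        cadlag_seg (theta - s) eta ->
        sup_dist (theta - s) eta (@infty_path R) < delta ->
        `|Xi theta (Some x) s eta - Xi theta (Some x) s (@infty_path R)| < e.

(* The values of [Psi2] at s = 0 and s = theta are the one-sided limits. *)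
Definition assumption_A6 : Prop :=
  (forall (theta s : R) (x : nat), 0 < s < theta ->
     Psi2 s theta = Xi theta (Some x) s (@infty_path R)) /\
  (forall theta : R, 0 < theta ->
     [/\ Psi2 s theta @[s --> 0^'+] --> Psi2 0 theta,
         Psi2 s theta @[s --> theta^'-] --> Psi2 theta theta,
         forall s, 0 < s < theta -> derivable (Psi2 ^~ theta) s 1
       & lebesgue_measure.-integrable `[0, theta]
           (fun s : R => (derive1 (Psi2 ^~ theta) s)%:E)]).

End Assumptions.

(* Main.v *)
(** The environment enters only through the positivity and the summability of
    the weights; the set of weights without decreasing enumeration, for which
    [gamma] is 0 and the path is constantly infinity, is excluded because the
    hypothesis would then give [Lambda = 1], whereas [Lambda] falls below 1 at
    large arguments.

    For positive summable weights two facts about small times [t] suffice.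
    First, [t] is almost surely covered by a visit to some state [x]: the set of
    unvisited times is Lebesgue-null, and one holding time, which has a density
    and is independent of everything else, shifts [t] with respect to it.
    Second, a return to [x] before [(1 + theta) t] is unlikely: on a fine grid,
    the cell in which the clock passes [t] is independent of the later
    increments of the Poisson process of [x].

    Since low states are unlikely to be visited before [(1 + theta) t], the path
    after the exit at [t + s t] is close to infinity in the sup norm, so that
    [Phi] is close to [Psi1 theta] when [s > theta] and to [Psi2 s theta] when
    [s < theta].  Writing [Psi2 s theta] as [Psi2 0 theta] plus the integral of
    its derivative up to [s], taking expectations and exchanging the integrals
    expresses the limit through the probabilities of no exit before [t + u t],
    which tend to [Lambda u]. *)
Require Import Defs.
From HB Require Import structures.
From mathcomp Require Import all_boot all_order all_algebra finmap.
From mathcomp Require Import all_classical all_reals all_analysis.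
From mathcomp Require Import measurable_realfun lra ring.
Set Implicit Arguments.
Unset Strict Implicit.
Unset Printing Implicit Defensive.
Import Order.TTheory GRing.Theory Num.Theory.
Import numFieldNormedType.Exports.
Local Open Scope classical_set_scope.
Local Open Scope ring_scope.

(** * The clock *)

Section Clock.
Context (R : realType).
Implicit Types (g : nat -> R) (n : nat -> R -> nat) (tau : nat -> nat -> R).

(** Two layers are kept apart. The pathwise arguments rest on [regular] and [clk_strict], properties
    of a deterministic array of counts and holding times; probability serves to show that these hold
    almost surely, to prove the two facts on small times and to take expectations. What passes
    between the layers are the visit intervals from [vstart] to [vend]. They are measurable, whereas
    the K-process is defined by left limits and a choice, and its functionals become measurable only
    after a change on a null set; [ae_integral_eq] is there for this reason.

    No Markov property is invoked. The clock mixes all components of the driving family, so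
    independence is always used at deterministic clock arguments, between an event of one component
    and the sigma-algebra of the others, enlarged if necessary by a part of that component.

    [Psi2'] is merely integrable, possibly unbounded and discontinuous; this is why the fundamental
    theorem of calculus is proved for differentiable functions with integrable derivative.

    The environment is fixed throughout: the limit is derived for each [w] separately. *)

Definition work n tau (x : nat) (t : R) : R := \sum_(i < n x t) tau x i.

Definition clk g n tau (t : R) : \bar R :=
  (\sum_(0 <= x <oo) (g x * work n tau x t)%:E)%E.

(** For a fixed sample point this is convertible to [event_time], so that facts about it apply
    directly to [Kprocess]. *)
Definition evt n (x j : nat) : R := inf [set t | 0 <= t /\ (j <= n x t)%N].

(** [cnt_ub] keeps the set defining [evt] nonempty; the infimum of the empty set would be the
    default value 0. *)
Record counting n : Prop := {
  cnt0 : forall x, n x 0 = 0%N;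
  cnt_le : forall x s t, 0 <= s -> s <= t -> (n x s <= n x t)%N;
  cnt_rc : forall x t, 0 <= t -> \forall s \near t^'+, n x s = n x t;
  cnt_ub : forall x j, exists2 t, 0 <= t & (j <= n x t)%N }.

Section evt.
Variables (n : nat -> R -> nat) (hn : counting n).

Let has_inf_evt x j : has_inf [set t : R | 0 <= t /\ (j <= n x t)%N].
Proof.
split; first by have [t t0 jt] := cnt_ub hn x j; exists t.
by exists 0 => t [].
Qed.

Lemma evt_ge0 x j : 0 <= evt n x j.
Proof. by apply: lb_le_inf; [case: (has_inf_evt x j)|move=> t []]. Qed.

(** Right-continuity turns the infimum into a minimum. All later comparisons between times and
    events go through this equivalence. *)
Lemma evt_le x j t : 0 <= t -> (evt n x j <= t) = (j <= n x t)%N.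
Proof.
move=> t0; apply/idP/idP => [|jt]; last first.
  by apply: ge_inf => //; case: (has_inf_evt x j).
rewrite le_eqVlt => /orP[/eqP <-|]; last first.
  rewrite -subr_gt0 => ht.
  have [s [s0 js]] := inf_adherent ht (has_inf_evt x j).
  rewrite addrC subrK => st; apply: leq_trans js _.
  exact: (cnt_le hn _ s0 (ltW st)).
have e0 := evt_ge0 x j.
have [/= e /= epos he] := (cnt_rc hn x e0).
have [||s [s0 js] se] := @inf_adherent R [set t : R | 0 <= t /\ (j <= n x t)%N] e.
- exact: epos.
- exact: has_inf_evt.
have les : evt n x j <= s by apply: ge_inf => //; case: (has_inf_evt x j).
move: les; rewrite le_eqVlt => /orP[/eqP->//|lts].
rewrite -(he s)//= ltr_distlC; apply/andP; split => //.
by rewrite (lt_trans _ lts)// ltrBlDr ltrDl.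
Qed.

Lemma lt_evt x j t : 0 <= t -> (t < evt n x j) = (n x t < j)%N.
Proof. by move=> t0; rewrite ltNge evt_le// -ltnNge. Qed.

Lemma evt_cnt x j : (j <= n x (evt n x j))%N.
Proof. by rewrite -evt_le// evt_ge0. Qed.

Lemma evt_gt0 x j : 0 < evt n x j.+1.
Proof. by rewrite lt_evt// (cnt0 hn). Qed.

Lemma le_evt x i j : (i <= j)%N -> evt n x i <= evt n x j.
Proof.
move=> ij; rewrite evt_le ?evt_ge0//; exact: leq_trans ij (evt_cnt x j).
Qed.

(** The index is read off from the count at [t]: its event is not after [t], and if it were earlier,
    the full count would be reached before [t]. *)
Lemma jump_evt x t : 0 < t -> (forall s, 0 <= s < t -> (n x s < n x t)%N) ->
  exists j, t = evt n x j.+1.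
Proof.
move=> t0 h; have : (0 < n x t)%N by apply: leq_ltn_trans (h 0 _); rewrite ?lexx.
case E : (n x t) => [//|j] _; exists j; apply/eqP; rewrite eq_le.
rewrite (evt_le _ _ (ltW t0)) E leqnn andbT leNgt; apply/negP => lt.
have := h _ (introT andP (conj (evt_ge0 x j.+1) lt)).
by rewrite E ltnNge evt_cnt.
Qed.

End evt.

Section clk.
Variables (g : nat -> R) (n : nat -> R -> nat) (tau : nat -> nat -> R).
Hypotheses (g0 : forall x, 0 <= g x) (tau0 : forall x i, 0 <= tau x i).
Hypothesis hn : counting n.
Local Notation clk := (clk g n tau).
Local Notation work := (work n tau).

Lemma work_ge0 x t : 0 <= work x t.
Proof. by apply: sumr_ge0. Qed.

Lemma work_le x s t : (n x s <= n x t)%N -> work x s <= work x t.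
Proof.
move=> h; rewrite /work -!(big_mkord xpredT (tau x)).
by rewrite (@big_cat_nat _ _ _ (n x s) 0 (n x t))//= lerDl sumr_ge0.
Qed.

Lemma gwork_ge0 x t : (0 <= (g x * work x t)%:E)%E.
Proof. by rewrite lee_fin mulr_ge0// work_ge0. Qed.

Lemma clk_ge0 t : (0 <= clk t)%E.
Proof. by apply: nneseries_ge0 => x _ _; exact: gwork_ge0. Qed.

Lemma clk0 : clk 0 = 0%E.
Proof. by apply: eseries0 => x _ _; rewrite /work (cnt0 hn) big_ord0 mulr0. Qed.

Lemma clk_le s t : 0 <= s -> s <= t -> (clk s <= clk t)%E.
Proof.
move=> s0 st; apply: lee_nneseries => x; first by move=> _ _; exact: gwork_ge0.
by move=> _; rewrite lee_fin ler_wpM2l// work_le// (cnt_le hn).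
Qed.

Lemma clk_jump x i s t : 0 <= s -> s <= t -> (n x s <= i < n x t)%N ->
  (clk s + (g x * tau x i)%:E <= clk t)%E.
Proof.
move=> s0 st /andP[si it].
(* The clock at [t] is the clock at [s] plus a series of nonnegative increments; the single term [x]
   already contains the holding time [i]. *)
pose f y : \bar R := (g y * (work y t - work y s))%:E.
have f0 y : (0 <= f y)%E.
  by rewrite lee_fin mulr_ge0// subr_ge0 work_le// (cnt_le hn).
have -> : clk t = (clk s + \sum_(0 <= y <oo) f y)%E.
  rewrite /clk -(nneseriesD (fun y _ _ => gwork_ge0 y s) (fun y _ _ => f0 y)).
  by apply: eq_eseriesr => y _; rewrite -EFinD -mulrDr addrCA subrr addr0.
rewrite leeD2l//.
apply: le_trans (nneseries_lim_ge x.+1 (fun y _ _ => f0 y)).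
rewrite big_nat_recr//= -[leLHS]add0e leeD ?sume_ge0//.
rewrite lee_fin ler_wpM2l// /work -!(big_mkord xpredT (tau x)).
rewrite (@big_cat_nat _ _ _ (n x s) 0 (n x t))//=; last exact: (cnt_le hn).
rewrite addrAC subrr add0r (@big_cat_nat _ _ _ i (n x s) (n x t))//=; last first.
  exact: ltnW.
rewrite -[leLHS]add0r lerD ?sumr_ge0// big_ltn//= lerDl sumr_ge0//.
Qed.

(** The tail of the series at time [T] dominates all tails before [T]. Up to [e], the increments of
    the clock are thus decided by finitely many states, and both one-sided continuity statements
    reduce to finitely many counts. *)
Lemma clk_approx T (e : R) : 0 <= T -> (clk T < +oo)%E -> 0 < e ->
  exists K, forall s t, 0 <= s -> s <= t -> t <= T ->
    (forall x, (x < K)%N -> n x s = n x t) -> (clk t <= clk s + e%:E)%E.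
Proof.
move=> T0 fin e0.
have fint : \forall N \near \oo,
   (\sum_(N <= x <oo) (g x * work x T)%:E < e%:E)%E.
  have e0' : (0%:E < e%:E)%E by rewrite lte_fin.
  exact: (nneseries_tail_cvg fin (fun x _ => gwork_ge0 x T) (open_ereal_lt' e0')).
near \oo => K.
have hK : (\sum_(K <= x <oo) (g x * work x T)%:E < e%:E)%E by near: K.
exists K => s t s0 st tT eqn.
have split u : clk u = (\sum_(0 <= x < K) (g x * work x u)%:E
    + \sum_(K <= x <oo) (g x * work x u)%:E)%E.
  by rewrite /clk (nneseries_split 0 K)// => x _; exact: gwork_ge0.
rewrite !split -addeA leeD//.
  rewrite [leLHS]big_nat_cond [leRHS]big_nat_cond.
  apply: lee_sum => x /andP[/andP[_ xK] _].
  by rewrite lee_fin /work eqn.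
apply: le_trans (_ : _ <= \sum_(K <= x <oo) (g x * work x T)%:E)%E _.
  apply: lee_nneseries => x; first by move=> _ _; exact: gwork_ge0.
  by move=> _; rewrite lee_fin ler_wpM2l// work_le// (cnt_le hn)// (le_trans s0).
rewrite (le_trans (ltW hK))// -[leLHS]add0e leeD//.
by apply: nneseries_ge0 => x _ _; exact: gwork_ge0.
Unshelve. all: end_near. Qed.

Lemma clk_right t (e : R) : (forall t, 0 <= t -> (clk t < +oo)%E) ->
  0 <= t -> 0 < e -> exists2 s, t < s & (clk s <= clk t + e%:E)%E.
Proof.
move=> fin t0 e0.
have t10 : 0 <= t + 1 by rewrite addr_ge0.
have [K hK] := clk_approx t10 (fin _ t10) e0.
have nK : \forall s \near t^'+, forall x : 'I_K, n x s = n x t.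
  by apply: filter_forall => x; exact: (cnt_rc hn).
near t^'+ => s.
have ts : t < s by near: s; exact: nbhs_right_gt.
have sT : s <= t + 1 by near: s; apply: nbhs_right_le; rewrite ltrDl.
have H : forall x : 'I_K, n x s = n x t by near: s.
exists s => //; apply: (hK t s t0 (ltW ts) sT).
by move=> x xK; rewrite (H (Ordinal xK)).
Unshelve. all: end_near. Qed.

(** The hypothesis on counts says that no state has an event at [t]; elsewhere the clock does not
    jump. *)
Lemma clk_left t (e : R) : (forall t, 0 <= t -> (clk t < +oo)%E) ->
  0 < t -> (forall x, exists2 s, 0 <= s < t & n x s = n x t) -> 0 < e ->
  exists2 s, 0 <= s < t & (clk t <= clk s + e%:E)%E.
Proof.
move=> fin t0 cst e0.
have [K hK] := clk_approx (ltW t0) (fin _ (ltW t0)) e0.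
suff [s /andP[s0 st] H] : exists2 s, 0 <= s < t &
    forall x, (x < K)%N -> n x s = n x t.
  by exists s; rewrite ?s0//; apply: hK => //; exact: ltW.
elim: K {hK} => [|K [s /andP[s0 st] IH]]; first by exists 0; rewrite ?lexx.
have [u /andP[u0 ut] hu] := cst K.
exists (Num.max s u); first by rewrite le_max s0 gt_max st.
move=> x; rewrite ltnS leq_eqVlt => /orP[/eqP->|xK]; apply/eqP; rewrite eqn_leq.
  rewrite (cnt_le hn) ?le_max ?s0 ?ge_max ?(ltW st) ?(ltW ut)//=.
  by rewrite -hu (cnt_le hn)// le_max lexx orbT.
rewrite (cnt_le hn) ?le_max ?s0 ?ge_max ?(ltW st) ?(ltW ut)//=.
by rewrite -(IH _ xK) (cnt_le hn)// le_max lexx.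
Qed.

End clk.
End Clock.

(** * Visits *)

Section Intervals.
Context (R : realType).
Implicit Types (g : nat -> R) (n : nat -> R -> nat) (tau : nat -> nat -> R).

(** An enumeration of the nonnegative rationals, indexed by [nat] so that suprema along it are
    measurable and almost sure statements can be intersected over it. *)
Definition qdense (k : nat) : R :=
  if (choice.unpickle k : option (nat * nat)) is Some (i, j) then i%:R / j.+1%:R else 0.

Lemma qdense_ge0 k : 0 <= qdense k.
Proof. by rewrite /qdense; case: choice.unpickle => [[i j]|]. Qed.

Lemma qdenseP (s t : R) : 0 <= s -> s < t -> exists k, s < qdense k < t.
Proof.
move=> s0 /rat_in_itvoo[q]; rewrite in_itv/= => /andP[sq qt].
have q0 : 0 < ratr q :> R by exact: le_lt_trans sq.
have : 0 < q by rewrite ltr0q in q0.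
rewrite -numq_gt0 => nq0.
exists (choice.pickle (`|numq q|%N, (`|denq q|%N).-1)).
rewrite /qdense choice.pickleK prednK ?absz_gt0 ?denq_eq0//.
have -> : `|numq q|%:R / `|denq q|%:R = ratr q :> R.
  rewrite /ratr !pmulrn !gez0_abs ?(ltW nq0)//.
by rewrite sq qt.
Qed.

(** [reg_inf] lets the clock pass every time, and [reg_simple] makes distinct visits disjoint. *)
Record regular g n tau : Prop := {
  reg_cnt : counting n;
  reg_tau : forall x i, 0 <= tau x i;
  reg_fin : forall t, 0 <= t -> (clk g n tau t < +oo)%E;
  reg_inf : forall M : R, exists2 t, 0 <= t & (M%:E <= clk g n tau t)%E;
  reg_simple : forall x y i j, evt n x i.+1 = evt n y j.+1 -> x = y /\ i = j }.

(** Kept apart from [regular], which must also be established for the modified holding times of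
    [drop_first]. *)
Definition clk_strict g n tau :=
  forall s t, 0 <= s -> s < t -> (clk g n tau s < clk g n tau t)%E.

(* The (j+1)-st visit to [x] occupies [[vstart x j, vend x j)]; taking the
   extrema along the dense sequence [qdense] makes both ends measurable. *)
Definition vstart g n tau (x j : nat) : R :=
  fine (esups (fun k => if (n x (qdense k) <= j)%N
                        then clk g n tau (qdense k) else 0%E) 0).

Definition vend g n tau (x j : nat) : R :=
  fine (einfs (fun k => if (j < n x (qdense k))%N
                        then clk g n tau (qdense k) else +oo%E) 0).

Section det.
Variables (g : nat -> R) (n : nat -> R -> nat) (tau : nat -> nat -> R).
Hypotheses (g0 : forall x, 0 <= g x) (H : regular g n tau).
Local Notation clk := (clk g n tau).
Local Notation evt := (evt n).
Local Notation a := (vstart g n tau).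
Local Notation b := (vend g n tau).

Let hn := reg_cnt H.
Let tau0 := reg_tau H.
Let clkle := clk_le g0 tau0 hn.
Let clkge0 := clk_ge0 n g0 tau0.

Let clkfin t : 0 <= t -> clk t \is a fin_num.
Proof. by move=> t0; rewrite ge0_fin_numE// reg_fin. Qed.

Let G t := fine (clk t).
Let GE t : 0 <= t -> clk t = (G t)%:E.
Proof. by move=> t0; rewrite fineK// clkfin. Qed.

Let S x j := esups (fun k => if (n x (qdense k) <= j)%N
                        then clk (qdense k) else 0%E) 0.

Let S_le x j (M : \bar R) : (0 <= M)%E ->
  (forall s, 0 <= s -> s < evt x j.+1 -> (clk s <= M)%E) -> (S x j <= M)%E.
Proof.
move=> M0 h; apply: ge_ereal_sup => _ /= [k _ <-]; case: ifPn => // nj.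
by apply: h; [exact: qdense_ge0|rewrite (lt_evt hn) ?ltnS ?qdense_ge0].
Qed.

Let S_ge x j s : 0 <= s -> s < evt x j.+1 -> (clk s <= S x j)%E.
Proof.
move=> s0 /(qdenseP s0)[k /andP[sk ke]].
have k0 := qdense_ge0 k.
apply: (le_trans (clkle s0 (ltW sk))); apply: ereal_sup_ubound => /=.
by exists k => //=; rewrite -ltnS -(lt_evt hn)// ke.
Qed.

Let vstartE x j : (a x j)%:E = S x j.
Proof.
rewrite fineK// ge0_fin_numE; last first.
  by apply: (le_trans _ (S_ge (lexx 0) (evt_gt0 hn x j))).
apply: (@le_lt_trans _ _ (clk (evt x j.+1))); last exact: reg_fin (evt_ge0 hn _ _).
by apply: S_le => // s s0 se; exact: clkle s0 (ltW se).
Qed.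

Lemma vstart_ge0 x j : 0 <= a x j.
Proof.
rewrite -lee_fin vstartE; exact: (le_trans _ (S_ge (lexx 0) (evt_gt0 hn x j))).
Qed.

(** Together with [vstart_le], this characterizes [vstart] as the left limit of the clock at the
    event. *)
Lemma clk_vstart x j s : 0 <= s -> s < evt x j.+1 -> (clk s <= (a x j)%:E)%E.
Proof. by move=> s0 se; rewrite vstartE S_ge. Qed.

Lemma vstart_le x j t : 0 <= t ->
  (forall s, 0 <= s -> s < evt x j.+1 -> (clk s <= t%:E)%E) -> a x j <= t.
Proof. by move=> t0 h; rewrite -lee_fin vstartE S_le// lee_fin. Qed.

(** Right-continuity of the clock makes the infimum over later rational times equal to the value at
    the event. *)
Lemma vendE x j : (b x j)%:E = clk (evt x j.+1).
Proof.
have e0 := evt_ge0 hn x j.+1.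
suff E : einfs (fun k => if (j < n x (qdense k))%N
    then clk (qdense k) else +oo%E) 0 = clk (evt x j.+1).
  by rewrite /vend E -GE.
apply/eqP; rewrite eq_le; apply/andP; split; last first.
  apply: le_ereal_inf_tmp => _ /= [k _ <-]; case: ifPn; last by rewrite leey.
  by rewrite -(evt_le hn) ?qdense_ge0// => /(clkle e0).
apply/lee_addgt0Pr => e epos.
have [s es hs] := clk_right g0 tau0 hn (reg_fin H) e0 epos.
have [k /andP[ek ks]] := qdenseP e0 es.
apply: (le_trans _ hs); apply: (le_trans _ (clkle (qdense_ge0 k) (ltW ks))).
apply: ereal_inf_lbound => /=; exists k => //.
by rewrite -(evt_le hn) ?qdense_ge0// ltW.
Qed.

Definition visit x j t := a x j <= t < b x j.

Lemma visit_evt x j s t : visit x j t -> 0 <= s -> (clk s <= t%:E)%E -> s < evt x j.+1.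
Proof.
move=> /andP[_ tb] s0 st; rewrite ltNge; apply/negP => es.
have := clkle (evt_ge0 hn _ _) es; rewrite -vendE => /le_trans/(_ st).
by rewrite lee_fin leNgt tb.
Qed.

(** If one event preceded the other, the clock at the earlier one, which is the end of its visit,
    would not exceed the start of the other visit. *)
Lemma visit_inj x y i j t : visit x i t -> visit y j t -> x = y /\ i = j.
Proof.
move=> hx hy; apply: (reg_simple H); apply/eqP; rewrite eq_le !leNgt.
apply/andP; split; apply/negP => lt.
- have /andP[ax bx] := hx; have := clk_vstart (evt_ge0 hn _ _) lt.
  by rewrite -vendE lee_fin => /le_trans/(_ ax); case/andP: hy => _; rewrite ltNge => /negP.
- have /andP[ax bx] := hy; have := clk_vstart (evt_ge0 hn _ _) lt.
  by rewrite -vendE lee_fin => /le_trans/(_ ax); case/andP: hx => _; rewrite ltNge => /negP.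
Qed.

Lemma vstart_locfin x (T : R) : exists J, forall j, a x j <= T -> (j < J)%N.
Proof.
have [r r0 hr] := reg_inf H (T + 1); exists (n x r) => j aT.
rewrite -(evt_le hn)// leNgt; apply/negP => /(clk_vstart r0).
rewrite leNgt => /negP; apply; apply: lt_le_trans hr.
by rewrite lte_fin (le_lt_trans aT)// ltrDl.
Qed.

(** The supremum [r] of the arguments at which the clock is at most [t] does it: a clock jumping
    over [t] at [r] would jump because of an event, whose visit would cover [t]. *)
Lemma unvisited_clk t : 0 <= t -> (forall x j, ~~ visit x j t) ->
  exists2 r, 0 <= r & clk r = t%:E.
Proof.
move=> t0 nv; pose A := [set r : R | 0 <= r /\ (clk r <= t%:E)%E].
have A0 : A 0 by split; rewrite // (clk0 g tau hn) lee_fin.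
have [u u0 hu] := reg_inf H (t + 1).
have ubA : ubound A u.
  move=> r [r0 rt]; rewrite leNgt; apply/negP => /ltW/(clkle u0).
  move=> /(le_trans hu)/le_trans/(_ rt); rewrite lee_fin leNgt ltrDl.
  by rewrite ltr01.
have supA : has_sup A by split; [exists 0|exists u].
pose r := sup A.
have r0 : 0 <= r by apply: ub_le_sup => //; exists u.
have below s : 0 <= s -> s < r -> (clk s <= t%:E)%E.
  move=> s0; rewrite -subr_gt0 => d.
  have [v [v0 vt]] := sup_adherent d supA.
  by rewrite /r opprB addrC subrK => sv; apply: le_trans vt; exact: clkle s0 (ltW sv).
exists r => //; apply/eqP; rewrite eq_le; apply/andP; split.
- rewrite leNgt; apply/negP => tr; suff : (clk r <= t%:E)%E by rewrite leNgt tr.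
  have rpos : 0 < r.
    rewrite lt_neqAle r0 andbT; apply/negP => /eqP re; move: tr.
    by rewrite -re (clk0 g tau hn) lte_fin ltNge t0.
  (* A count that changes at [r] would make [r] an event with a visit covering [t]; hence no count
     changes and [clk_left] applies. *)
  have cst x : exists2 s, 0 <= s < r & n x s = n x r.
    have [//|ne] := pselect (exists2 s, 0 <= s < r & n x s = n x r).
    have [s /andP[s0 sr]|j rE] := @jump_evt _ n hn x r rpos.
      rewrite ltn_neqAle (cnt_le hn _ s0 (ltW sr)) andbT; apply/negP => /eqP E.
      by apply: ne; exists s; rewrite ?s0.
    have := nv x j; rewrite /visit -lte_fin vendE -rE tr andbT => /negP[].
    by apply: vstart_le => // s s0; rewrite -rE => sr; exact: below.
  apply/lee_addgt0Pr => e e0.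
  have [s /andP[s0 sr] hs] := clk_left g0 tau0 hn (reg_fin H) rpos cst e0.
  by apply: (le_trans hs); rewrite leeD2r// below.
- apply/lee_addgt0Pr => e e0.
  have [s rs hs] := clk_right g0 tau0 hn (reg_fin H) r0 e0.
  apply: le_trans hs; rewrite leNgt; apply/negP => st.
  have : s <= r by apply: ub_le_sup; [exists u|split; [exact: le_trans (ltW rs)|exact: ltW]].
  by rewrite leNgt rs.
Qed.

(** A lower bound on the length suffices: in [visited_upto] the disjoint visits have to fit into the
    range of the clock. *)
Lemma visit_len x j : a x j + g x * tau x j <= b x j.
Proof.
have e0 := evt_ge0 hn x j.+1.
have step s : 0 <= s -> s < evt x j.+1 ->
    (clk s + (g x * tau x j)%:E <= clk (evt x j.+1))%E.
  move=> s0 se; apply: clk_jump => //; first exact: ltW.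
  by rewrite -ltnS -(lt_evt hn)// se (evt_cnt hn).
rewrite -lerBrDr; apply: vstart_le.
  rewrite subr_ge0 -lee_fin vendE; apply: le_trans (step _ (lexx 0) (evt_gt0 hn _ _)).
  by rewrite (clk0 g tau hn) add0e.
by move=> s s0 se; rewrite EFinB leeBrDr// vendE; exact: step.
Qed.

Section strict.
Hypothesis strict : clk_strict g n tau.

(** Every state is left through infinity. The clock increases strictly between two events, so its
    value midway separates the end of one visit from the start of the next. This supplies the
    condition in (A4) that the segment after the exit starts away from [x]. *)
Lemma vend_unvisited x j y k : ~~ visit y k (b x j).
Proof.
apply/negP => v; have e0 := evt_ge0 hn x j.+1.
have lt := visit_evt v e0; rewrite -vendE lexx in lt; have {}lt := lt isT.
have m0 : 0 <= (evt x j.+1 + evt y k.+1) / 2 by rewrite divr_ge0// addr_ge0// (evt_ge0 hn).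
have [mx my] : evt x j.+1 < (evt x j.+1 + evt y k.+1) / 2 /\
   (evt x j.+1 + evt y k.+1) / 2 < evt y k.+1 by split; lra.
have := strict e0 mx; rewrite ltNge -vendE => /negP; apply.
by apply: le_trans (clk_vstart m0 my) _; rewrite lee_fin; case/andP: v.
Qed.

Lemma vstart_gt0 x j : 0 < a x j.
Proof.
have e0 := evt_gt0 hn x j.
have [m0 me] : 0 < evt x j.+1 / 2 /\ evt x j.+1 / 2 < evt x j.+1 by split; lra.
rewrite -lte_fin; apply: (lt_le_trans _ (clk_vstart (ltW m0) me)).
by have := strict (lexx 0) m0; rewrite (clk0 g tau hn).
Qed.

Lemma strict_event s t : 0 <= s -> s < t -> exists x, (n x s < n x t)%N.
Proof.
move=> s0 st; apply/not_existsP => h.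
have := strict s0 st; rewrite ltNge => /negP; apply.
apply: lee_nneseries => x; first by move=> _ _; exact: gwork_ge0.
move=> _; rewrite lee_fin ler_wpM2l// work_le// leqNgt; apply/negP; exact: h.
Qed.

(** An unvisited [s] is a value of the clock. By strictness some event follows immediately, and by
    right-continuity its visit ends before [t]. *)
Lemma visit_dense s t : (forall x j, 0 < g x * tau x j) -> 0 <= s -> s < t ->
  exists x j u, s <= u <= t /\ visit x j u.
Proof.
move=> gt0 s0 st; have [[x [j v]]|nv] := pselect (exists x j, visit x j s).
  by exists x, j, s; rewrite lexx ltW.
have [|r r0 rE] := unvisited_clk s0.
  by move=> x j; apply/negP => v; apply: nv; exists x, j.
have ts0 : 0 < t - s by rewrite subr_gt0.
have [r' rr' hr'] := clk_right g0 tau0 hn (reg_fin H) r0 ts0.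
have [x hx] := strict_event r0 rr'; exists x, (n x r), (a x (n x r)).
have rlt : r < evt x (n x r).+1 by rewrite (lt_evt hn).
have ab : a x (n x r) < b x (n x r).
  by apply: lt_le_trans (visit_len _ _); rewrite ltrDl.
rewrite /visit lexx ab; split => //; apply/andP; split.
  by rewrite -lee_fin -rE clk_vstart.
rewrite (le_trans (ltW ab))// -lee_fin vendE.
apply: (@le_trans _ _ (clk r')).
  by apply: clkle; rewrite ?(evt_ge0 hn)// (evt_le hn)// (le_trans r0 (ltW rr')).
by rewrite (le_trans hr')// rE -EFinD addrC subrK.
Qed.

End strict.

End det.
End Intervals.

Section Visits.
Context (R : realType).
Variables (g : nat -> R) (n : nat -> R -> nat) (tau : nat -> nat -> R).
Hypotheses (g0 : forall x, 0 <= g x) (H : regular g n tau).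
Local Notation clk := (clk g n tau).
Local Notation evt := (evt n).
Local Notation a := (vstart g n tau).
Local Notation b := (vend g n tau).
Local Notation mu := (@lebesgue_measure R).

Let hn := reg_cnt H.
Let tau0 := reg_tau H.

(** The limit in the definition of [Kprocess] exists because the clock is monotone and finite;
    [visitP] then translates the condition there into [visit]. *)
Lemma lim_clk_le x j (t : R) :
  (lim (clk s @[s --> (evt x j.+1)^'-]) <= t%:E)%E <->
  (forall s, 0 <= s -> s < evt x j.+1 -> (clk s <= t%:E)%E).
Proof.
set e := evt x j.+1; have e0 : 0 < e := evt_gt0 hn x j.
have fin s : 0 <= s -> clk s \is a fin_num.
  by move=> s0; rewrite ge0_fin_numE ?(reg_fin H)// clk_ge0.
have mono s u : 0 <= s -> s <= u -> fine (clk s) <= fine (clk u).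
  by move=> s0 su; rewrite fine_le ?fin ?clk_le// (le_trans s0).
have near0 : \forall s \near e^'-, 0 <= s by apply: nbhs_left_ge.
have cv : cvg (clk s @[s --> e^'-]).
  have h : cvg ((fine \o clk) s @[s --> e^'-]).
    apply: nondecreasing_at_left_is_cvgr.
    - apply: filterS near0 => s s0 u v; rewrite !in_itv/= => /andP[su _] /andP[sv _] uv /=.
      by apply: mono => //; exact: le_trans (ltW su).
    - apply: filterS near0 => s s0.
      exists (fine (clk e)) => _ [u /= + <-]; rewrite in_itv/= => /andP[su ue].
      by apply: mono; [exact: le_trans (ltW su)|exact: ltW].
  apply/cvg_ex; exists (lim ((fine \o clk) s @[s --> e^'-]))%:E.
  apply: cvg_EFin => //; exact: filterS near0.
split=> [le s s0 se|h].
  apply: le_trans le; apply: lime_ge => //; near=> u.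
  apply: clk_le => //; near: u; exact: nbhs_left_ge.
apply: lime_le => //; apply: filterS2 near0 (nbhs_left_lt e) => s; exact: h.
Unshelve. all: end_near. Qed.

Lemma visitP x j (t : R) : 0 <= t ->
  ((lim (clk s @[s --> (evt x j.+1)^'-]) <= t%:E)%E /\
   (t%:E < clk (evt x j.+1))%E) <-> visit g n tau x j t.
Proof.
move=> t0; rewrite /visit -lte_fin (vendE g0 H); split=> [[/lim_clk_le h ->]|].
  by rewrite andbT (vstart_le g0 H).
move=> /andP[at_ ->]; split => //; apply/lim_clk_le => s s0 se.
by apply: le_trans (clk_vstart g0 H s0 se) _; rewrite lee_fin.
Qed.

Let I x j : set R := `[a x j, b x j[%classic.

Let IE x j t : I x j t = visit g n tau x j t :> Prop.
Proof. by rewrite /I /= in_itv. Qed.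

Let mI x j : measurable (I x j). Proof. exact: measurable_itv. Qed.

(** The visits whose events occur up to the clock argument [r] are disjoint, lie in [[0, clk r)],
    and by [visit_len] have total length at least [clk r]. They therefore exhaust this interval up
    to a null set. *)
Let visited_upto r : 0 <= r ->
  mu (`[0, fine (clk r)[%classic `\` \bigcup_x \bigcup_j I x j) = 0%E.
Proof.
move=> r0; set G := fine _.
have fin : clk r \is a fin_num by rewrite ge0_fin_numE ?(reg_fin H)// clk_ge0.
have G0 : 0 <= G by rewrite fine_ge0// clk_ge0.
pose U x := \big[setU/set0]_(j < n x r) I x j.
have mU x : measurable (U x) by exact: bigsetU_measurable.
have UI x t : U x t -> exists2 j, (j < n x r)%N & visit g n tau x j t.
  by rewrite /U -bigcup_mkord => -[j /= jn]; rewrite IE; exists j.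
have tU : trivIset setT U.
  move=> x y _ _ [t [/UI[i _ hi] /UI[j _ hj]]].
  by have [] := visit_inj g0 H hi hj.
have tI x : trivIset setT (I x).
  move=> i j _ _ [t []]; rewrite !IE => hi hj.
  by have [] := visit_inj g0 H hi hj.
have UG : \bigcup_x U x `<=` `[0, G[%classic.
  move=> t [x _ /UI[j jn v]]; rewrite /= in_itv/=; apply/andP; split.
    by apply: le_trans (vstart_ge0 g0 H x j) _; case/andP: v.
  case/andP: v => _ tb; apply: lt_le_trans tb _.
  rewrite -lee_fin (vendE g0 H) [leRHS]fineK//; apply: clk_le => //; first exact: evt_ge0.
  by rewrite evt_le.
have geI x j : ((g x * tau x j)%:E <= mu (I x j))%E.
  rewrite /I lebesgue_measure_itv/= lte_fin.
  have := visit_len g0 H x j; case: ltP => [_ h|ba h].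
    by rewrite lee_fin lerBrDl.
  by rewrite lee_fin -(lerD2l (a x j)) addr0 (le_trans h).
have geG : (G%:E <= mu (\bigcup_x U x))%E.
  rewrite fineK// measure_semi_bigcup//; last exact: bigcupT_measurable.
  apply: lee_nneseries => x; first by move=> _ _; exact: gwork_ge0.
  move=> _; rewrite /U measure_bigsetU; [|exact: mI|exact: tI].
  rewrite /work mulr_sumr -sumEFin.
  by apply: lee_sum => j _; exact: geI.
apply/eqP; rewrite eq_le measure_ge0 andbT.
have mUU : measurable (\bigcup_x U x) by exact: bigcupT_measurable.
have GE : mu `[0, G[%classic = G%:E.
  rewrite lebesgue_measure_itv/= lte_fin; case: ltP => [_|]; first by rewrite oppr0 adde0.
  by move=> G0'; congr EFin; apply/eqP; rewrite eq_le G0 G0'.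
apply: (@le_trans _ _ (mu (`[0, G[%classic `\` \bigcup_x U x))).
  apply: le_measure; rewrite ?inE.
  - by apply: measurableD => //; do 2 apply: bigcupT_measurable => ?; exact: mI.
  - exact: measurableD.
  - move=> t [tG nt]; split => // -[x _ /UI[j _ v]]; apply: nt.
    by exists x => //; exists j => //; rewrite IE.
have key (u v : \bar R) : u = G%:E -> (G%:E <= v)%E -> (u - v <= 0)%E.
  move=> ->; case: v => [v| |]; rewrite ?leeNy_eq // -?EFinB ?lee_fin ?subr_le0 //.
  by move=> _; rewrite leNye.
rewrite measureD//; last exact: (eq_ind_r (fun z => (z < +oo)%E) (ltry G) GE).
by rewrite (setIidr UG); exact: key GE geG.
Qed.

Lemma visited_full : mu (`[0, +oo[%classic `\`
  \bigcup_x \bigcup_j [set` `[a x j, b x j[]) = 0%E.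
Proof.
have /choice[r hr] : forall k : nat, exists r, 0 <= r /\ (k%:R%:E <= clk r)%E.
  by move=> k; have [r r0 hr] := reg_inf H k%:R; exists r.
suff : mu.-negligible (`[0, +oo[%classic `\` \bigcup_x \bigcup_j I x j).
  move/negligibleP => -> //; apply: measurableD => //.
  by do 2 apply: bigcupT_measurable => ?; exact: mI.
have N : mu.-negligible (\bigcup_k (`[0, fine (clk (r k))[%classic `\` \bigcup_x \bigcup_j I x j)).
  apply: negligible_bigcup => k; apply/negligibleP; last exact: visited_upto (hr k).1.
  by apply: measurableD => //; do 2 apply: bigcupT_measurable => ?; exact: mI.
apply: negligibleS N => t [/=]; rewrite in_itv/= andbT => t0 nt.
have [k _ tk] : exists2 k, True & t < k%:R.
  by exists (Num.truncn t).+1; rewrite // truncnS_gt.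
exists k => //; split => //=; rewrite in_itv/= t0/= (lt_le_trans tk)//.
have [r0 h] := hr k.
by rewrite -lee_fin fineK// ge0_fin_numE ?(reg_fin H)// clk_ge0.
Qed.

End Visits.

(** * Removing the first holding time of a state *)

Section Removal.
Context (R : realType).
Variables (g : nat -> R) (n : nat -> R -> nat) (tau : nat -> nat -> R).
Hypotheses (g0 : forall x, 0 <= g x) (H : regular g n tau).
Hypothesis strict : clk_strict g n tau.

(** The modified clock does not involve the first holding time of [x]; from the first event of [x]
    on, the original clock is its translate by that holding time multiplied by [g x]. *)
Definition drop_first (x : nat) (tau : nat -> nat -> R) (y i : nat) : R :=
  if (y == x) && (i == 0%N) then 0 else tau y i.

Lemma clk_drop_first x r : clk g n tau r = (clk g n (drop_first x tau) r +
  (if (0 < n x r)%N then g x * tau x 0 else 0)%:E)%E.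
Proof.
set c := (if _ then _ else _).
have c0 : 0 <= c by rewrite /c; case: ifP => // _; rewrite mulr_ge0// (reg_tau H).
have d0 y i : 0 <= drop_first x tau y i.
  by rewrite /drop_first; case: ifP => // _; exact: reg_tau H y i.
pose f y : \bar R := (if y == x then c else 0)%:E.
have f0 y : (0 <= f y)%E by rewrite lee_fin; case: ifP.
have <- : (\sum_(0 <= y <oo) f y)%E = c%:E.
  rewrite (nneseriesD1 (n := x))//= /f eqxx eseries0 ?adde0//.
  by move=> y _ /= /negPf ->.
rewrite /clk -(nneseriesD (fun y _ _ => gwork_ge0 n g0 d0 y r) (fun y _ _ => f0 y)).
apply: eq_eseriesr => y _; rewrite /f -EFinD; congr EFin.
case: eqP => [->|/eqP yx]; last first.
  rewrite addr0; congr (_ * _); apply: eq_bigr => i _.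
  by rewrite /drop_first (negPf yx).
rewrite /c /work; case: (n x r) => [|m]; first by rewrite !big_ord0 addr0.
rewrite !big_ord_recl /= [drop_first x tau x 0]/drop_first !eqxx add0r mulrDr addrC.
congr (_ * _ + _); by apply: eq_bigr => i _; rewrite /drop_first eqxx.
Qed.

Lemma regular_drop_first x : regular g n (drop_first x tau).
Proof.
split.
- exact: reg_cnt H.
- by move=> y i; rewrite /drop_first; case: ifP => // _; exact: reg_tau H y i.
- move=> t t0; apply: le_lt_trans (reg_fin H t0); rewrite (clk_drop_first x).
  by rewrite leeDl// lee_fin; case: ifP => // _; rewrite mulr_ge0// (reg_tau H).
- move=> M; have [t t0 h] := reg_inf H (M + g x * tau x 0); exists t => //.
  move: h; rewrite EFinD (clk_drop_first x) => h.
  rewrite -(leeD2rE (x := (g x * tau x 0)%:E))//; apply: (le_trans h).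
  by rewrite leeD2l// lee_fin; case: ifP => // _; rewrite mulr_ge0// (reg_tau H).
- exact: reg_simple H.
Qed.

(* At an unvisited [t] the clock takes the value [t]; any state [x] with an
   earlier event has its first holding time contributing to it. *)
Lemma unvisited_drop_first t : 0 < t -> (forall x j, ~~ visit g n tau x j t) ->
  exists x, 0 <= t - g x * tau x 0 /\
    forall y j, ~~ visit g n (drop_first x tau) y j (t - g x * tau x 0).
Proof.
move=> t0 nv; have [r r0 hr] := unvisited_clk g0 H (ltW t0) nv.
have rpos : 0 < r.
  rewrite lt_neqAle r0 andbT; apply/negP => /eqP re; move: hr.
  by rewrite -re (clk0 g tau (reg_cnt H)) => -[] t0'; rewrite -t0' ltxx in t0.
have [x] := strict_event g0 H strict (lexx 0) rpos.
rewrite (cnt0 (reg_cnt H)) => nx; exists x.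
have H' := regular_drop_first x.
have cE s : r <= s -> clk g n tau s = (clk g n (drop_first x tau) s + (g x * tau x 0)%:E)%E.
  by move=> rs; rewrite (clk_drop_first x) (leq_trans nx)// (cnt_le (reg_cnt H)).
have rE : clk g n (drop_first x tau) r = (t - g x * tau x 0)%:E.
  by rewrite EFinB -hr cE// addeK.
split=> [|y j].
  by rewrite -lee_fin -rE clk_ge0//; exact: reg_tau H'.
(* Such a visit would keep the modified clock constant between [r] and its event, hence also the
   original one, against strictness. *)
apply/negP => v.
have lt : r < evt n y j.+1 by apply: (visit_evt g0 H' v r0); rewrite rE.
have [m1 m2] : r < (r + evt n y j.+1) / 2 /\ (r + evt n y j.+1) / 2 < evt n y j.+1.
  by split; lra.
have m0 := ltW (le_lt_trans r0 m1).
have := strict r0 m1; rewrite ltNge => /negP; apply.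
rewrite (cE _ (ltW m1)) (cE _ (lexx r)) leeD2r// rE.
apply: le_trans (clk_vstart g0 H' m0 m2) _; rewrite lee_fin.
by case/andP: v.
Qed.

End Removal.

(** * Paths described by visits *)

Section Paths.
Context (R : realType).

(** The interface through which the path arguments see the K-process; it mentions neither clock nor
    events. *)
Record visits_ok (a b : nat -> nat -> R) : Prop := {
  vis_start : forall x j, 0 < a x j;
  vis_inj : forall x y i j t, a x i <= t < b x i -> a y j <= t < b y j ->
    x = y /\ i = j;
  vis_locfin : forall x T, exists J, forall j, a x j <= T -> (j < J)%N;
  vis_end : forall x j y k, ~~ (a y k <= b x j < b y k);
  vis_dense : forall s t, 0 <= s -> s < t ->
    exists x j u, s <= u <= t /\ a x j <= u < b x j }.

Definition describes (a b : nat -> nat -> R) (Y : R -> nbar) :=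
  forall t x, 0 <= t -> (Y t = Some x <-> exists j, a x j <= t < b x j).

(** Only finitely many states are at distance at least [e] from infinity, so it suffices to leave
    each state separately. *)
Lemma nbar_dist_None_cvg (F : set_system R) (FF : Filter F) (Y : R -> nbar) :
  (forall x, \forall s \near F, Y s <> Some x) ->
  nbar_dist R (Y s) None @[s --> F] --> (0 : R).
Proof.
move=> h; apply/cvgrPdist_le => e e0.
have [N _ hN] : exists2 N, True & N.+1%:R^-1 < e.
  exists (Num.truncn e^-1) => //.
  by rewrite -[ltRHS]invrK ltf_pV2 ?posrE ?invr_gt0// truncnS_gt.
have : \forall s \near F, forall x : 'I_N, Y s <> Some (x : nat).
  by apply: filter_forall => x; exact: h.
apply: filterS => s hs; rewrite /nbar_dist /= subr0 sub0r normrN normr_id.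
case E : (Y s) => [x|]; last by rewrite normr0 ltW.
rewrite /= ger0_norm//; apply: le_trans (ltW hN).
rewrite lef_pV2 ?posrE// ler_nat ltnS leqNgt; apply/negP => xN.
by apply: (hs (Ordinal xN)).
Qed.

Section path.
Variables (a b : nat -> nat -> R) (ok : visits_ok a b).
Variables (Y : R -> nbar) (hY : describes a b Y).

(** Finitely many visits to [x] start before [t + 1], and each of them misses a right neighbourhood
    of [t]. *)
Lemma near_right_other t x : 0 <= t -> Y t <> Some x ->
  \forall s \near t^'+, Y s <> Some x.
Proof.
move=> t0 nt; have [J hJ] := vis_locfin ok x (t + 1).
have : \forall s \near t^'+, forall j : 'I_J, ~~ (a x j <= s < b x j).
  apply: filter_forall => j.
  have : ~~ (a x j <= t < b x j).
    by apply/negP => h; apply: nt; apply/(hY _ t0); exists j.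
  rewrite negb_and -ltNge -leNgt => /orP[ta|bt].
    by apply: filterS (nbhs_right_lt ta) => s sa; rewrite negb_and -ltNge sa.
  apply: filterS (nbhs_right_gt t) => s ts.
  by rewrite negb_and -leNgt orbC (le_trans bt (ltW ts)).
have t1 : t < t + 1 by rewrite ltrDl.
move=> h; near=> s => /hY[|j vj].
  by apply: (le_trans t0); near: s; exact: nbhs_right_ge.
have jJ : (j < J)%N.
  apply: hJ; case/andP: vj => /le_trans + _; apply.
  by near: s; exact: nbhs_right_le.
move: vj; apply/negP.
have H : forall j : 'I_J, ~~ (a x j <= s < b x j) by near: s.
exact: H (Ordinal jJ).
Unshelve. all: end_near. Qed.

(** The dichotomy is whether [t] lies in some half-open interval [(a x j, b x j]]. It yields the
    left limit: a state in the first case, infinity in the second. *)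
Lemma near_left_visit t : 0 < t -> (exists x, \forall s \near t^'-, Y s = Some x) \/
  (forall x, \forall s \near t^'-, Y s <> Some x).
Proof.
move=> t0; have [[x [j /andP[at_ tb]]]|nv] := pselect (exists x j, a x j < t <= b x j).
  left; exists x; near=> s; apply/hY.
    by near: s; exact: nbhs_left_ge.
  exists j; apply/andP; split; first by near: s; exact: nbhs_left_ge.
  by apply: lt_le_trans tb; near: s; exact: nbhs_left_lt.
right=> x; have [J hJ] := vis_locfin ok x t.
have : \forall s \near t^'-, forall j : 'I_J, ~~ (a x j <= s < b x j).
  apply: filter_forall => j.
  have : ~~ (a x j < t <= b x j).
    by apply/negP => h; apply: nv; exists x, j.
  rewrite negb_and -ltNge -leNgt => /orP[ta|bt].
    apply: filterS (nbhs_left_lt t) => s st.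
    by rewrite negb_and -ltNge (lt_le_trans st ta).
  by apply: filterS (nbhs_left_ge bt) => s bs; rewrite negb_and -leNgt orbC bs.
move=> h; near=> s => /hY[|j vj].
  by near: s; exact: nbhs_left_ge.
have jJ : (j < J)%N.
  apply: hJ; case/andP: vj => /le_trans + _; apply.
  by near: s; exact: nbhs_left_le.
move: vj; apply/negP.
have H : forall j : 'I_J, ~~ (a x j <= s < b x j) by near: s.
exact: H (Ordinal jJ).
Unshelve. all: end_near. Qed.

Lemma describes_cadlag : cadlag Y.
Proof.
split=> t t0.
  case E : (Y t) => [x|].
    have /(hY _ t0)[j /andP[at_ tb]] := E.
    suff h : \forall s \near t^'+, nbar_dist R (Y s) (Some x) = 0.
      by apply: cvg_near_cst; apply: filterS h => s ->.
    near=> s; suff -> : Y s = Some x by rewrite /nbar_dist subrr normr0.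
    have ts : t <= s by near: s; exact: nbhs_right_ge.
    apply/hY; first exact: le_trans ts.
    exists j; rewrite (le_trans at_ ts)/=; near: s; exact: nbhs_right_lt.
  by apply: nbar_dist_None_cvg => x; apply: near_right_other => //; rewrite E.
have [[x h]|h] := near_left_visit t0.
  exists (Some x); apply: cvg_near_cst; apply: filterS h => s ->.
  by rewrite /nbar_dist subrr normr0.
by exists None; exact: nbar_dist_None_cvg.
Unshelve. all: end_near. Qed.

End path.

Lemma cvg_affine_right (c e t : R) : 0 < c ->
  (fun s => c * s + e) @ t^'+ --> (c * t + e)^'+.
Proof.
move=> c0 A [d /= d0 hA]; exists (d / c); first by rewrite /= divr_gt0.
move=> s /= ts lts; apply: hA => /=; last by rewrite ltrD2r ltr_pM2l.
rewrite opprD addrACA subrr addr0 -mulrBr normrM gtr0_norm//.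
by rewrite mulrC -ltr_pdivlMr.
Qed.

Lemma cvg_affine_left (c e t : R) : 0 < c ->
  (fun s => c * s + e) @ t^'- --> (c * t + e)^'-.
Proof.
move=> c0 A [d /= d0 hA]; exists (d / c); first by rewrite /= divr_gt0.
move=> s /= ts lts; apply: hA => /=; last by rewrite ltrD2r ltr_pM2l.
rewrite opprD addrACA subrr addr0 -mulrBr normrM gtr0_norm//.
by rewrite mulrC -ltr_pdivlMr.
Qed.

Lemma cadlag_affine (f : R -> nbar) (c e : R) : 0 < c -> 0 <= e ->
  cadlag f -> cadlag (fun s => f (c * s + e)).
Proof.
move=> c0 e0 [fr fl]; split=> t t0.
  have /fr h : 0 <= c * t + e by rewrite addr_ge0// mulr_ge0// ltW.
  exact: cvg_comp (cvg_affine_right (e := e) (t := t) c0) h.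
have /fl[l h] : 0 < c * t + e by rewrite ltr_wpDr// mulr_gt0.
by exists l; exact: cvg_comp (cvg_affine_left (e := e) (t := t) c0) h.
Qed.

Lemma cadlag_segW (u : R) (f : R -> nbar) : cadlag f -> cadlag_seg u f.
Proof.
by move=> [fr fl]; split=> t /andP[t0 _]; [exact: fr|exact: fl].
Qed.

End Paths.

(** * Integrals of derivatives *)

Section FTC.
Context (R : realType).
Local Notation mu := (@lebesgue_measure R).

Lemma is_derive_near (F : R -> R) (x d e : R) : is_derive x 1 F d -> 0 < e ->
  \forall u \near x, `|F u - F x - d * (u - x)| <= e * `|u - x|.
Proof.
move=> /is_derive1_caratheodory[G [FG cG Gx]] e0.
move/cvgrPdist_le : cG => /(_ e e0); apply: filterS => u.
rewrite Gx FG -mulrBl normrM distrC => h.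
by rewrite ler_wpM2r.
Qed.

(* Vitali-Caratheodory: [h] is rounded up to multiples of [eta] and its
   superlevel sets are enlarged to open sets. *)
Lemma lsc_majorant (a b : R) (h : R -> R) (e : R) :
  a <= b -> mu.-integrable `[a, b] (EFin \o h) ->
  (forall x, x \in `[a, b] -> 0 <= h x) -> 0 < e ->
  exists g : R -> \bar R, [/\ measurable_fun [set: R] g, forall s, (0 <= g s)%E,
    (\int[mu]_(x in `[a, b]) g x <= \int[mu]_(x in `[a, b]) (h x)%:E + e%:E)%E
    & forall x, x \in `[a, b] -> \forall s \near x, ((h x)%:E <= g s)%E].
Proof.
move=> ab ih h0 e0.
have mD : measurable `[a, b]%classic := measurable_itv _.
set D := `[a, b]%classic in ih mD *.
(* Rounding up costs at most [eta * (b - a)] and enlarging the level sets at most [eta], in total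
   [e]. *)
pose eta := e / (b - a + 1).
have ba1 : 0 < b - a + 1 by rewrite ltr_wpDl// subr_ge0.
have eta0 : 0 < eta by rewrite divr_gt0.
pose E (k : nat) := D `&` [set x | k%:R * eta <= h x].
have mh : measurable_fun D h by case/integrableP : (ih) => /measurable_EFinP.
have mE k : measurable (E k).
  have -> : E k = D `&` h @^-1` `[k%:R * eta, +oo[%classic.
    by apply/seteqP; split => x [Dx] /=; rewrite in_itv/= andbT.
  exact: mh.
have finD : (mu D < +oo)%E.
  by rewrite /D lebesgue_measure_itv/=; case: ifP => // _; rewrite -EFinB ltry.
have finE k : (mu (E k) < +oo)%E.
  by apply: le_lt_trans finD; apply: le_measure; [by rewrite inE; exact: mE|by rewrite inE; exact: mD|by move=> x []].
have /choice[U hU] : forall k : nat, exists U : set R, [/\ open U, E k `<=` U &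
    (mu (U `\` E k) < (1 / (2 ^ k.+1)%:R)%:E)%E].
  move=> k; apply: (lebesgue_regularity_outer (mE k) (finE k)).
  by rewrite divr_gt0// ltr0n expn_gt0.
have oU k : open (U k) by have [] := hU k.
have mU k : measurable (U k) by exact: open_measurable.
(* With [E k] in place of [U k] the sum would be [eta] times one plus the integer part of
   [h s / eta], which lies above [h s] by at most [eta]; level 0 contributes the extra one. *)
pose g (s : R) : \bar R := (\sum_(0 <= k <oo) (eta * \1_(U k) s)%:E)%E.
have g0 s : (0 <= g s)%E.
  by apply: nneseries_ge0 => k _ _; rewrite lee_fin mulr_ge0// ltW.
have mterm (A : set R) : measurable A ->
    measurable_fun setT (fun s => (eta * \1_A s)%:E).
  move=> mA; apply/measurable_EFinP; apply: measurable_funM; first exact: measurable_cst.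
  exact: (measurable_indic mA).
exists g; split => //.
- by apply: ge0_emeasurable_sum => [k x _ _|k _]; [rewrite lee_fin mulr_ge0// ltW|exact: mterm].
- have t0 (A : set R) s : (0 <= (eta * \1_A s)%:E :> \bar R)%E.
    by rewrite lee_fin mulr_ge0// ltW.
  pose g1 s := (\sum_(0 <= k <oo) (eta * \1_(E k) s)%:E)%E.
  pose g2 s := (\sum_(0 <= k <oo) (eta * \1_(U k `\` E k) s)%:E)%E.
  have mUE k : measurable (U k `\` E k) by exact: measurableD.
  have mg1 : measurable_fun D g1.
    apply: measurable_funTS.
    by apply: ge0_emeasurable_sum => [k x _ _|k _]; [exact: t0|exact: mterm].
  have mg2 : measurable_fun D g2.
    apply: measurable_funTS.
    by apply: ge0_emeasurable_sum => [k x _ _|k _]; [exact: t0|exact: mterm].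
  have gE s : g s = (g1 s + g2 s)%E.
    rewrite /g1 /g2 -nneseriesD//; apply: eq_eseriesr => k _.
    rewrite -EFinD -mulrDr; congr (_ * _)%:E.
    have [_ EU _] := hU k; rewrite !indicE in_setD.
    case: (boolP (s \in E k)) => [sE|sE]; last by rewrite andbT add0r.
    have -> : s \in U k by apply/mem_set/EU/set_mem.
    by rewrite /= addr0.
  have -> : (\int[mu]_(x in D) g x = \int[mu]_(x in D) g1 x + \int[mu]_(x in D) g2 x)%E.
    rewrite -ge0_integralD//; first by apply: eq_integral => s _; exact: gE.
      by move=> x _; apply: nneseries_ge0.
    by move=> x _; apply: nneseries_ge0.
  have i1 : (\int[mu]_(x in D) g1 x <= \int[mu]_(x in D) (h x)%:E + (eta * (b - a))%:E)%E.
    have -> : (eta * (b - a))%:E = (\int[mu]_(x in D) (cst eta%:E x))%E.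
      rewrite integral_cst// EFinM; congr (_ * _)%E; apply/esym.
      have -> : (b - a)%:E = mu D; last by [].
      rewrite /D lebesgue_measure_itv/= lte_fin.
      by move: ab; rewrite le_eqVlt => /orP[/eqP->|->]; rewrite ?ltxx ?subrr -?EFinB.
    rewrite -ge0_integralD//; last first.
    - by move=> x _; rewrite lee_fin ltW.
    - exact/measurable_EFinP.
    apply: ge0_le_integral => //.
    - by move=> x _; apply: nneseries_ge0.
    - by apply: emeasurable_funD => //; exact/measurable_EFinP.
    move=> x Dx /=; have hx := h0 x Dx.
    pose N := Num.truncn (h x / eta).
    have /andP[N1 N2] := truncn_itv (divr_ge0 hx (ltW eta0)).
    rewrite /g1 (@nneseries_split _ _ 0 N.+1 (fun k _ => t0 (E k) x)).
    rewrite [X in (_ + X)%E]eseries0 ?adde0; last first.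
      move=> k /= Nk _; rewrite indicE memNset ?mulr0// => -[_ /=].
      rewrite -ler_pdivlMr// leNgt => /negP; apply; apply: lt_le_trans N2 _.
      by rewrite ler_nat -(add0n N.+1).
    apply: (@le_trans _ _ (\sum_(0 <= k < N.+1) eta%:E)%E).
      by rewrite add0n; apply: lee_sum => k _; rewrite lee_fin ler_piMr ?(ltW eta0)// indicE; case: (_ \in _).
    rewrite sumEFin big_const_nat subn0 iter_addr_0 -EFinD lee_fin -mulr_natl.
    by rewrite -natr1 mulrDl mul1r lerD2r -ler_pdivlMr.
  have i2 : (\int[mu]_(x in D) g2 x <= eta%:E)%E.
    rewrite integral_nneseries//; last by move=> k; apply: measurable_funTS; exact: mterm.
    apply: (@le_trans _ _ (\sum_(0 <= k <oo) (eta / (2 ^ k.+1)%:R)%:E)%E); last first.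
      by apply: epsilon_trick0; exact: ltW.
    apply: lee_nneseries => k; first by move=> _ _; apply: integral_ge0 => x _.
    move=> _; under eq_integral do rewrite EFinM.
    rewrite ge0_integralZl_EFin//; last exact: ltW; last first.
      by apply: measurable_funTS; apply/measurable_EFinP; exact: (measurable_indic (mUE k)).
    rewrite integral_indic; [|exact: mD|exact: mUE].
    rewrite [leRHS]EFinM lee_pmul2l ?lte_fin//.
    have [_ _ /ltW lt] := hU k; rewrite div1r in lt; apply: le_trans lt.
    apply: le_measure; [|by rewrite inE; exact: mUE|by move=> x []].
    by rewrite inE; apply: measurableI; [exact: mUE|exact: mD].
  apply: le_trans (leeD i1 i2) _; rewrite -addeA leeD2l// -EFinD lee_fin.
  by rewrite -{2}[eta]mulr1 -mulrDr /eta divfK// gt_eqF.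
- move=> x xD; have hx := h0 x xD.
  pose N := Num.truncn (h x / eta).
  have /andP[N1 N2] := truncn_itv (divr_ge0 hx (ltW eta0)).
  have : \forall s \near x, forall k : 'I_N.+1, U k s.
    apply: (@filter_forall _ _ (fun k : 'I_N.+1 => U k) (nbhs x) (nbhs_filter x)) => k; apply: open_nbhs_nbhs; split => //.
    have [_ EU _] := hU k; apply: EU; split => //=.
    rewrite -ler_pdivlMr//; apply: le_trans N1; rewrite ler_nat.
    by rewrite -ltnS.
  apply: filterS => s hs.
  apply: (@le_trans _ _ (\sum_(0 <= k < N.+1) (eta * \1_(U k) s)%:E)%E); last first.
    by apply: nneseries_lim_ge => k _ _; rewrite lee_fin mulr_ge0// ltW.
  apply: (@le_trans _ _ (\sum_(0 <= k < N.+1) eta%:E)%E).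
    by rewrite sumEFin big_const_nat subn0 iter_addr_0 lee_fin -mulr_natl ltW// -ltr_pdivrMr.
  rewrite !big_mkord; apply: lee_sum => k _; rewrite lee_fin indicE mem_set ?mulr1//.
Qed.

(* Rudin, Real and Complex Analysis, Theorem 7.21: a derivative lying below a
   lower semicontinuous [g] forces the increments of [F] below those of the
   integral of [g], by a supremum argument. *)
Lemma increment_le_integral (F F' h : R -> R) (a b : R) : a <= b ->
  (forall x, x \in `[a, b] -> is_derive x 1 F (F' x)) ->
  mu.-integrable `[a, b] (EFin \o h) ->
  (forall x, x \in `[a, b] -> 0 <= h x) ->
  (forall x, x \in `[a, b] -> F' x <= h x) ->
  ((F b - F a)%:E <= \int[mu]_(x in `[a, b]) (h x)%:E)%E.
Proof.
move=> ab dF ih h0 F'h; apply/lee_addgt0Pr => e e0.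
have e20 : 0 < e / 2 by rewrite divr_gt0.
have [g [mg g0 gle gloc]] := lsc_majorant ab ih h0 e20.
pose eta := e / 2 / (b - a + 1).
have ba1 : 0 < b - a + 1 by rewrite ltr_wpDl// subr_ge0.
have eta0 : 0 < eta by rewrite divr_gt0.
pose J x := (\int[mu]_(t in `[a, x]) g t)%E.
have J0 x : (0 <= J x)%E by exact: integral_ge0.
have Jle s u : s <= u -> (J s <= J u)%E.
  move=> su; apply: ge0_subset_integral => //; first exact: measurable_funTS.
  by move=> x /=; rewrite !in_itv/= => /andP[-> /le_trans]; apply.
pose A := [set x | a <= x <= b /\ ((F x - F a - eta * (x - a))%:E <= J x)%E].
have Aa : A a by split; rewrite ?lexx// !subrr mulr0 subrr.
have supA : has_sup A by split; [exists a|exists b => x [/andP[]]].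
pose s := sup A.
have as_ : a <= s by apply: ub_le_sup => //; case: supA.
have sb : s <= b by apply: ge_sup; [exists a|move=> x [/andP[]]].
have sab : s \in `[a, b] by rewrite in_itv/= as_.
(* The supremum is attained: [F] is continuous at [s] and [J] is nondecreasing. *)
have As : A s.
  split; first by rewrite as_.
  apply/lee_addgt0Pr => d d0.
  pose k := (`|F' s| + 1 + eta).
  have k0 : 0 < k by rewrite /k addr_gt0// ltr_wpDl.
  have := is_derive_near (dF s sab) ltr01 => -[/= r /= r0 hr].
  have m0 : 0 < Num.min r (d / k) by rewrite lt_min r0 divr_gt0.
  have [x Ax xs] := sup_adherent m0 supA.
  have xles : x <= s by apply: ub_le_sup => //; case: supA.
  have sxlt : s - x < Num.min r (d / k) by rewrite ltrBlDr -ltrBlDl.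
  have {}hr : `|F x - F s - F' s * (x - s)| <= 1 * `|x - s|.
    apply: hr => /=; rewrite ger0_norm ?subr_ge0//.
    by move: sxlt; rewrite lt_min => /andP[].
  have [_ Jx] := Ax.
  apply: (@le_trans _ _ (J x + d%:E)%E); last by rewrite leeD2r// Jle.
  apply: le_trans (leeD2r _ Jx); rewrite -EFinD lee_fin.
  have dk : (s - x) * k <= d.
    rewrite -ler_pdivlMr//; apply/ltW.
    by move: sxlt; rewrite lt_min => /andP[].
  have Fle : F' s * (s - x) <= `|F' s| * (s - x).
    by rewrite ler_wpM2r ?subr_ge0// ler_norm.
  have ex : 0 <= eta * (s - x) by apply: mulr_ge0; [exact: ltW|rewrite subr_ge0].
  move: hr dk; rewrite mul1r (ler0_norm (x := x - s)) ?subr_le0// ler_norml /k => /andP[h1 h2] dk.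
  nra.
(* If [s < b], then just after [s] the increment of [F] is at most [(h s + eta) * (u - s)], while
   [J] grows by at least [h s * (u - s)]. So [A] would extend beyond [s]. *)
have {}sb : s = b.
  apply/eqP; rewrite eq_le sb leNgt; apply/negP => sltb.
  have [/= r1 /= r10 hr1] := is_derive_near (dF s sab) eta0.
  have [/= r2 /= r20 hr2] := gloc s sab.
  have r0 : 0 < Num.min r1 r2 by rewrite lt_min r10 r20.
  pose u := Num.min b (s + Num.min r1 r2 / 2).
  have su : s < u by rewrite lt_min sltb ltrDl divr_gt0.
  have ub : u <= b by rewrite ge_min lexx.
  have close v : s <= v -> v <= u -> v - s < Num.min r1 r2.
    move=> sv vu; rewrite ltrBlDl; apply: (le_lt_trans vu).
    rewrite gt_min; apply/orP; right; rewrite ltrD2l ltr_pdivrMr// ltr_pMr//.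
    by rewrite ltr1n.
  have Fu : F u - F s <= (h s + eta) * (u - s).
    have : `|F u - F s - F' s * (u - s)| <= eta * `|u - s|.
      apply: hr1 => /=; rewrite distrC ger0_norm ?subr_ge0 ?(ltW su)//.
      by have := close u (ltW su) (lexx _); rewrite lt_min => /andP[].
    rewrite (ger0_norm (x := u - s)) ?subr_ge0 ?(ltW su)// ler_norml => /andP[_].
    have : F' s * (u - s) <= h s * (u - s).
      by rewrite ler_wpM2r ?F'h// subr_ge0 ltW.
    lra.
  have Ju : (J s + (h s * (u - s))%:E <= J u)%E.
    have -> : J u = (J s + \int[mu]_(t in `]s, u]) g t)%E.
      rewrite /J (@itv_bndbnd_setU _ _ (BLeft a) (BRight s) (BRight u)) ?bnd_simp//; last exact: ltW.
      rewrite ge0_integral_setU//; first exact: measurable_funTS.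
      by apply/disj_set2P; rewrite -subset0 => t []/=; rewrite !in_itv/= => /andP[_ ts] /andP[/(le_lt_trans ts)]; rewrite ltxx.
    rewrite leeD2l//.
    have -> : (h s * (u - s))%:E = (\int[mu]_(t in `]s, u]) (cst (h s)%:E t))%E.
      rewrite integral_cst// EFinM; congr (_ * _)%E; apply/esym.
      have -> : (u - s)%:E = mu `]s, u]; last by [].
      by rewrite lebesgue_measure_itv/= lte_fin su -EFinB.
    apply: ge0_le_integral => //.
    - by move=> t _; rewrite lee_fin h0.
    - exact: measurable_funTS.
    move=> t /=; rewrite in_itv/= => /andP[st tu]; apply: hr2 => /=.
    rewrite distrC ger0_norm ?subr_ge0 ?(ltW st)//.
    by have := close t (ltW st) tu; rewrite lt_min => /andP[].
  have : u <= s.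
    apply: ub_le_sup; first by case: supA.
    split; first by rewrite (le_trans as_ (ltW su)).
    apply: le_trans Ju; have [_ Js] := As.
    apply: le_trans (leeD2r _ Js); rewrite -EFinD lee_fin; nra.
  by rewrite leNgt su.
have [_] := As; rewrite sb => hb.
apply: (@le_trans _ _ (J b + (e / 2)%:E)%E).
  apply: le_trans (leeD2r _ hb); rewrite -EFinD lee_fin.
  have : eta * (b - a) <= e / 2.
    rewrite /eta -mulrA ler_piMr ?(ltW e20)// mulrC ler_pdivrMr// mul1r.
    by rewrite lerDl.
  lra.
apply: (le_trans (leeD2r _ gle)).
by rewrite -addeA leeD2l// -EFinD lee_fin -splitr.
Qed.

(** To drop the sign condition, [F'] is truncated below at [- n] and shifted by [n], which
    corresponds to adding [n * y] to [F]. The shift cancels, and dominated convergence removes the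
    truncation. *)
Let increment_le (F F' : R -> R) (a b : R) : a <= b ->
  (forall x, x \in `[a, b] -> is_derive x 1 F (F' x)) ->
  mu.-integrable `[a, b] (EFin \o F') ->
  F b - F a <= \int[mu]_(x in `[a, b]) F' x.
Proof.
move=> ab dF iF'.
have mD : measurable (`[a, b]%classic : set (measurableTypeR R)) by exact: measurable_itv.
have mF' : measurable_fun `[a, b] F' by case/integrableP : (iF') => /measurable_EFinP.
have muD : mu `[a, b]%classic = (b - a)%:E.
  rewrite lebesgue_measure_itv/= lte_fin.
  by move: ab; rewrite le_eqVlt => /orP[/eqP->|->]; rewrite ?ltxx ?subrr -?EFinB.
pose m (n : nat) x := Num.max (F' x) (- n%:R).
have mm n : measurable_fun (`[a, b]%classic : set (measurableTypeR R)) (EFin \o m n).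
  by apply/measurable_EFinP; apply: measurable_realfun.measurable_maxr => //; exact: measurable_cst.
have mle n x : `|m n x| <= `|F' x|.
  rewrite /m; case: (leP (F' x) (- n%:R)) => // Fn.
  rewrite normrN ger0_norm// ler0_norm; first by rewrite lerNr.
  by apply: (le_trans Fn); rewrite oppr_le0.
have im n : mu.-integrable `[a, b] (EFin \o m n).
  apply: (@le_integrable _ _ _ mu _ mD _ _ (mm n) _ iF') => x _ /=.
  by rewrite lee_fin mle.
have ic (c : R) : mu.-integrable `[a, b] (EFin \o cst c).
  apply/integrableP; split; first by apply/measurable_EFinP; exact: measurable_cst.
  rewrite (_ : (fun _ => _) = cst `|c|%:E) ?integral_cst//.
  by rewrite [X in (_ * X)%E](_ : _ = (b - a)%:E) ?ltry//; exact: muD.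
have key n : ((F b - F a)%:E <= \int[mu]_(x in `[a, b]) (m n x)%:E)%E.
  have dn x : x \in `[a, b] -> is_derive x 1 (fun y => F y + n%:R * y) (F' x + n%:R).
    move=> /dF/is_derive1_caratheodory[G [FG cG <-]].
    apply/is_derive1_caratheodory; exists (fun z => G z + n%:R); split => //.
      by move=> z; rewrite opprD addrACA FG -mulrBr mulrDl.
    by apply: cvgD => //; exact: cvg_cst.
  have imn : mu.-integrable `[a, b] (EFin \o (fun x => m n x + n%:R)).
    by have := integrableD mD (im n) (ic n%:R); apply: eq_integrable.
  have h0 x : x \in `[a, b] -> 0 <= m n x + n%:R.
    by move=> _; rewrite -lerBlDr sub0r le_max lexx orbT.
  have Fm x : x \in `[a, b] -> F' x + n%:R <= m n x + n%:R.
    by move=> _; rewrite lerD2r le_max lexx.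
  have := increment_le_integral ab dn imn h0 Fm.
  under eq_integral do rewrite EFinD.
  rewrite (integralD mD (im n) (ic n%:R)) /=.
  rewrite (_ : (\int[mu]_(x in `[a, b]) (cst n%:R x)%:E)%E = (n%:R * (b - a))%:E); last first.
    rewrite (integral_cst mu mD n%:R%:E) EFinM; congr (_ * _)%E; exact: muD.
  rewrite opprD addrACA -mulrBr EFinD.
  by rewrite leeD2rE.
have cv : (\int[mu]_(x in `[a, b]) (EFin \o m n) x)%E @[n --> \oo] -->
          (\int[mu]_(x in `[a, b]) (EFin \o F') x)%E.
  apply: (dominated_cvg mD (g := abse \o (EFin \o F'))) => //.
  - move=> x _ /=; apply: cvg_near_cst; near=> n.
    congr EFin; apply/max_idPl; rewrite lerNl.
    near: n; exact: nbhs_infty_ger.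
  - exact: integrable_abse.
  - by move=> n x _ /=; rewrite lee_fin.
rewrite -lee_fin /Rintegral fineK; last exact: integrable_fin_num.
rewrite -(cvg_lim _ cv)//; apply: lime_ge; first by apply/cvg_ex; eexists; exact: cv.
by near=> n; exact: key.
Unshelve. all: end_near. Qed.

Lemma integral_derivative (F F' : R -> R) (a b : R) : a <= b ->
  (forall x, x \in `[a, b] -> is_derive x 1 F (F' x)) ->
  mu.-integrable `[a, b] (EFin \o F') ->
  \int[mu]_(x in `[a, b]) F' x = F b - F a.
Proof.
move=> ab dF iF'; apply/eqP; rewrite eq_le increment_le// andbT.
have mD : measurable (`[a, b]%classic : set (measurableTypeR R)) by exact: measurable_itv.
have dN x : x \in `[a, b] -> is_derive x 1 (\- F) (- F' x).
  by move=> /dF dx; exact: is_deriveN.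
have iN : mu.-integrable `[a, b] (EFin \o (fun x => - F' x)).
  by have := integrableN iF'; apply: eq_integrable.
have := increment_le ab dN iN.
rewrite (_ : \int[mu]_(x in `[a, b]) - F' x = - \int[mu]_(x in `[a, b]) F' x).
  by rewrite opprK addrC lerNr opprB.
under eq_Rintegral do rewrite -mulN1r.
by rewrite RintegralZl// mulN1r.
Qed.

(** The form required by (A6): [Psi2] is differentiable inside the interval only and has one-sided
    limits at the ends. The indefinite integral is continuous there, so the identity on inner
    intervals passes to the limit. *)
Lemma integral_derivative_oo (F : R -> R) (a b la lb : R) : a < b ->
  (forall x, a < x < b -> derivable F x 1) ->
  F x @[x --> a^'+] --> la -> F x @[x --> b^'-] --> lb ->
  mu.-integrable `[a, b] (EFin \o derive1 F) ->
  \int[mu]_(x in `[a, b]) derive1 F x = lb - la /\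
  (forall s, a < s < b -> \int[mu]_(x in `[a, s]) derive1 F x = F s - la).
Proof.
move=> ab dF cla clb iF.
have sub x y : a <= x -> y <= b -> mu.-integrable `[x, y] (EFin \o derive1 F).
  move=> ax yb; apply: integrableS iF => //.
  by apply: subset_itv; rewrite bnd_simp.
pose I x := \int[mu]_(t in `[a, x]) derive1 F t.
have step x y : a < x -> x <= y -> y < b -> F y - F x = I y - I x.
  move=> ax xy yb; rewrite /I Rintegral_itvB; last by rewrite bnd_simp.
  - rewrite Rintegral_itv_obnd_cbnd; last first.
      apply: integrableS (sub x y (ltW ax) (ltW yb)) => //.
      by apply: subset_itvr; rewrite bnd_simp.
    apply/esym/integral_derivative => //; last exact: sub (ltW ax) (ltW yb).
    move=> z; rewrite in_itv/= => /andP[xz zy].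
    rewrite derive1E; apply: derivableP; apply: dF.
    by rewrite (lt_le_trans ax xz) (le_lt_trans zy yb).
  - exact: sub (lexx a) (ltW yb).
  - by rewrite bnd_simp ltW.
have I0 : I x @[x --> a^'+] --> 0.
  by apply: cvg_at_right_filter; exact: parameterized_integral_cvg_left ab iF.
have Ib : I x @[x --> b^'-] --> I b.
  exact: parameterized_integral_cvg_at_left ab iF.
have inner s : a < s < b -> I s = F s - la.
  move=> /andP[as_ sb].
  have h1 : F s - F x @[x --> a^'+] --> F s - la by apply: cvgB => //; exact: cvg_cst.
  have h2 : F s - F x @[x --> a^'+] --> I s - 0.
    have : I s - I x @[x --> a^'+] --> I s - 0 by apply: cvgB => //; exact: cvg_cst.
    apply: cvg_trans; apply: near_eq_cvg; near=> x; apply/esym/step => //.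
    by near: x; exact: nbhs_right_le.
  by rewrite subr0 in h2; exact: (cvg_unique _ h2 h1).
split; last exact: inner.
have h1 : F x - la @[x --> b^'-] --> lb - la by apply: cvgB => //; exact: cvg_cst.
suff h2 : F x - la @[x --> b^'-] --> I b by exact: (cvg_unique _ h2 h1).
apply: cvg_trans Ib; apply: near_eq_cvg; near=> x; apply: inner.
by apply/andP; split; near: x; [exact: nbhs_left_gt|exact: nbhs_left_lt].
Unshelve. all: end_near. Qed.

End FTC.

(** * The limit for paths with random visits *)

Section ae_integral.
Local Open Scope ereal_scope.
Context d (T : measurableType d) (R : realType) (mu : {measure set T -> \bar R}).
Import HBNNSimple.

Let nnint (f : T -> \bar R) := ereal_sup [set sintegral mu h |
  h in [set h : {nnsfun T >-> R} | forall x, (h x)%:E <= f x]].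

(** A simple function below [f] keeps its integral when set to 0 on the null set, and then lies
    below [g]. *)
Let nnint_le (f g : T -> \bar R) (N : set T) : measurable N -> mu N = 0 ->
  (forall x, ~ N x -> f x = g x) -> (forall x, 0 <= g x) ->
  nnint f <= nnint g.
Proof.
move=> mN N0 fg g0; apply: ge_ereal_sup => _ [h /= hf <-].
pose h' := proj_nnsfun h (measurableC mN).
have -> : sintegral mu h = sintegral mu h'.
  rewrite -!integralT_nnsfun; apply: ae_eq_integral => //.
    by apply/measurable_EFinP.
    by apply/measurable_EFinP.
  exists N; split=> // x /= hx; apply: contrapT => nx; apply: hx => _.
  by rewrite /h' /proj_nnsfun /= mindicE mem_set// mulr1.
apply: ereal_sup_ubound; exists h' => // x.
rewrite /h' /proj_nnsfun /= mindicE; have [/set_mem nx|nx] := boolP (x \in ~` N).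
  by rewrite mulr1 -fg.
by rewrite mulr0.
Qed.

(** The functions are arbitrary: this works from the definition of the integral as a supremum over
    simple functions, and it is applied to functionals of the path that are measurable only after a
    change on a null set. *)
Lemma ae_integral_eq (f g : T -> \bar R) :
  {ae mu, forall x, f x = g x} -> \int[mu]_x f x = \int[mu]_x g x.
Proof.
move=> [N [mN N0 hN]].
have fg x : ~ N x -> f x = g x.
  by move=> nx; apply: contrapT => h; apply: nx; exact: hN.
rewrite /integral !patch_setT.
have E (f1 g1 : T -> \bar R) : (forall x, ~ N x -> f1 x = g1 x) ->
   (forall x, 0 <= f1 x) -> (forall x, 0 <= g1 x) -> nnint f1 = nnint g1.
  move=> e f0 g0; apply/eqP; rewrite eq_le (nnint_le mN)//= (nnint_le mN)// => x nx.
  by rewrite e.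
by congr (_ - _); apply: E => // x nx; rewrite ?funeposE ?funenegE fg.
Qed.

End ae_integral.

(** * Exchanging expectation and integral *)

Section fubini.
Context (R : realType) d (Omega : measurableType d) (P : probability Omega R).
Local Notation mu := (@lebesgue_measure R).
Local Notation R' := (measurableTypeR R).
Variables (h : R -> R) (theta : R).
Let D : set R' := `]0, theta]%classic.
Hypothesis ih : mu.-integrable D (EFin \o h).
Variable S : set (Omega * R').
Hypothesis mS : measurable S.

Let f (z : Omega * R') : \bar R := ((h \_ D) z.2 * \1_S z)%:E.

Let mD : measurable D. Proof. exact: measurable_itv. Qed.

Let mh : measurable_fun setT (h \_ D : R' -> R).
Proof.
apply/(measurable_restrictT _ mD).
by case/integrableP : ih => /measurable_EFinP.
Qed.

Let mf : measurable_fun setT f.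
Proof.
apply/measurable_EFinP; apply: measurable_funM; last exact: (measurable_indic mS).
exact: measurableT_comp mh measurable_snd.
Qed.

Let int_f : (P \x mu)%E.-integrable setT f.
Proof.
apply/(integrable21ltyP _ _ mf).
have : (\int[mu]_u `|((h \_ D) u)%:E| < +oo)%E.
  have : mu.-integrable setT (EFin \o (h \_ D)).
  rewrite (_ : EFin \o _ = (EFin \o h) \_ D); first exact/(integrable_mkcond _ mD).
    by apply/funext => u /=; rewrite /patch; case: ifP.
  by case/integrableP.
apply: le_lt_trans; apply: ge0_le_integral => //.
- by move=> u _; exact: integral_ge0.
- have mabs : measurable_fun setT (abse \o f).
    by apply: measurableT_comp mf; exact: abse_measurable.
  exact: (measurable_fun_fubini_tonelli_G (m1 := P) (abse \o f) mabs (fun _ => abse_ge0 _)).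
- by apply/measurableT_comp => //; exact/measurable_EFinP.
move=> u _.
have -> : `|((h \_ D) u)%:E|%E = (\int[P]_v (cst `|((h \_ D) u)%:E|%E v))%E.
  rewrite (integral_cst P measurableT) -[LHS]mule1; congr (_ * _)%E.
  exact/esym/probability_setT.
apply: ge0_le_integral => //.
- apply: measurableT_comp => //; apply: measurableT_comp mf _.
  exact: measurable_pair2.
- move=> v _ /=; rewrite lee_fin normrM ler_piMr// indicE.
  by case: (_ \in _); rewrite ?normr1 ?normr0.
Qed.

Let fF : fubini_F mu f = fun v => (\int[mu]_(u in D) (h u * \1_S (v, u))%:E)%E.
Proof.
apply/funext => v; rewrite /fubini_F [RHS]integral_mkcond; apply: eq_integral => u _.
by rewrite /f /= /patch; case: ifP => // _; rewrite mul0r.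
Qed.

Let section_fin v : (\int[mu]_(u in D) (h u * \1_S (v, u))%:E)%E \is a fin_num.
Proof.
apply: integrable_fin_num => //.
apply: (@le_integrable _ _ _ mu _ mD _ _ _ _ ih).
  apply/measurable_EFinP; apply: measurable_funM.
    by case/integrableP : ih => /measurable_EFinP.
  apply: measurable_funTS; apply: measurableT_comp; first exact: measurable_indic.
  exact: measurable_pair1.
move=> u _ /=; rewrite lee_fin normrM ler_piMr// indicE.
by case: (_ \in _); rewrite ?normr1 ?normr0.
Qed.

Lemma integrable_section :
  P.-integrable setT (EFin \o (fun v => \int[mu]_(u in D) (h u * \1_S (v, u)))).
Proof.
have := integrable_fubini_F int_f; rewrite fF.
by congr (is_true (_.-integrable _ _)); apply/funext => v /=; rewrite fineK.
Qed.

(** Used with [h] the derivative of [Psi2] and [S] the set [stay t], where the sections have the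
    probabilities of no exit. *)
Lemma Rintegral_section :
  \int[P]_v (\int[mu]_(u in D) (h u * \1_S (v, u))) =
  \int[mu]_(u in D) (h u * fine (P (ysection S u))).
Proof.
rewrite /Rintegral; congr fine.
under eq_integral do rewrite fineK//.
have := integral12_prod_meas1 int_f; rewrite fF => ->.
rewrite -(integral21_prod_meas1 int_f) [RHS]integral_mkcond.
apply: eq_integral => u _; rewrite /fubini_G /f /=.
have mx : measurable (ysection S u) by exact: measurable_ysection.
have E v : \1_S (v, u) = \1_(ysection S u) v :> R.
  by rewrite !indicE; congr (nat_of_bool _)%:R; apply/idP/idP; rewrite !inE /ysection /= ?inE.
under eq_integral do rewrite E EFinM.
rewrite integralZl//; last exact: integrable_indic.
rewrite integral_indic// setIT /patch; case: ifP => _; last by rewrite mul0e.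
by rewrite EFinM fineK ?fin_num_measure.
Qed.

End fubini.

(** * The functional along a single path *)

Section PhiPath.
Context (R : realType).
Variables (Phi : R -> R -> path_space R -> R) (Psi1 : R -> R).
Variables (Xi : R -> nbar -> R -> (R -> nbar) -> R) (Psi2 : R -> R -> R).
Hypotheses (hA2 : assumption_A2 Phi) (hA3 : assumption_A3 Phi Psi1).
Hypothesis hA4 : assumption_A4 Phi Xi.

Lemma path_cadlag (Y : path_space R) : cadlag Y.
Proof. by case: Y. Qed.

Variables (a b : nat -> nat -> R) (ok : visits_ok a b).
Variables (Y : path_space R) (hY : describes a b Y).
Variables (t theta : R) (t0 : 0 < t) (theta0 : 0 < theta).

Let Yc : cadlag (fun s => Y (t * s + 0)) :=
  cadlag_affine t0 (lexx 0) (path_cadlag Y).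

Let zeta : path_space R := Path Yc.

Let zetaE s : zeta s = Y (t * s). Proof. by rewrite /= addr0. Qed.

Let PhiE : Phi t (theta * t) Y = Phi 1 theta zeta.
Proof.
have tt0 : 0 < theta * t by rewrite mulr_gt0.
by rewrite (hA2 t0 tt0 (fun s _ => zetaE s)) mulfK// gt_eqF.
Qed.

(** Constancy at infinity is impossible, since visits are dense. Constancy at a state forces its
    visit to last beyond the interval, since the end of a visit is unvisited. *)
Lemma visited_constP : (forall s, t <= s <= t + theta * t -> Y s = Y t) <->
  exists x j, a x j <= t /\ t + theta * t < b x j.
Proof.
have tlt : t < t + theta * t by rewrite ltrDl mulr_gt0.
split=> [h|[x [j [at_ tb]]] s /andP[ts st]].
  case E : (Y t) => [x|].
    have /(hY _ (ltW t0))[j /andP[at_ tb]] := E.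
    exists x, j; split => //; rewrite ltNge; apply/negP => bt.
    have : Y (b x j) = Some x by rewrite h ?(ltW tb).
    case/(hY _ (ltW (lt_trans t0 tb))) => k; apply/negP; exact: (vis_end ok x j x k).
  have [x [j [u [/andP[tu ut] v]]]] := vis_dense ok (ltW t0) tlt.
  have := h u; rewrite tu ut E => /(_ isT).
  suff -> : Y u = Some x by [].
  by apply/hY; [exact: le_trans (ltW t0) tu|exists j].
have -> : Y t = Some x.
  by apply/hY; [exact: ltW|exists j; rewrite at_ (lt_trans tlt tb)].
apply/hY; first exact: le_trans (ltW t0) ts.
by exists j; rewrite (le_trans at_ ts) (le_lt_trans st tb).
Qed.

Lemma Phi_const x j : a x j <= t -> t + theta * t < b x j ->
  Phi t (theta * t) Y = Psi1 theta.
Proof.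
move=> at_ tb; rewrite PhiE; apply: (hA3 (x := x)) => // r /andP[r1 r2].
rewrite zetaE; have tr : t <= t * r by rewrite ler_peMr// ltW.
apply/hY; first exact: le_trans (ltW t0) tr.
exists j; rewrite (le_trans at_ tr)/=; apply: le_lt_trans tb.
have -> : t + theta * t = t * (1 + theta) by ring.
by rewrite ler_pM2l.
Qed.

Let s x j := (b x j - t) / t.

(** The path is rescaled by (A2) to start at time 1 and then cut at the end of the visit, where it
    is at infinity, so that (A4) applies. The last two conclusions prepare the hypotheses of
    [Xi_near_Psi2]: [eta] avoids [x] unless there is a return, and it visits only states entered by
    time [t + theta * t]. *)
Lemma Phi_exit x j : a x j <= t < b x j -> b x j < t + theta * t ->
  exists eta, [/\ cadlag_seg (theta - s x j) eta,
    Phi t (theta * t) Y = Xi theta (Some x) (s x j) eta,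
    (forall k, b x j <= a x k -> t + theta * t < a x k) ->
      forall r, 0 <= r <= theta - s x j -> eta r <> Some x
    & forall r y, 0 <= r <= theta - s x j -> eta r = Some y ->
        exists k, a y k <= t + theta * t].
Proof.
move=> /andP[at_ tb] bt.
have s0 : 0 < s x j < theta.
  by rewrite divr_gt0 ?subr_gt0//= ltr_pdivrMr// ltrBlDl.
have sE : t * (1 + s x j) = b x j.
  by rewrite mulrDr mulr1 /s mulrCA divff ?gt_eqF// mulr1 addrC subrK.
have s1 : 0 <= 1 + s x j by case/andP: s0 => s0 _; rewrite addr_ge0// ltW.
have cz : cadlag (fun r => zeta (1 * r + (1 + s x j))).
  exact: cadlag_affine (path_cadlag zeta).
have b0 : 0 <= b x j by rewrite ltW// (lt_trans t0).
have etaE r : zeta (1 * r + (1 + s x j)) = Y (t * r + b x j).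
  by rewrite zetaE mul1r mulrDr sE.
have rng r : 0 <= r <= theta - s x j -> b x j <= t * r + b x j <= t + theta * t.
  move=> /andP[r0 r1]; rewrite lerDr mulr_ge0 ?(ltW t0)//= -sE; nra.
have bP r : 0 <= r <= theta - s x j -> zeta (1 * r + (1 + s x j)) = Some x ->
    exists k, a x k <= t * r + b x j < b x k.
  by move=> /rng/andP[br rt]; rewrite etaE => /hY; apply; exact: le_trans b0 br.
have notb k : ~~ (a x k <= b x j < b x k) := vis_end ok x j x k.
exists (fun r => zeta (1 * r + (1 + s x j))); split.
- exact: cadlag_segW.
- rewrite PhiE; apply: (hA4 (eta := fun r => zeta (1 * r + (1 + s x j)))) => //.
  + exact: cadlag_segW.
  + have r0 : (0 : R) <= 0 <= theta - s x j.
      by rewrite lexx subr_ge0; case/andP: s0 => _ /ltW.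
    by case/(bP 0 r0) => k; rewrite mulr0 add0r; exact/negP.
  + move=> r /andP[r1 r2]; rewrite zetaE; have tr : t <= t * r by rewrite ler_peMr// ltW.
    apply/hY; first exact: le_trans (ltW t0) tr.
    exists j; rewrite (le_trans at_ tr)/= -sE ltr_pM2l//.
  + by move=> r _; congr (zeta _); rewrite mul1r subrK.
- move=> nret r rr /(bP r rr)[k /andP[ak kb]].
  have /andP[br rt] := rng r rr.
  have [bak|akb] := leP (b x j) (a x k).
    by have := nret k bak; rewrite ltNge (le_trans ak rt).
  have := notb k; rewrite (ltW akb)/= => /negP; apply.
  exact: le_lt_trans br kb.
- move=> r y rr; rewrite etaE => /hY[|k /andP[ak _]].
    by case/andP: (rng r rr) => /(le_trans b0).
  by exists k; case/andP: (rng r rr) => _; exact: le_trans.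
Qed.

End PhiPath.

Section Exit.
Context (R : realType).
Variables (Xi : R -> nbar -> R -> (R -> nbar) -> R) (Psi2 : R -> R -> R).
Hypotheses (hA5ii : assumption_A5ii Xi) (hA5iii : assumption_A5iii Xi).
Hypothesis hA6 : assumption_A6 Xi Psi2.

(** The modulus in (A5)(iii) may depend on the state. A segment that visits only states above [K]
    avoids state 0, so (A5)(ii) replaces [x] by 0 and one modulus [del] serves all [x]. States above
    [K] are within [1 / (K + 1) < del] of infinity. *)
Lemma Xi_near_Psi2 (theta e : R) : 0 < theta -> 0 < e -> exists K : nat,
  forall x s eta, 0 < s < theta -> cadlag_seg (theta - s) eta ->
    (forall r, 0 <= r <= theta - s -> eta r <> Some x) ->
    (forall r y, 0 <= r <= theta - s -> eta r = Some y -> (K < y)%N) ->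
    `|Xi theta (Some x) s eta - Psi2 s theta| <= e.
Proof.
move=> th0 e0; have [del del0 hdel] := hA5iii 0%N th0 e0.
pose K := Num.truncn del^-1; exists K => x s eta s0 ceta nx lowK.
have s0' : 0 <= s <= theta by case/andP: s0 => /ltW -> /ltW.
have -> : Xi theta (Some x) s eta = Xi theta (Some 0%N) s eta.
  apply: hA5ii => // r rr; split; first exact: nx.
  by move=> /(lowK _ _ rr).
rewrite (hA6.1 _ s 0%N)//; apply/ltW/hdel => //.
have : K.+1%:R^-1 < del.
  by rewrite -[ltRHS]invrK ltf_pV2 ?posrE ?invr_gt0// truncnS_gt.
apply: le_lt_trans; apply: ge_sup.
  exists (nbar_dist R (eta 0) None); exists 0 => //=.
  by rewrite in_itv/= lexx subr_ge0; case/andP: s0'.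
move=> _ [r /= + <-]; rewrite in_itv/= => rr.
rewrite /nbar_dist /= subr0; case E : (eta r) => [y|]; last by rewrite normr0.
rewrite /= ger0_norm// lef_pV2 ?posrE// ler_nat; exact: leqW (lowK _ _ rr E).
Qed.

End Exit.

(** * From paths to expectations *)

Section Random.
Context (R : realType) d (Omega : measurableType d) (P : probability Omega R).
Local Notation mu := (@lebesgue_measure R).
Local Notation R' := (measurableTypeR R).
Variables (a b : nat -> nat -> Omega -> R).
Hypotheses (ma : forall x j, measurable_fun setT (a x j)).
Hypotheses (mb : forall x j, measurable_fun setT (b x j)).
Variable Y : Omega -> path_space R.

Definition good v := visits_ok (fun x j => a x j v) (fun x j => b x j v) /\
  describes (fun x j => a x j v) (fun x j => b x j v) (Y v).

Hypothesis hgood : {ae P, forall v, good v}.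

Let mle (f : Omega -> R) (c : R) : measurable_fun setT f -> measurable [set v | f v <= c].
Proof.
move=> mf; rewrite -[X in measurable X]setTI.
rewrite (_ : [set v | _] = f @^-1` `]-oo, c]%classic); first exact: mf.
by apply/seteqP; split => v /=; rewrite in_itv.
Qed.

Let mlt (f : Omega -> R) (c : R) : measurable_fun setT f -> measurable [set v | c < f v].
Proof.
move=> mf; rewrite -[X in measurable X]setTI.
rewrite (_ : [set v | _] = f @^-1` `]c, +oo[%classic); first exact: mf.
by apply/seteqP; split => v /=; rewrite in_itv/= ?andbT.
Qed.

(** The path is replaced by the constant infinity on a null set. For the modified path, being in
    state [x] at time [t] is a countable union of events on the ends of visits, and such events
    generate [path_sigma] together with their complements. *)
Lemma measurable_functional (F : path_space R -> R) :
  (forall B : set R, measurable B -> @path_sigma R (F @^-1` B)) ->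
  exists2 Fm : Omega -> R, measurable_fun setT Fm & {ae P, forall v, F (Y v) = Fm v}.
Proof.
move=> mF; have [N [mN N0 hN]] := hgood.
have gd v : ~ N v -> good v.
  by move=> nv; apply: contrapT => h; apply: nv; exact: hN.
pose Y' v := if v \in N then Path (@cadlag_infty_path R) else Y v.
have Y'E v : ~ N v -> Y' v = Y v.
  by move=> nv; rewrite /Y' memNset.
exists (F \o Y'); last first.
  exists N; split=> // v /= h; apply: contrapT => nv; apply: h.
  by rewrite Y'E.
have mSome (t : R) x : 0 <= t -> measurable (Y' @^-1` [set zeta | zeta t = Some x]).
  move=> t0; rewrite (_ : _ @^-1` _ = ~` N `&`
      \bigcup_j ([set v | a x j v <= t] `&` [set v | t < b x j v])).
    apply: measurableI; first exact: measurableC.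
    by apply: bigcupT_measurable => j; apply: measurableI; [exact: mle|exact: mlt].
  apply/seteqP; split => v /=.
    rewrite /Y'; case: ifPn => // /negP nv e.
    have {}nv : ~ N v by move=> h; apply: nv; exact: mem_set.
    split => //; have [_ hY] := gd v nv.
    by have [j /andP[? ?]] := (hY _ _ t0).1 e; exists j.
  move=> [nv [j _ [h1 h2]]]; rewrite Y'E//; have [_ hY] := gd v nv.
  by apply/(hY _ _ t0); exists j; rewrite h1 h2.
have mall : @path_sigma R `<=` image_set_system setT Y' measurable.
  apply: smallest_sub; first by apply: sigma_algebra_image; exact: sigma_algebra_measurable.
  move=> _ [t [[x|] [t0 ->]]]; rewrite /image_set_system /= setTI; first exact: mSome.
  rewrite (_ : _ @^-1` _ = ~` \bigcup_x (Y' @^-1` [set zeta | zeta t = Some x])).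
    by apply: measurableC; apply: bigcupT_measurable => x; exact: mSome.
  apply/seteqP; split => v /=; first by move=> e [x _ /=]; rewrite e.
  by move=> h; case E : (Y' v t) => [x|//]; exfalso; apply: h; exists x.
move=> _ B mB; rewrite setTI; have := mall _ (mF B mB).
by rewrite /image_set_system /= setTI.
Qed.

(** A joint set in the sample point and the length [u], as the exchange of integrals requires; by
    [visited_constP] its section at a positive [u] is almost surely the event that the path is
    constant on [[t, t + u * t]]. *)
Definition stay (t : R) : set (Omega * R') :=
  [set z | exists x j, a x j z.1 <= t /\ t + z.2 * t < b x j z.1].

Lemma measurable_stay t : measurable (stay t).
Proof.
rewrite (_ : stay t = \bigcup_x \bigcup_j
  (fst @^-1` [set v | a x j v <= t] `&`
   (fun z : Omega * R' => b x j z.1 - z.2 * t) @^-1` `]t, +oo[)).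
  apply: bigcupT_measurable => x; apply: bigcupT_measurable => j.
  apply: measurableI.
    rewrite -[X in measurable X]setTI; apply: measurable_fst => //; exact: mle.
  rewrite -[X in measurable X]setTI.
  have mf : measurable_fun setT (fun z : Omega * R' => b x j z.1 - z.2 * t).
    apply: measurable_funB; first exact: measurableT_comp (mb x j) measurable_fst.
    apply: measurable_funM; last exact: measurable_cst.
    exact: measurable_snd.
  by apply: mf => //; exact: measurable_itv.
apply/seteqP; split => [[v u] [x [j [h1 h2]]]|[v u] [x _ [j _ [h1]]]].
  by exists x => //; exists j => //; split => //=; rewrite in_itv/= andbT ltrBrDr.
by rewrite /= in_itv/= andbT ltrBrDr => h2; exists x, j.
Qed.

Definition stay_at (t u : R) : set Omega := ysection (stay t) u.

Lemma stay_atE t u v : stay_at t u v <->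
  exists x j, a x j v <= t /\ t + u * t < b x j v.
Proof. by rewrite /stay_at /ysection /= inE. Qed.

Lemma measurable_stay_at t u : measurable (stay_at t u).
Proof. by apply: measurable_ysection; exact: measurable_stay. Qed.

Lemma Rintegral_stay (t u : R) : 0 < t -> 0 < u ->
  \int[P]_v \1_([set v | forall s : R, t <= s <= t + u * t -> Y v s = Y v t]) v
  = fine (P (stay_at t u)).
Proof.
move=> t0 u0; rewrite /Rintegral; congr fine.
transitivity (\int[P]_v (\1_(stay_at t u) v)%:E)%E; last first.
  by rewrite (integral_indic P measurableT (measurable_stay_at t u)) setIT.
apply: ae_integral_eq; apply: filterS hgood => v [ok hY].
congr EFin; rewrite !indicE; congr (nat_of_bool _)%:R.
have [E1 E2] := visited_constP ok hY t0 u0.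
by apply/idP/idP; rewrite !inE /=; [move=> /E1/stay_atE|move=> /stay_atE/E2].
Qed.


Variables (Phi : R -> R -> path_space R -> R) (Psi1 : R -> R).
Variables (Xi : R -> nbar -> R -> (R -> nbar) -> R) (Psi2 : R -> R -> R).
Hypotheses (hPhi : path_measurable Phi) (hA2 : assumption_A2 Phi).
Hypotheses (hA3 : assumption_A3 Phi Psi1) (hA4 : assumption_A4 Phi Xi).
Hypotheses (hA5i : assumption_A5i Xi) (hA5ii : assumption_A5ii Xi).
Hypotheses (hA5iii : assumption_A5iii Xi) (hA6 : assumption_A6 Xi Psi2).

Hypothesis hcov : forall t, 0 < t ->
  {ae P, forall v, exists x j, a x j v <= t < b x j v}.

Variables (theta : R) (theta0 : 0 < theta).

Local Notation dPsi := (derive1 (Psi2 ^~ theta)).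

Let dPsi_int : mu.-integrable `[0, theta] (EFin \o dPsi).
Proof. by have [_ /(_ _ theta0)[]] := hA6. Qed.

Let dPsi_int' : mu.-integrable `]0, theta] (EFin \o dPsi).
Proof.
by apply: integrableS dPsi_int => //; apply: subset_itvr; rewrite bnd_simp.
Qed.

Let ftc : \int[mu]_(u in `[0, theta]) dPsi u = Psi2 theta theta - Psi2 0 theta /\
  forall s, 0 < s < theta -> \int[mu]_(u in `[0, s]) dPsi u = Psi2 s theta - Psi2 0 theta.
Proof.
have [_ /(_ _ theta0)[c0 c1 dd ii]] := hA6.
exact: (integral_derivative_oo theta0 dd c0 c1 ii).
Qed.

(* [Psi2 0 + int_0^theta Psi2' 1{no exit before u} du] is [Psi2] at the exit
   time, or at [theta] if the exit occurs later. *)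
Definition proxy (t : R) (v : Omega) : R :=
  Psi2 0 theta + \int[mu]_(u in `]0, theta]) (dPsi u * \1_(stay t) (v, u))
  + (Psi1 theta - Psi2 theta theta) * \1_(stay_at t theta) v.

Let stay_iff t v x j u : good v -> 0 < t -> 0 <= u -> a x j v <= t < b x j v ->
  stay t (v, u) <-> t + u * t < b x j v.
Proof.
move=> [ok _] t0 u0 /andP[at_ tb]; split=> [[y [k /= [h1 h2]]]|h]; last by exists x, j.
have [||xy jk] := vis_inj ok (t := t) (x := x) (i := j) (y := y) (j := k); last by rewrite xy jk.
  by rewrite at_ tb.
by rewrite h1 (le_lt_trans _ h2)// lerDl mulr_ge0// ltW.
Qed.

Let proxy_const t v x j : good v -> 0 < t -> a x j v <= t ->
  t + theta * t < b x j v -> proxy t v = Psi1 theta.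
Proof.
move=> gv t0 at_ tb; have tb' : t < b x j v.
  by apply: lt_trans tb; rewrite ltrDl mulr_gt0.
have c : a x j v <= t < b x j v by rewrite at_ tb'.
rewrite /proxy (_ : \int[mu]_(u in _) _ = Psi2 theta theta - Psi2 0 theta); last first.
  rewrite -ftc.1 -Rintegral_itv_obnd_cbnd//; apply: eq_Rintegral => u.
  rewrite inE/= in_itv/= => /andP[u0 ut].
  rewrite indicE mem_set ?mulr1//; apply/(stay_iff gv t0 (ltW u0) c).
  by apply: le_lt_trans tb; rewrite lerD2l ler_wpM2r// ltW.
rewrite indicE mem_set ?mulr1; first by lra.
by apply/stay_atE; exists x, j.
Qed.

Let proxy_exit t v x j : good v -> 0 < t -> a x j v <= t < b x j v ->
  b x j v < t + theta * t -> proxy t v = Psi2 ((b x j v - t) / t) theta.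
Proof.
move=> gv t0 c tb; set s := _ / _.
have s0 : 0 < s < theta.
  case/andP: c => _ tb'.
  by rewrite divr_gt0 ?subr_gt0//= ltr_pdivrMr// ltrBlDl.
have sE : b x j v = t + s * t by rewrite /s divfK ?gt_eqF// addrC subrK.
have out u : 0 <= u -> stay t (v, u) <-> u < s.
  by move=> u0; rewrite (stay_iff gv t0 u0 c) sE ltrD2l ltr_pM2r.
rewrite /proxy indicE memNset; last first.
  move=> /stay_atE /((out theta (ltW theta0)).1); apply/negP; rewrite -leNgt.
  by case/andP: s0 => _ /ltW.
rewrite mulr0 addr0 (_ : \int[mu]_(u in _) _ = Psi2 s theta - Psi2 0 theta); last first.
  rewrite -ftc.2// -[RHS]Rintegral_itv_bndo_bndc; last first.
    by apply: integrableS dPsi_int => //; apply: subset_itvl; rewrite bnd_simp ltW//; case/andP: s0.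
  rewrite -[RHS]Rintegral_itv_obnd_cbnd; last first.
    by apply: integrableS dPsi_int => //; apply: subset_itv; rewrite bnd_simp// ltW//; case/andP: s0.
  rewrite Rintegral_mkcond [RHS]Rintegral_mkcond; congr Rintegral.
  apply/funext => u; rewrite /patch !mem_setE !in_itv/=.
  case: (ltP 0 u) => //= u0; have [us|su] := ltP u s.
    rewrite (le_trans (ltW us) (ltW (andP s0).2)) indicE mem_set ?mulr1//.
    by apply/(out _ (ltW u0)).
  case: ifP => // _; rewrite indicE memNset ?mulr0//.
  by move=> /(out _ (ltW u0)); rewrite ltNge su.
by rewrite addrC subrK.
Qed.

Definition low (K : nat) (t : R) : set Omega :=
  \bigcup_(y in `I_K.+1) \bigcup_k [set v | a y k v <= t + theta * t].

Let measurable_low K t : measurable (low K t).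
Proof. by apply: bigcup_measurable => y _; apply: bigcupT_measurable => k; exact: mle. Qed.

(** Without an exit both quantities equal [Psi1 theta]. After an exit, [Xi_near_Psi2] bounds the
    difference by [e] off the bad event, and (A5)(i) bounds it by twice the uniform bound of [Xi] on
    it. *)
Lemma Phi_proxy (e : R) : 0 < e -> exists M K, 0 <= M /\
  forall t (B : set Omega), 0 < t ->
   {ae P, forall v, B v \/ forall x j k, a x j v <= t < b x j v ->
       b x j v <= a x k v -> t + theta * t < a x k v} ->
   {ae P, forall v, `|Phi t (theta * t) (Y v) - proxy t v| <= e + M * \1_(B `|` low K t) v}.
Proof.
move=> e0; have [M0 hM0] := hA5i theta0.
have [K hK] := Xi_near_Psi2 hA5ii hA5iii hA6 theta0 e0.
have M00 : 0 <= M0.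
  apply: le_trans (hM0 None 0 (@infty_path R) _ (cadlag_segW _ (@cadlag_infty_path R))) => //.
  by rewrite lexx ltW.
exists (M0 + M0), K; split; first by rewrite addr_ge0.
move=> t B t0 nret; have tt0 : 0 < t + theta * t by rewrite addr_gt0// mulr_gt0.
apply: filterS3 (hcov t0) (hcov tt0) (filterI hgood nret).
move=> v [x [j c]] [x' [j' c']] [gv nr]; have [ok hY] := gv.
have ind0 (A : set Omega) : 0 <= \1_A v :> R by rewrite indicE.
case/andP: (c) => at_ tb.
have [lt|gt|eq] := ltgtP (b x j v) (t + theta * t).
- have [eta [ceta PhiE neta leta]] := Phi_exit hA2 hA4 ok hY t0 theta0 c lt.
  rewrite PhiE (proxy_exit gv t0 c lt); set s := _ / _ in ceta neta leta *.
  have s0 : 0 < s < theta.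
    by rewrite divr_gt0 ?subr_gt0//= ltr_pdivrMr// ltrBlDl.
  have s0' : 0 <= s <= theta by case/andP: s0 => /ltW -> /ltW.
  have [vB|vB] := pselect ((B `|` low K t) v).
    rewrite indicE mem_set// mulr1; apply: le_trans (ler_normB _ _) _.
    apply: (@le_trans _ _ (M0 + M0)); last by rewrite lerDr ltW.
    apply: lerD; first exact: hM0.
    rewrite (hA6.1 _ s 0%N)//; apply: hM0 => //.
    exact/cadlag_segW/cadlag_infty_path.
  rewrite indicE memNset// mulr0 addr0; apply: hK => //.
    apply: neta => k; case: nr => [vb|h]; first by exfalso; apply: vB; left.
    by apply: h.
  move=> r y rr ey; rewrite ltnNge; apply/negP => yK; apply: vB; right.
  by have [k hk] := leta r y rr ey; exists y => //; exists k.
- rewrite (Phi_const hA2 hA3 hY t0 theta0 at_ gt) (proxy_const gv t0 at_ gt).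
  rewrite subrr normr0; apply: addr_ge0; first exact: ltW.
  by apply: mulr_ge0 => //; exact: addr_ge0.
(* An exit exactly at [t + theta * t] is excluded: that time is also covered by a visit, whereas the
   end of a visit is not. *)
- have := vis_end ok x j x' j'; rewrite eq => /negP[]; exact: c'.
Qed.


Hypothesis hret : forall e : R, 0 < e -> \forall t \near 0^'+,
  exists B, [/\ measurable B, (P B <= e%:E)%E &
   {ae P, forall v, B v \/ forall x j k, a x j v <= t < b x j v ->
       b x j v <= a x k v -> t + theta * t < a x k v}].

Let near_low K v : good v ->
  \forall s \near (0 : R)^'+, forall y k, (y <= K)%N -> s < a y k v.
Proof.
move=> [ok _]; suff : \forall s \near (0 : R)^'+, forall y : 'I_K.+1, forall k, s < a y k v.
  by apply: filterS => s h y k yK; exact: (h (Ordinal (yK : (y < K.+1)%N)) k).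
apply: filter_forall => y; have [J hJ] := vis_locfin ok y 1.
have h : \forall s \near (0 : R)^'+, forall k : 'I_J, s < a y k v.
  by apply: filter_forall => k; apply: nbhs_right_lt; exact: vis_start ok y k.
apply: filterS2 h (nbhs_right_lt ltr01) => s h s1 k.
rewrite ltNge; apply/negP => ak.
have kJ : (k < J)%N by apply: hJ; exact: le_trans ak (ltW s1).
by have := h (Ordinal kJ); rewrite ltNge ak.
Qed.

(** For a good path the finitely many low states all start their visits after some positive time, so
    the decreasing events along [t = 1 / (n + 1)] have a null intersection. *)
Let low_cvg K (e : R) : 0 < e -> \forall t \near 0^'+, (P (low K t) <= e%:E)%E.
Proof.
move=> e0; pose F n := low K (n.+1%:R^-1).
have mF n : measurable (F n) by exact: measurable_low.
have dF : {homo F : n m / (n <= m)%N >-> (m <= n)%O}.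
  move=> n m nm; apply/subsetPset => v [y yK [k _ /= h]]; exists y => //; exists k => //=.
  apply: le_trans h _; have le : m.+1%:R^-1 <= n.+1%:R^-1 :> R.
    by rewrite lef_pV2 ?posrE// ler_nat ltnS.
  by apply: lerD => //; rewrite ler_wpM2l// ltW.
have P0 : P (\bigcap_n F n) = 0%E.
  apply/negligibleP; first exact: bigcapT_measurable.
  apply: negligibleS hgood => v hv gv.
  have [del /= del0 hd] := near_low K gv.
  have th1 : 0 < 1 + theta by rewrite addr_gt0.
  pose n := Num.truncn ((1 + theta) / del).
  pose s := n.+1%:R^-1 + theta * n.+1%:R^-1.
  have s0 : 0 < s by rewrite addr_gt0// ?mulr_gt0// invr_gt0.
  have sd : s < del.
    rewrite /s -[X in X + _]mul1r -mulrDl ltr_pdivrMr// mulrC -ltr_pdivrMr//.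
    exact: truncnS_gt.
  have [y /= yK [k _ /= h]] := hv n I.
  have yK' : (y <= K)%N by rewrite -ltnS.
  have := hd s _ s0 y k yK'; rewrite ltNge h => hh; apply/notF/hh.
  by rewrite /= sub0r normrN gtr0_norm.
have cv : (P \o F) x @[x --> \oo] --> 0%E.
  rewrite -P0; apply: (nonincreasing_cvg_mu _ mF (bigcapT_measurable mF) dF).
  exact: (le_lt_trans (probability_le1 P (mF 0%N)) (ltry 1)).
have e0' : (0%:E < e%:E)%E by rewrite lte_fin.
have [n _ hn] := cv _ (open_ereal_lt' e0').
have n0 : (0 : R) < n.+1%:R^-1 by rewrite invr_gt0.
apply: filterS (nbhs_right_lt n0) => t tn; apply: le_trans (ltW (hn n (leqnn n))).
apply: le_measure; rewrite ?inE; [exact: measurable_low|exact: measurable_low|].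
move=> v [y yK [k _ /= h]]; exists y => //; exists k => //=.
by apply: le_trans h _; apply: lerD; rewrite ?ler_wpM2l// ltW.
Qed.

Local Notation F t u := (fine (P (stay_at t u))).

Let F01 t u : 0 <= F t u <= 1.
Proof.
have ms := measurable_stay_at t u; rewrite fine_ge0//=.
by rewrite -lee_fin fineK ?fin_num_measure// probability_le1.
Qed.

Let mF t (D : set R') : measurable_fun D (fun u => F t u).
Proof.
apply: measurable_funTS; apply: measurableT_comp => //.
exact: (measurable_fun_ysection P (measurable_stay t)).
Qed.

Let integrable_proxy_cst (c : R) : P.-integrable setT (EFin \o cst c).
Proof. exact: finite_measure_integrable_cst. Qed.

Let integrable_indic' (A : set Omega) (c : R) : measurable A ->
  P.-integrable setT (EFin \o (fun v => c * \1_A v)).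
Proof.
move=> mA; have := integrableZl measurableT c (integrable_indic P mA).
by apply: eq_integrable.
Qed.

Let Rintegral_indic' (A : set Omega) (c : R) : measurable A ->
  \int[P]_v (c * \1_A v) = c * fine (P A).
Proof.
move=> mA; rewrite RintegralZl//; last by have := integrable_indic P mA; apply: eq_integrable.
by rewrite /Rintegral integral_indic// setIT.
Qed.

Let Rint_cst (c : R) : \int[P]_v (cst c v) = c.
Proof.
rewrite Rintegral_cst// -[RHS]mulr1; congr (_ * _).
exact: (congr1 fine (probability_setT P)).
Qed.

Let integrable_proxy t : P.-integrable setT (EFin \o proxy t).
Proof.
have i1 := integrable_section P dPsi_int' (measurable_stay t).
have i2 := integrable_indic' (Psi1 theta - Psi2 theta theta) (measurable_stay_at t theta).
have := integrableD measurableT (integrableD measurableT (integrable_proxy_cst (Psi2 0 theta)) i1) i2.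
by apply: eq_integrable.
Qed.

Let Rintegral_proxy t : \int[P]_v proxy t v = Psi2 0 theta +
  \int[mu]_(u in `]0, theta]) (dPsi u * F t u) + (Psi1 theta - Psi2 theta theta) * F t theta.
Proof.
have i1 := integrable_section P dPsi_int' (measurable_stay t).
have i2 := integrable_indic' (Psi1 theta - Psi2 theta theta) (measurable_stay_at t theta).
have i0 := integrable_proxy_cst (Psi2 0 theta).
have i01 : P.-integrable setT (EFin \o (fun v => Psi2 0 theta +
    \int[mu]_(u in `]0, theta]) (dPsi u * \1_(stay t) (v, u)))).
  by have := integrableD measurableT i0 i1; apply: eq_integrable.
rewrite /proxy RintegralD// RintegralD// Rintegral_indic'; last exact: measurable_stay_at.
by rewrite (Rint_cst (Psi2 0 theta)) (Rintegral_section P dPsi_int' (measurable_stay t)).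
Qed.

(** Dominated convergence along sequences decreasing to 0 in value, with the absolute value of
    [Psi2'] as majorant because the other factor is a probability. *)
Let proxy_limit (L : R -> R) :
  (forall u, 0 < u -> F t u @[t --> 0^'+] --> L u) ->
  \int[P]_v proxy t v @[t --> 0^'+] -->
    Psi2 0 theta + (Psi1 theta - Psi2 theta theta) * L theta
    + \int[mu]_(s in `[0, theta]) (dPsi s * L s).
Proof.
move=> FL; apply/cvg_at_rightP => t ht.
under eq_fun do rewrite Rintegral_proxy.
rewrite addrAC; have FLt u : 0 < u -> F (t n) u @[n --> \oo] --> L u.
  by move=> u0; have /cvg_at_rightP := FL u u0; apply.
pose D : set R' := `]0, theta]%classic.
have mD : measurable D by exact: measurable_itv.
have mdPsi : measurable_fun D (dPsi : R' -> R).
  by case/integrableP : dPsi_int' => /measurable_EFinP.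
pose f_ n (u : R') := (dPsi u * F (t n) u)%:E.
pose f (u : R') := (dPsi u * L u)%:E.
have mf_ n : measurable_fun D (f_ n).
  by apply/measurable_EFinP; apply: measurable_funM => //; exact: mF.
have f_f u : D u -> f_ n u @[n --> \oo] --> f u.
  rewrite /D /= in_itv/= => /andP[u0 _]; apply: cvg_EFin; first exact: nearW.
  by apply: cvgM; [exact: cvg_cst|exact: FLt].
have mf : measurable_fun D f by exact: emeasurable_fun_cvg mf_ f_f.
have ig : mu.-integrable D (abse \o (EFin \o dPsi)) by exact: integrable_abse.
have [||intf _ cv] := dominated_convergence mD mf_ mf _ ig _.
- by apply: aeW => u; exact: f_f.
- apply: aeW => u n _ /=; rewrite lee_fin normrM ler_piMr//.
  by have /andP[F0 F1] := F01 (t n) u; rewrite ger0_norm.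
rewrite -Rintegral_itv_obnd_cbnd; last exact: intf.
apply: cvgD; first apply: cvgD; first exact: cvg_cst.
- apply: fine_cvg; rewrite fineK; first exact: cv.
  exact: integrable_fin_num.
- by apply: cvgM; [exact: cvg_cst|exact: FLt].
Qed.

Theorem Phi_limit (L : R -> R) :
  (forall u, 0 < u ->
    \int[P]_v \1_([set v | forall s : R, t <= s <= t + u * t -> Y v s = Y v t]) v
      @[t --> 0^'+] --> L u) ->
  \int[P]_v Phi t (theta * t) (Y v) @[t --> 0^'+] -->
    Psi2 0 theta + (Psi1 theta - Psi2 theta theta) * L theta
    + \int[mu]_(s in `[0, theta]) (dPsi s * L s).
Proof.
move=> hL; have FL u : 0 < u -> F t u @[t --> 0^'+] --> L u.
  move=> u0; apply: cvg_trans (hL u u0); apply: near_eq_cvg.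
  by near=> t; rewrite Rintegral_stay//; near: t; exact: nbhs_right_gt.
have cp := proxy_limit FL; set l := (X in _ --> X) in cp *.
apply/cvgrPdist_le => e e0.
have e20 : 0 < e / 2 by rewrite divr_gt0.
have e40 : 0 < e / 4 by rewrite divr_gt0.
have [M [K [M0 hMK]]] := Phi_proxy e40.
(* The bad event has probability at most [2 * d'], and [M * d' <= e / 8]; thus it costs at most
   [e / 4], next to [e / 4] from [Phi_proxy] and [e / 2] from [proxy_limit]. *)
pose d' := e / 8 / (M + 1).
have d'0 : 0 < d' by rewrite !divr_gt0// ltr_wpDl.
move/cvgrPdist_le : cp => /(_ _ e20) cp.
near=> t.
have t0 : 0 < t by near: t; exact: nbhs_right_gt.
have [B [mB PB nB]] : exists B, [/\ measurable B, (P B <= d'%:E)%E &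
   {ae P, forall v, B v \/ forall x j k, a x j v <= t < b x j v ->
       b x j v <= a x k v -> t + theta * t < a x k v}].
  by near: t; exact: hret.
have Plow : (P (low K t) <= d'%:E)%E by near: t; exact: low_cvg.
have hdiff := hMK t B t0 nB.
have [Fm mFm hFm] := measurable_functional (hPhi (ltW t0) (ltW (mulr_gt0 theta0 t0))).
set A := B `|` low K t in hdiff.
have mA : measurable A by apply: measurableU => //; exact: measurable_low.
pose g v := e / 4 + M * \1_A v.
have g0 v : 0 <= g v.
  by apply: addr_ge0; [exact: ltW|apply: mulr_ge0 => //; rewrite indicE].
have ig : P.-integrable setT (EFin \o g).
  have := integrableD measurableT (integrable_proxy_cst (e / 4)) (integrable_indic' M mA).
  by apply: eq_integrable.
have mproxy : measurable_fun setT (proxy t).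
  by case/integrableP : (integrable_proxy t) => /measurable_EFinP.
have mg : measurable_fun setT g by case/integrableP : ig => /measurable_EFinP.
(* The difference is clamped between [- g] and [g]. This changes it only on a null set and makes it
   integrable everywhere bounded by [g]. *)
pose dd v := Num.max (- g v) (Num.min (g v) (Fm v - proxy t v)).
have ddg v : `|dd v| <= g v.
  rewrite ler_norml; apply/andP; split; first by rewrite le_max lexx.
  by rewrite ge_max (le_trans _ (g0 v)) ?oppr_le0//= ge_min lexx.
have mdd : measurable_fun setT dd.
  apply: measurable_realfun.measurable_maxr; first exact: measurable_funN.
  by apply: measurable_realfun.measurable_minr => //; exact: measurable_funB.
have idd : P.-integrable setT (EFin \o dd).
  apply: (@le_integrable _ _ _ P _ measurableT _ _ _ _ ig).
    exact/measurable_EFinP.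
  by move=> v _ /=; rewrite lee_fin (ger0_norm (g0 v)).
have -> : \int[P]_v Phi t (theta * t) (Y v) = \int[P]_v (proxy t v + dd v).
  rewrite /Rintegral; congr fine; apply: ae_integral_eq.
  apply: filterS2 hFm hdiff => v hFv; rewrite hFv -/(g v) => hv; congr EFin.
  rewrite /dd; have /andP[h1 h2] : - g v <= Fm v - proxy t v <= g v by rewrite -ler_norml.
  by rewrite (min_idPr h2) (max_idPr h1) addrC subrK.
rewrite RintegralD// opprD addrA; apply: le_trans (ler_normB _ _) _.
rewrite (splitr e); apply: lerD; first by near: t; exact: cp.
apply: le_trans (le_normr_Rintegral measurableT idd) _.
apply: (@le_trans _ _ (\int[P]_v g v)).
  apply: le_Rintegral => //.
  by have := integrable_abse idd; apply: eq_integrable.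
rewrite /g (RintegralD measurableT (integrable_proxy_cst (e / 4)) (integrable_indic' M mA)).
rewrite (Rint_cst (e / 4)) Rintegral_indic'//.
have PA : fine (P A) <= d' + d'.
  rewrite -lee_fin fineK ?fin_num_measure// EFinD.
  apply: le_trans (leeD PB Plow).
  by apply: measureU2 => //; exact: measurable_low.
have : M * fine (P A) <= e / 4.
  apply: (@le_trans _ _ (M * (d' + d'))); first by rewrite ler_wpM2l.
  have : M * d' <= e / 8.
    rewrite /d' mulrCA ler_piMr ?divr_ge0// ?(ltW e0)// ler_pdivrMr ?mul1r ?lerDl//.
    by rewrite ltr_wpDl.
  lra.
lra.
Unshelve. all: end_near. Qed.

End Random.

(** * Measurability of the visits *)

Section Measurability.
Context d (T : measurableType d) (R : realType).
Variables (g : nat -> R) (n : nat -> R -> T -> nat) (tau : nat -> nat -> T -> R).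
Hypothesis g0 : forall x, 0 <= g x.
Hypothesis tau0 : forall x i v, 0 <= tau x i v.
Hypothesis mtau : forall x i, measurable_fun setT (tau x i).

Lemma measurable_work x t : (forall k, measurable [set v | n x t v = k]) ->
  measurable_fun setT
    (fun v => work (fun x t => n x t v) (fun x i => tau x i v) x t).
Proof.
move=> mn _ B mB; rewrite setTI.
(* The number of summands is random, so the event is split according to its value. *)
rewrite (_ : _ @^-1` _ = \bigcup_k ([set v | n x t v = k] `&`
    (fun v => \sum_(i < k) tau x i v) @^-1` B)).
  apply: bigcupT_measurable => k; apply: measurableI => //.
  rewrite -[X in measurable X]setTI.
  suff : measurable_fun setT (fun v => \sum_(i < k) tau x i v) by apply.
  exact: measurable_sum.
apply/seteqP; split => [v Bv|v [k _ [/= <-]]//].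
by exists (n x t v).
Qed.

Lemma measurable_clk t : (forall x k, measurable [set v | n x t v = k]) ->
  measurable_fun setT
    (fun v => clk g (fun x t => n x t v) (fun x i => tau x i v) t).
Proof.
move=> mn; apply: ge0_emeasurable_sum => [x v _ _|x _]; first exact: gwork_ge0.
apply/measurable_EFinP; apply: measurable_funM; first exact: measurable_cst.
exact: measurable_work.
Qed.

Hypothesis mn : forall x t k, 0 <= t -> measurable [set v | n x t v = k].

Let mcmp x t (Q : pred nat) : 0 <= t -> measurable [set v | Q (n x t v)].
Proof.
move=> t0; rewrite (_ : [set v | _] = \bigcup_(k in [set k | Q k]) [set v | n x t v = k]).
  by apply: bigcup_measurable => k _; exact: mn.
by apply/seteqP; split => [v Qv|v [k Qk /= ->]//]; exists (n x t v).
Qed.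

Let mif x j k (Q : nat -> pred nat) (c : \bar R) :
  measurable_fun setT (fun v => if Q j (n x (qdense R k) v)
    then clk g (fun x t => n x t v) (fun x i => tau x i v) (qdense R k) else c).
Proof.
have q0 := qdense_ge0 R k.
apply: measurable_fun_if => //.
- apply: (measurable_fun_bool true); rewrite setTI; exact: mcmp q0.
- by apply: measurable_funTS; apply: measurable_clk => y l; exact: mn.
Qed.

Lemma measurable_vstart x j : measurable_fun setT
  (fun v => vstart g (fun x t => n x t v) (fun x i => tau x i v) x j).
Proof.
apply: measurableT_comp => //; apply: measurable_fun_esups => k.
exact: (mif x j k (fun j i => (i <= j)%N)).
Qed.

Lemma measurable_vend x j : measurable_fun setT
  (fun v => vend g (fun x t => n x t v) (fun x i => tau x i v) x j).
Proof.
apply: measurableT_comp => //; apply: measurable_fun_einfs => k.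
exact: (mif x j k (fun j i => (j < i)%N)).
Qed.

End Measurability.

(** * Independence *)

Section Indep.
Context d (T : measurableType d) (R : realType) (P : probability T R).

Lemma mutually_indep_pair (I : choiceType) (F : I -> set (set T)) i j A B :
  mutually_indep P F -> i != j -> F i A -> F j B ->
  P (A `&` B) = (P A * P B)%E.
Proof.
move=> hF ij FA FB; pose X k := if k == i then A else B.
have Xi : X i = A by rewrite /X eqxx.
have Xj : X j = B by rewrite /X eq_sym (negPf ij).
have ni : i \notin [fset j]%fset by rewrite inE.
have := hF (i |` [fset j])%fset X; rewrite big_fsetU1//= big_seq_fset1 Xi Xj => <-.
  congr (P _); apply/seteqP; split => [t [At Bt] k /=|t h].
    by rewrite !inE => /orP[/eqP->|/eqP->]; rewrite ?Xi ?Xj.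
  by split; [rewrite -Xi; apply: h|rewrite -Xj; apply: h]; rewrite /= !inE eqxx ?orbT.
by move=> k; rewrite !inE => /orP[/eqP->|/eqP->]; rewrite ?Xi ?Xj.
Qed.

(** The first [n] events occur together with probability at most [c ^+ n]. *)
Lemma mutually_indep_null (I : choiceType) (F : I -> set (set T))
    (e : nat -> I) (A : I -> set T) (c : R) :
  mutually_indep P F -> injective e -> c < 1 ->
  (forall k, F (e k) (A (e k))) -> (forall k, measurable (A (e k))) ->
  (forall k, (P (A (e k)) <= c%:E)%E) -> P (\bigcap_k A (e k)) = 0%E.
Proof.
move=> hF einj c1 FA mA Ac.
have c0 : 0 <= c by rewrite -lee_fin; apply: le_trans (Ac 0%N).
pose J := fix J n : {fset I} := if n is m.+1 then (e m |` J m)%fset else fset0.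
have JP n i : i \in J n -> exists2 k, (k < n)%N & i = e k.
  elim: n => [|n IH] //=; rewrite !inE => /orP[/eqP->|/IH[k kn ->]]; first by exists n.
  by exists k => //; exact: ltnW.
have key n : (P (\bigcap_(i in [set` J n]) A i) <= (c ^+ n)%:E)%E.
  rewrite hF; last by move=> i /JP[k _ ->].
  elim: n => [|n IH]; first by rewrite /= big_seq_fset0 expr0.
  rewrite /= big_fsetU1/=; last first.
    by apply/negP => /JP[k kn /einj nk]; rewrite nk ltnn in kn.
  rewrite exprS EFinM; apply: lee_pmul => //.
  by rewrite big_seq; apply: prode_ge0 => i _.
have mcap : measurable (\bigcap_k A (e k)) by exact: bigcapT_measurable.
apply/eqP; rewrite eq_le measure_ge0 andbT; apply/lee_addgt0Pr => r r0.
rewrite add0e; have : \forall n \near \oo, `|c ^+ n| < r.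
  have cv : c ^+ n @[n --> \oo] --> 0 by apply: cvg_expr; rewrite ger0_norm.
  by move/cvgr0Pnorm_lt : cv; apply.
move=> [n _ /(_ n (leqnn n))]; rewrite ger0_norm ?exprn_ge0// => cn.
apply: (@le_trans _ _ (c ^+ n)%:E); last by rewrite lee_fin ltW.
apply: le_trans (key n); apply: le_measure; rewrite ?inE//.
  by apply: fin_bigcap_measurable => [|i /JP[k _ ->]//]; exact: finite_fset.
by move=> t h i /= /JP[k _ ->]; exact: h.
Qed.

(** A pi-system for the sigma-algebra of all components other than [i0], enlarged by the part [F0]
    of the component [i0]. The choice of [F0] as the singleton of [setT] leaves [i0] out. *)
Definition cylinders (I : choiceType) (F : I -> set (set T)) (i0 : I)
    (F0 : set (set T)) : set (set T) :=
  [set X | exists (J : {fset I}) A C, [/\ i0 \notin J, forall i, i \in J -> F i (A i),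
    F0 C & X = \bigcap_(i in [set` J]) A i `&` C]].

Section grouping.
Variables (I : choiceType) (F : I -> set (set T)) (hF : mutually_indep P F).
Hypothesis FT : forall i, F i setT.
Hypothesis FI : forall i, setI_closed (F i).
Hypothesis Fm : forall i, F i `<=` measurable.
Variables (i0 : I) (F0 : set (set T)).
Hypotheses (F0T : F0 setT) (F0I : setI_closed F0) (F0F : F0 `<=` F i0).

Lemma cylinders_other i : i != i0 -> F i `<=` cylinders F i0 F0.
Proof.
move=> ii A FA; exists [fset i]%fset, (fun _ => A), setT; split => //.
- by rewrite inE eq_sym.
- by move=> k; rewrite inE => /eqP->.
- rewrite setIT; apply/seteqP; split => [t At k //|t]; apply.
  by rewrite /= inE.
Qed.

Lemma cylinders_own : F0 `<=` cylinders F i0 F0.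
Proof.
move=> C F0C; exists fset0, (fun _ => setT), C; split => //.
by apply/seteqP; split => [t Ct|t []//]; split.
Qed.

Lemma cylinders_setI : setI_closed (cylinders F i0 F0).
Proof.
move=> _ _ [J1 [A1 [C1 [n1 FA1 FC1 ->]]]] [J2 [A2 [C2 [n2 FA2 FC2 ->]]]].
pose A i := (if i \in J1 then A1 i else setT) `&` (if i \in J2 then A2 i else setT).
exists (J1 `|` J2)%fset, A, (C1 `&` C2); split.
- by rewrite inE negb_or n1.
- move=> i _; apply: FI; first by case: ifP => [/FA1|].
  by case: ifP => [/FA2|].
- exact: F0I.
- apply/seteqP; split => [t [[h1 c1] [h2 c2]]|t [h [c1 c2]]].
    split => // i _; split.
      by case: ifP => // iJ; exact: h1.
    by case: ifP => // iJ; exact: h2.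
  split; split => // i /= iJ.
    by have := h i; rewrite /= inE /A iJ => /(_ isT)[].
  by have := h i; rewrite /= inE /A iJ orbT => /(_ isT)[].
Qed.

Lemma cylinders_measurable : cylinders F i0 F0 `<=` measurable.
Proof.
move=> _ [J [A [C [_ FA FC ->]]]]; apply: measurableI; last exact/Fm/F0F.
apply: fin_bigcap_measurable; first exact: finite_fset.
by move=> i iJ; apply: (Fm (i := i)); exact: FA.
Qed.

(** The finite measures [P (D & E)] and [P D * P E], as functions of [D], agree on the pi-system of
    cylinders, hence on the sigma-algebra it generates. For cylinders it is enough that [E] is
    independent of [F0], provided the intersections with [E] stay in the component [i0]. *)
Lemma indep_cylinders (E : set T) : measurable E ->
  (forall C, F0 C -> F i0 (C `&` E) /\ P (C `&` E) = (P C * P E)%E) ->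
  forall D, <<s cylinders F i0 F0 >> D -> P (D `&` E) = (P D * P E)%E.
Proof.
move=> mE hE D hD.
have step (J : {fset I}) A C : i0 \notin J -> (forall i, i \in J -> F i (A i)) -> F i0 C ->
    P (\bigcap_(i in [set` J]) A i `&` C) = (P C * \prod_(i <- J) P (A i))%E.
  move=> nJ FA FC; pose A' i := if i == i0 then C else A i.
  have iJ i : i \in J -> (i == i0) = false.
    by move=> iJ; apply/negbTE; apply: contraNneq nJ => <-.
  have A'0 : A' i0 = C by rewrite /A' eqxx.
  have pE : (\prod_(i <- J) P (A' i) = \prod_(i <- J) P (A i))%E.
    by apply: eq_big_seq => i ij; rewrite /A' iJ.
  have := hF (J := (i0 |` J)%fset) (A := A'); rewrite big_fsetU1//= A'0 pE => <-.
    congr (P _); apply/seteqP; split => [t [h c] i /=|t h].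
      rewrite !inE /A'; case: eqP => //= _ ij; exact: h.
    split=> [i /= ij|]; last by have := h i0; rewrite /= !inE eqxx /A' eqxx; apply.
    by have := h i; rewrite /= !inE ij orbT /A' iJ//; apply.
  move=> i; rewrite !inE /A'; case: eqP => [->//|_] /=; exact: FA.
have agree X : cylinders F i0 F0 X -> P (X `&` E) = (P X * P E)%E.
  move=> [J [A [C [nJ FA FC ->]]]]; rewrite -setIA.
  have [FCE PCE] := hE C FC.
  by rewrite !step//; [rewrite PCE muleAC|exact: F0F].
pose m1 := mrestr P mE.
pose m2 := mscale (NngNum (fine_ge0 (measure_ge0 P E))) P.
have m2E X : m2 X = (P X * P E)%E.
  by rewrite /m2 /mscale /= fineK ?fin_num_measure// muleC.
have := @g_sigma_algebra_measure_unique _ R T (cylinders F i0 F0)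
  cylinders_measurable (fun _ => setT) _ _ m1 m2 cylinders_setI _ _ D hD.
move=> h; rewrite -m2E; apply: h.
- by move=> _; exact: cylinders_own.
- exact: bigcup_const.
- by move=> X hX; exact: (etrans (agree X hX) (esym (m2E X))).
- move=> _; have : (P (setT `&` E) < +oo)%E by rewrite ltey_eq fin_num_measure// setTI.
  exact.
Qed.

End grouping.

End Indep.

(** * The driving variables *)

Section SigmaGenerated.
Context d (T : measurableType d) d' (T' : measurableType d').
Variables (J : Type) (D : set J) (X : J -> T -> T').
Local Notation S := (sigma_generated D X).

Let sS : sigma_algebra setT S := smallest_sigma_algebra _ _.

Lemma sigma_generatedT : S setT.
Proof. by have /sigma_algebraP[] := sS. Qed.

Lemma sigma_generatedI : setI_closed S.
Proof. by have /sigma_algebraP[] := sS. Qed.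

Lemma sigma_generated_preimage j B : D j -> measurable B -> S (X j @^-1` B).
Proof.
move=> Dj mB; apply: sub_sigma_algebra; exists j => //.
by exists B => //; rewrite setTI.
Qed.

Lemma sigma_generated_measurable : (forall j, D j -> measurable_fun setT (X j)) ->
  S `<=` measurable.
Proof.
move=> mX; apply: smallest_sub; first exact: sigma_algebra_measurable.
by move=> _ [j Dj [B mB <-]]; exact: mX.
Qed.

Lemma sigma_generated_sigma_algebra : sigma_algebra setT S.
Proof. exact: sS. Qed.

End SigmaGenerated.

Section PoissonPmf.
Context (R : realType).

Lemma poisson_pmf0 (h : R) : 0 < h -> poisson_pmf h 0 = expR (- h).
Proof. by move=> h0; rewrite /poisson_pmf h0 expr0 fact0 invr1 !mul1r. Qed.

Lemma poisson_pmf1 (h : R) : 0 < h -> poisson_pmf h 1 = h * expR (- h).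
Proof. by move=> h0; rewrite /poisson_pmf h0 expr1 invr1 mulr1. Qed.

(** One term of the exponential series gives [(2 * h) ^+ k / k! <= expR (2 * h)]; the resulting
    geometric decay in [k] makes the sums in [mean_work] elementary. *)
Lemma poisson_pmf_le (h : R) k : 0 < h -> poisson_pmf h k <= expR h / 2 ^+ k.
Proof.
move=> h0; rewrite /poisson_pmf h0.
have le : (2 * h) ^+ k / k`!%:R <= expR (2 * h).
  case: k => [|k]; first by rewrite expr0 fact0 invr1 mulr1 -expR0 ler_expR mulr_ge0// ltW.
  apply: le_trans (expR_ge1Dxn k _); last by rewrite mulr_ge0// ltW.
  by rewrite lerDr.
have -> : h ^+ k / k`!%:R * expR (- h) = ((2 * h) ^+ k / k`!%:R) * (expR (- h) / 2 ^+ k).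
  by rewrite exprMn; field; rewrite ?pnatr_eq0 -?lt0n ?fact_gt0 ?expf_neq0//= ?andbT.
apply: (@le_trans _ _ (expR (2 * h) * (expR (- h) / 2 ^+ k))).
  by rewrite ler_wpM2r// divr_ge0 ?expR_ge0// exprn_ge0.
by rewrite mulrA -expRD (_ : 2 * h - h = h)//; ring.
Qed.

End PoissonPmf.

Section Driving.
Context (R : realType) d (Omega : measurableType d) (P : probability Omega R).
Variables (N : nat -> R -> {RV P >-> nat}) (T0 : {RV P >-> R}).
Variable (T : nat -> nat -> {RV P >-> R}).
Hypothesis hD : driving_variables N T0 T.

Let hN x : poisson_process 1 (N x). Proof. by case: hD. Qed.
Let hI : mutually_indep P (driving_sigma N T0 T). Proof. by case: hD. Qed.

Lemma measurable_count x t k : measurable [set v | N x t v = k].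
Proof.
rewrite -[X in measurable X]setTI.
have -> : [set v | N x t v = k] = N x t @^-1` [set k] by [].
exact: measurable_funP.
Qed.

Lemma measurable_incr x s t (Q : nat -> Prop) :
  measurable [set v | Q (N x t v - N x s v)%N].
Proof.
rewrite (_ : [set v | _] = \bigcup_k \bigcup_l
    ([set v | N x t v = k] `&` [set v | N x s v = l] `&` [set v | Q (k - l)%N])).
  apply: bigcupT_measurable => k; apply: bigcupT_measurable => l.
  apply: measurableI; first by apply: measurableI; exact: measurable_count.
  have [h|h] := pselect (Q (k - l)%N).
    by rewrite (_ : [set v | _] = setT)//; apply/seteqP; split.
  by rewrite (_ : [set v | _] = set0)//; apply/seteqP; split.
apply/seteqP; split => [v h|v [k _ [l _ [[/= <- <-]]]]//].
by exists (N x t v) => //; exists (N x s v).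
Qed.

Lemma prob_incr0 x s t : 0 <= s -> s < t ->
  P [set v | (N x t v - N x s v)%N = 0%N] = (expR (- (t - s)))%:E.
Proof.
move=> s0 st; have [_ _ _ _ ->] := hN x; last by rewrite s0.
by rewrite mul1r poisson_pmf0// subr_gt0.
Qed.

Lemma prob_incr_ge1 x s t : 0 <= s -> s < t ->
  (P [set v | (0 < N x t v - N x s v)%N] <= (t - s)%:E)%E.
Proof.
move=> s0 st.
have -> : [set v | (0 < N x t v - N x s v)%N] = ~` [set v | (N x t v - N x s v)%N = 0%N].
  by apply/seteqP; split => v /=; rewrite lt0n => /eqP.
rewrite probability_setC; last exact: (measurable_incr x s t (fun k => k = 0%N)).
rewrite prob_incr0// -EFinB lee_fin.
by have := expR_ge1Dx (- (t - s)); lra.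
Qed.

Lemma prob_incr_ge2 x s t : 0 <= s -> s < t ->
  (P [set v | (1 < N x t v - N x s v)%N] <= ((t - s) ^+ 2)%:E)%E.
Proof.
move=> s0 st; have h0 : 0 < t - s by rewrite subr_gt0.
pose A k := [set v | (N x t v - N x s v)%N = k].
have mA k : measurable (A k) := measurable_incr x s t (fun i => i = k).
have -> : [set v | (1 < N x t v - N x s v)%N] = ~` (A 0%N `|` A 1%N).
  apply/seteqP; split => v /=; rewrite /A /=.
    by move=> h [e|e]; rewrite e in h.
  by case: (N x t v - N x s v)%N => [|[|k]]//; case; [left|right].
rewrite probability_setC; last exact: measurableU.
rewrite measureU//; last first.
  by apply/seteqP; split => v //= [h1 h2]; rewrite /A /= in h1 h2; rewrite h1 in h2.
have pA k : P (A k) = (poisson_pmf (t - s) k)%:E.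
  by have [_ _ _ _ ->] := hN x; rewrite ?s0// mul1r.
rewrite [X in (_ - X)%E](_ : _ = (expR (- (t - s)) * (1 + (t - s)))%:E); last first.
  transitivity (P (A 0%N) + P (A 1%N))%E; first by [].
  by rewrite !pA poisson_pmf0// poisson_pmf1// -EFinD; congr EFin; ring.
rewrite -EFinB lee_fin.
(* With [h = t - s] the probability is [1 - expR (- h) * (1 + h)], which is at most
   [1 - (1 - h) * (1 + h) = h ^+ 2]. *)
have := expR_ge1Dx (- (t - s)); set h := t - s in h0 *.
by move=> h1; have : (1 - h) * (1 + h) <= expR (- h) * (1 + h); [rewrite ler_wpM2r//; lra|nra].
Qed.

Lemma driving_sigmaT i : driving_sigma N T0 T i setT.
Proof. by case: i => [x|[[x k]|]]; exact: sigma_generatedT. Qed.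

Lemma driving_sigmaI i : setI_closed (driving_sigma N T0 T i).
Proof. by case: i => [x|[[x k]|]]; exact: sigma_generatedI. Qed.

Lemma driving_sigma_measurable i : driving_sigma N T0 T i `<=` measurable.
Proof.
by case: i => [x|[[x k]|]]; apply: sigma_generated_measurable => *; exact: measurable_funP.
Qed.

Lemma driving_count x t (B : set nat) : 0 <= t ->
  driving_sigma N T0 T (inl x) (N x t @^-1` B).
Proof.
by move=> t0; exact: (sigma_generated_preimage (X := fun t => N x t : Omega -> nat)).
Qed.

Lemma driving_holding x k (B : set R) : measurable B ->
  driving_sigma N T0 T (inr (Some (x, k))) (T x k @^-1` B).
Proof.
by move=> mB; exact: (@sigma_generated_preimage _ _ _ _ _ _ (fun _ => T x k : Omega -> R) tt).
Qed.

Lemma driving_incr x s t (Q : nat -> Prop) : 0 <= s -> 0 <= t ->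
  driving_sigma N T0 T (inl x) [set v | Q (N x t v - N x s v)%N].
Proof.
move=> s0 t0; set S := driving_sigma _ _ _ _.
have [_ _ SU] : sigma_algebra setT S by exact: sigma_generated_sigma_algebra.
have E : [set v | Q (N x t v - N x s v)%N] = \bigcup_k \bigcup_l
    ([set v | N x t v = k] `&` [set v | Q (k - N x s v)%N /\ N x s v = l]).
  apply/seteqP; split => [v h|v [k _ [l _ [/= <- []]]]//].
  by exists (N x t v) => //; exists (N x s v).
rewrite E; apply: (SU) => k; apply: (SU) => l; apply: driving_sigmaI.
  exact: (@driving_count x t [set k] t0).
have [q|q] := pselect (Q (k - l)%N).
  rewrite (_ : [set v | _] = N x s @^-1` [set l]); first exact: driving_count.
  by apply/seteqP; split => [v []|v /= e]//; rewrite e.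
rewrite (_ : [set v | _] = N x s @^-1` set0); first exact: driving_count.
by apply/seteqP; split => [v /= [+ e]|v]//; rewrite e.
Qed.

Lemma holding_tail x i (u : R) : 0 <= u ->
  P [set v | u < T x i v] = (expR (- u))%:E.
Proof.
move=> u0; have [_ _ hT _] := hD.
have m : measurable (`]-oo, u]%classic : set R) by exact: measurable_itv.
have -> : [set v | u < T x i v] = ~` (T x i @^-1` `]-oo, u]%classic).
  apply/seteqP; split => v /=; rewrite in_itv/= leNgt; first by move=> ->.
  by move=> /negP; rewrite negbK.
have mT : measurable (T x i @^-1` `]-oo, u]%classic).
  by rewrite -[X in measurable X]setTI; exact: measurable_funP.
rewrite probability_setC// [X in (_ - X)%E](hT x i _ m).
suff -> : exponential_prob 1 `]-oo, u]%classic = (1 - expR (- u))%:E.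
  by rewrite -EFinB; congr EFin; ring.
have mpdf : measurable_fun setT (EFin \o exponential_pdf (1 : R)).
  by apply/measurable_EFinP; exact: measurable_exponential_pdf.
rewrite /exponential_prob (@itv_bndbnd_setU _ _ _ (BLeft 0)) ?bnd_simp//.
rewrite ge0_integral_setU//=.
- rewrite integral0_eq ?add0e; last first.
    by move=> y /=; rewrite in_itv/= => y0; rewrite lt0_exponential_pdf.
  move: u0; rewrite le_eqVlt => /orP[/eqP<-|u0].
    by rewrite set_itv1 integral_set1 oppr0 expR0 subrr.
  by have := exponential_prob_itv0c 1 u0; rewrite /exponential_prob => ->; rewrite mulN1r.
- exact: measurable_funTS.
- by move=> y _; rewrite lee_fin exponential_pdf_ge0.
- by apply/disj_set2P; rewrite -subset0 => y []/=; rewrite !in_itv/= => y0 /andP[]; rewrite leNgt y0.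
Qed.

End Driving.

(** * Almost sure properties of the driving variables *)

Section AlmostSure.
Context (R : realType) d (Omega : measurableType d) (P : probability Omega R).
Variables (N : nat -> R -> {RV P >-> nat}) (T0 : {RV P >-> R}).
Variable (T : nat -> nat -> {RV P >-> R}).
Hypothesis hD : driving_variables N T0 T.

Let hN x : poisson_process 1 (N x). Proof. by case: hD. Qed.
Let hI : mutually_indep P (driving_sigma N T0 T). Proof. by case: hD. Qed.

Lemma ae_of_null (A : set Omega) : measurable A -> P A = 0%E ->
  {ae P, forall v, ~ A v}.
Proof.
by move=> mA A0; exists A; split=> // v /= h; apply: contrapT.
Qed.

Lemma bigcap_null (B : nat -> set Omega) (c : R) :
  (forall m, measurable (B m)) -> (forall m, (P (B m) <= (c / m.+1%:R)%:E)%E) ->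
  {ae P, forall v, exists m, ~ B m v}.
Proof.
move=> mB PB; have mcap : measurable (\bigcap_m B m) by exact: bigcapT_measurable.
have c0 : 0 <= c.
  by have := le_trans (measure_ge0 P _) (PB 0%N); rewrite divr1 lee_fin.
have cap0 : P (\bigcap_m B m) = 0%E.
  apply/eqP; rewrite eq_le measure_ge0 andbT; apply/lee_addgt0Pr => r r0.
  rewrite add0e; pose m := Num.truncn (c / r).
  apply: (@le_trans _ _ (P (B m))).
    by apply: le_measure; rewrite ?inE// => v; exact.
  apply: le_trans (PB m) _; rewrite lee_fin ler_pdivrMr// mulrC -ler_pdivrMr//.
  exact/ltW/truncnS_gt.
have := ae_of_null mcap cap0; apply: filterS => v h.
by apply: contrapT => /forallNP h'; apply: h => m _; apply: contrapT; exact: h'.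
Qed.

(** Unit increments are independent and each vanishes with probability [expR (-1)], so almost surely
    they do not all vanish from [K] on. *)
Lemma ae_counting_part : {ae P, forall v, forall x, forall K, exists k,
  (0 < N x (K + k).+1%:R v - N x (K + k)%:R v)%N}.
Proof.
apply: ae_foralln => x; apply: ae_foralln => K.
pose A k := [set v | (N x k.+1%:R v - N x k%:R v)%N = 0%N].
have mA k : measurable (A k) := measurable_incr N x k%:R k.+1%:R (fun i => i = 0%N).
have [_ _ _ inc _] := hN x.
have ind := inc (fun k => k%:R) (lexx 0) (fun i => _).
have PA k : (P (A k) <= (expR (-1))%:E)%E.
  have E : k.+1%:R - k%:R = 1 :> R by rewrite -natr1 addrAC subrr add0r.
  by rewrite /A (prob_incr0 hD) ?ltr_nat// E.
have A0 : P (\bigcap_k A (K + k)%N) = 0%E.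
  apply: (mutually_indep_null (e := fun k => (K + k)%N) (A := A) (c := expR (-1)) (ind _)).
  - by move=> i; rewrite ler_nat.
  - exact: addnI.
  - by rewrite expR_lt1 oppr_lt0.
  - move=> k; apply: (@sigma_generated_preimage _ _ _ _ _ _
      (fun _ v => (N x (K + k).+1%:R v - N x (K + k)%:R v)%N) tt [set 0%N]) => //.
  - by move=> k; exact: mA.
  - by move=> k; exact: PA.
have mcap : measurable (\bigcap_k A (K + k)%N) by apply: bigcapT_measurable => k.
have := ae_of_null mcap A0; apply: filterS => v h.
apply: contrapT => /forallNP h'; apply: h => k _ /=.
by apply/eqP; rewrite -leqn0 leqNgt; apply/negP; exact: h'.
Qed.

Lemma ae_counting : {ae P, forall v, counting (fun x t => N x t v)}.
Proof.
apply: filterS ae_counting_part => v h; split.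
- by move=> x; have [z _ _ _ _] := hN x; exact: z.
- by move=> x s t s0 st; have [_ mono _ _ _] := hN x; apply: mono; rewrite s0.
- by move=> x t t0; have [_ _ rc _ _] := hN x; exact: rc.
- move=> x j; suff [K hK] : exists K : nat, (j <= N x K%:R v)%N by exists K%:R.
  elim: j => [|j [K hK]]; first by exists 0%N.
  have [k hk] := h x K; exists (K + k).+1; rewrite -subn_gt0 in hk *.
  have [_ mono _ _ _] := hN x.
  have le1 : (N x K%:R v <= N x (K + k)%:R v)%N.
    by apply: mono; rewrite ler0n ler_nat leq_addr.
  move: hk; rewrite !subn_gt0 => hk; exact: leq_ltn_trans hK (leq_ltn_trans le1 hk).
Qed.

(** Infinitely many independent Poisson processes have equal probability [expR (- (t - s)) < 1] of
    no event between [s] and [t]. Events are therefore dense in time, which makes the clock strictly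
    increasing although it has no drift. *)
Lemma ae_dense : {ae P, forall v, forall k l, qdense R k < qdense R l ->
  exists x, (N x (qdense R k) v < N x (qdense R l) v)%N}.
Proof.
apply: ae_foralln => k; apply: ae_foralln => l.
set s := qdense R k; set t := qdense R l.
have [st|ts] := ltP s t; last by apply: aeW => v.
have s0 : 0 <= s := qdense_ge0 R k; have t0 : 0 <= t := qdense_ge0 R l.
pose A (i : nat + option (nat * nat)) : set Omega := if i is inl x then [set v | (N x t v - N x s v)%N = 0%N] else setT.
have mA x : measurable (A (inl x)) := measurable_incr N x s t (fun i => i = 0%N).
have A0 : P (\bigcap_x A (inl x)) = 0%E.
  apply: (mutually_indep_null (e := @inl nat (option (nat * nat))) (A := A) (c := expR (- (t - s))) hI) => //.
  - by move=> x y [].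
  - by rewrite expR_lt1 oppr_lt0 subr_gt0.
  - move=> x; have := (@driving_incr _ _ _ _ N T0 T x s t (fun i => i = 0%N) s0 t0); exact.
  - by move=> x; rewrite /A (prob_incr0 hD).
have := ae_of_null (bigcapT_measurable mA) A0; apply: filterS => v h _.
apply: contrapT => /forallNP h'; apply: h => x _ /=.
by apply/eqP; rewrite subn_eq0 leqNgt; apply/negP; exact: h'.
Qed.

Lemma ae_holding_pos : {ae P, forall v, forall x i, 0 < T x i v}.
Proof.
apply: ae_foralln => x; apply: ae_foralln => i.
have E : [set v | 0 < T x i v] = T x i @^-1` `]0, +oo[%classic.
  by apply/seteqP; split => v /=; rewrite in_itv/= andbT.
have mT : measurable [set v | 0 < T x i v].
  by rewrite E -[X in measurable X]setTI; exact: measurable_funP.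
have := ae_of_null (measurableC mT).
rewrite probability_setC// (holding_tail hD)// oppr0 expR0 subee// => /(_ erefl).
by apply: filterS => v /= /contrapT.
Qed.

(** Through a single state this already makes the clock unbounded. *)
Lemma ae_holding_large x : {ae P, forall v, forall K, exists k, 1 < T x (K + k)%N v}.
Proof.
apply: ae_foralln => K.
pose B : set R := `]-oo, 1]%classic.
have mB : measurable B by exact: measurable_itv.
pose A (i : nat + option (nat * nat)) : set Omega := if i is inr (Some (x, k)) then T x k @^-1` B else setT.
have mA k : measurable (T x k @^-1` B).
  by rewrite -[X in measurable X]setTI; exact: measurable_funP.
have A0 : P (\bigcap_k A (inr (Some (x, (K + k)%N)))) = 0%E.
  apply: (mutually_indep_null (e := fun k => inr (Some (x, (K + k)%N))) (A := A) (c := 1 - expR (-1)) hI).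
  - by move=> k l [/addnI].
  - by rewrite ltrBlDr ltrDl expR_gt0.
  - by move=> k; exact: driving_holding.
  - by move=> k; exact: mA.
  - move=> k; rewrite /A.
    have -> : T x (K + k)%N @^-1` B = ~` [set v | 1 < T x (K + k)%N v].
      by apply/seteqP; split => v; rewrite /B /= in_itv/= leNgt => /negP.
    rewrite probability_setC ?(holding_tail hD) ?EFinB//.
    rewrite (_ : [set v | _] = ~` (T x (K + k)%N @^-1` B)); first exact: measurableC.
    by apply/seteqP; split => v; rewrite /B /= in_itv/= leNgt; [move=> ->|move=> /negP; rewrite negbK].
have mcap : measurable (\bigcap_k A (inr (Some (x, (K + k)%N)))).
  by apply: bigcapT_measurable => k; exact: mA.
have := ae_of_null mcap A0; apply: filterS => v h.
apply: contrapT => /forallNP h'; apply: h => k _.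
rewrite /A /B /= in_itv/= leNgt; apply/negP; exact: h'.
Qed.

End AlmostSure.

Lemma geometric_series_le (R : realType) (c : R) : 0 <= c ->
  (\sum_(0 <= k <oo) (c / 2 ^+ k.+1)%:E <= c%:E)%E.
Proof.
move=> c0; apply: le_trans (epsilon_trick0 xpredT c0).
by apply: lee_nneseries => k _ /=; rewrite ?lee_fin ?natrX// divr_ge0// exprn_ge0.
Qed.

(** * Simultaneous events and finiteness of the clock *)

Section Simple.
Context (R : realType) d (Omega : measurableType d) (P : probability Omega R).
Variables (N : nat -> R -> {RV P >-> nat}) (T0 : {RV P >-> R}).
Variable (T : nat -> nat -> {RV P >-> R}).
Hypothesis hD : driving_variables N T0 T.

Let hN x : poisson_process 1 (N x). Proof. by case: hD. Qed.
Let hI : mutually_indep P (driving_sigma N T0 T). Proof. by case: hD. Qed.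

(** On [[0, L + 1]] cut into [m + 1] equal cells, the probability of a bad cell is at most
    [(L + 1) ^+ 2 / (m + 1)]. Almost surely some [m] has no bad cell, and the cell of that grid
    around [r] is returned. *)
Lemma ae_grid (Q : R -> R -> set Omega) :
  (forall s t : R, measurable (Q s t)) ->
  (forall s t : R, 0 <= s -> s < t -> (P (Q s t) <= ((t - s) ^+ 2)%:E)%E) ->
  {ae P, forall v, forall r, 0 < r ->
    exists s t, [/\ 0 <= s, s < r, r <= t & ~ Q s t v]}.
Proof.
move=> mQ PQ.
suff : {ae P, forall v, forall L : nat, exists m, forall k, (k < m.+1)%N ->
    ~ Q (k%:R * (L.+1%:R / m.+1%:R)) (k.+1%:R * (L.+1%:R / m.+1%:R)) v}.
  apply: filterS => v h r r0.
  have [m hm] := h (Num.truncn r).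
  set z := _ / _ in hm; have z0 : 0 < z by rewrite divr_gt0.
  have ex : exists k, r <= k.+1%:R * z.
    exists m; rewrite mulrCA divff ?pnatr_eq0// mulr1.
    exact/ltW/truncnS_gt.
  case: (ex_minnP ex) => k rk kmin.
  have km : (k <= m)%N.
    by apply: kmin; rewrite mulrCA divff ?pnatr_eq0// mulr1; exact/ltW/truncnS_gt.
  exists (k%:R * z), (k.+1%:R * z); split => //.
  - by rewrite mulr_ge0// ltW.
  - case: k kmin {rk km} => [|k] kmin; first by rewrite mul0r.
    by rewrite ltNge; apply/negP => /kmin; rewrite ltnn.
  - exact: hm.
apply: ae_foralln => L.
pose z m : R := L.+1%:R / m.+1%:R.
have z0 m : 0 < z m by rewrite divr_gt0.
pose C m k := Q (k%:R * z m) (k.+1%:R * z m).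
pose B m := \bigcup_(k < m.+1) C m k.
have mB m : measurable (B m) by apply: bigcup_measurable => k _; exact: mQ.
have PB m : (P (B m) <= (L.+1%:R ^+ 2 / m.+1%:R)%:E)%E.
  have : (P (B m) <= \sum_(k < m.+1) P (C m k))%E.
    by rewrite /B bigcup_mkord; apply: Boole_inequality => k _; exact: mQ.
  move/le_trans; apply.
  apply: (@le_trans _ _ (\sum_(k < m.+1) (z m ^+ 2)%:E)%E).
    apply: lee_sum => k _; apply: le_trans (PQ _ _ _ _) _.
    - by rewrite mulr_ge0// ltW.
    - by rewrite ltr_pM2r// ltr_nat.
    - by rewrite -mulrBl -natr1 addrAC subrr add0r mul1r.
  rewrite sumEFin lee_fin sumr_const card_ord -[leLHS]mulr_natr /z.
  rewrite le_eqVlt; apply/orP; left; apply/eqP.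
  have : m.+1%:R != 0 :> R by rewrite pnatr_eq0.
  by move: (m.+1%:R : R) (L.+1%:R : R) => M K M0; field.
have := bigcap_null mB PB; apply: filterS => v [m h]; exists m => k km hQ.
by apply: h; exists k.
Qed.

Lemma ae_simple : {ae P, forall v, forall x y i j,
  evt (fun x t => N x t v) x i.+1 = evt (fun x t => N x t v) y j.+1 -> x = y /\ i = j}.
Proof.
(* A cell is bad if it could hide a coincidence: two events of one state, or an event of each of two
   states. *)
pose Q x y s t : set Omega := if x == y then [set v | (1 < N x t v - N x s v)%N]
  else [set v | (0 < N x t v - N x s v)%N] `&` [set v | (0 < N y t v - N y s v)%N].
have mQ x y s t : measurable (Q x y s t).
  rewrite /Q; case: ifP => _; first exact: (measurable_incr N x s t (fun k => (1 < k)%N)).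
  by apply: measurableI; exact: (measurable_incr N _ s t (fun k => (0 < k)%N)).
have PQ x y s t : 0 <= s -> s < t -> (P (Q x y s t) <= ((t - s) ^+ 2)%:E)%E.
  move=> s0 st; rewrite /Q; case: ifPn => xy; first exact: (prob_incr_ge2 hD).
  have t0 : 0 <= t by apply: le_trans s0 (ltW st).
  rewrite (mutually_indep_pair (i := inl x) (j := inl y) hI).
  - by rewrite expr2 EFinM; apply: lee_pmul => //; exact: (prob_incr_ge1 hD).
  - by apply: contra xy => /eqP[->].
  - exact: (@driving_incr _ _ _ _ N T0 T x s t (fun k => (0 < k)%N) s0 t0).
  - exact: (@driving_incr _ _ _ _ N T0 T y s t (fun k => (0 < k)%N) s0 t0).
have key : {ae P, forall v, forall x y r, 0 < r ->
    exists s t, [/\ 0 <= s, s < r, r <= t & ~ Q x y s t v]}.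
  by apply: ae_foralln => x; apply: ae_foralln => y; exact: (ae_grid (mQ x y) (PQ x y)).
apply: filterS2 key (ae_counting hD) => v h hc.
have gap x s t i r : 0 <= s -> s < r -> r <= t -> r = evt (fun x t => N x t v) x i.+1 ->
    (N x s v <= i)%N /\ (i < N x t v)%N.
  move=> s0 sr rt E; have t0 : 0 <= t by apply: le_trans s0 (le_trans (ltW sr) rt).
  split; first by rewrite -ltnS -(lt_evt hc)// -E.
  by rewrite -(evt_le hc)// -E.
have same x i j : (i < j)%N ->
    evt (fun x t => N x t v) x i.+1 <> evt (fun x t => N x t v) x j.+1.
  move=> ij E; have [s [t [s0 sr rt]]] := h x x _ (evt_gt0 hc x i).
  rewrite /Q eqxx /=; apply; rewrite ltn_subRL addn1.
  have [si _] := gap _ _ _ _ _ s0 sr rt erefl.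
  have [_ jt] := gap _ _ _ _ _ s0 sr rt E.
  exact: leq_ltn_trans (leq_ltn_trans si ij) jt.
move=> x y i j E; have [xy|xy] := eqVneq x y.
  split => //; subst y; have [ij|ij|//] := ltngtP i j; exfalso.
    exact: same ij E.
  exact: same ij (esym E).
exfalso; have [s [t [s0 sr rt]]] := h x y _ (evt_gt0 hc x i).
rewrite /Q (negbTE xy); apply; rewrite /= !subn_gt0.
have [si it] := gap _ _ _ _ _ s0 sr rt erefl.
have [sj jt] := gap _ _ _ _ _ s0 sr rt E.
by split; [exact: leq_ltn_trans si it|exact: leq_ltn_trans sj jt].
Qed.

(** Almost surely the exponential variable itself. The truncation makes the clock nonnegative at
    every sample point, which the measurability lemmas ask for. *)
Definition holding x i (v : Omega) : R := Num.max 0 (T x i v).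

Lemma holding_ge0 x i v : 0 <= holding x i v.
Proof. by rewrite /holding le_max lexx. Qed.

Lemma measurable_holding x i : measurable_fun setT (holding x i).
Proof. by apply: measurable_maxr => //; exact: measurable_cst. Qed.

Local Notation wk v := (work (fun x t => N x t v) (fun x i => holding x i v)).

(** The layer-cake bound: a real number is at most the number of naturals below it. *)
Lemma ler_unit_sum (y : R) : (y%:E <= \sum_(0 <= k <oo) ((k%:R < y)%R%:R)%:E)%E.
Proof.
have t0 (k : nat) : (0 <= ((k%:R < y)%R%:R)%:E :> \bar R)%E by rewrite lee_fin.
suff [n yn nk] : exists2 n : nat, y <= n%:R & forall k, (k < n)%N -> k%:R < y.
  apply: (@le_trans _ _ (\sum_(0 <= k < n) ((k%:R < y)%R%:R)%:E)%E); last first.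
    exact: nneseries_lim_ge.
  rewrite (eq_big_nat _ _ (F2 := fun=> 1%:E)); last by move=> k /andP[_ kn]; rewrite nk.
  by rewrite sumEFin lee_fin big_const_nat subn0 iter_addr_0.
have ex : exists n : nat, y <= n%:R by exists (Num.truncn y).+1; exact/ltW/truncnS_gt.
case: (ex_minnP ex) => n yn nmin; exists n => // k kn.
by rewrite ltNge; apply/negP => /nmin; rewrite leqNgt kn.
Qed.

Lemma prob_count_gt x i m : (0 < m)%N ->
  (P [set v | (i < N x m%:R v)%N] <= (2 * expR m%:R / 2 ^+ i.+1)%:E)%E.
Proof.
move=> m0; pose A l := [set v | N x m%:R v = (i + l).+1].
have mA l : measurable (A l) by exact: measurable_count.
have pA l : (P (A l) <= (expR m%:R / 2 ^+ i / 2 ^+ l.+1)%:E)%E.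
  have [N0 _ _ _ pmf] := hN x.
  have -> : A l = [set v | (N x m%:R v - N x 0 v)%N = (i + l).+1].
    by apply/seteqP; split => v; rewrite /A /= N0 subn0.
  rewrite pmf; last by rewrite lexx/= ltr0n.
  rewrite mul1r subr0 lee_fin; apply: le_trans (poisson_pmf_le _ _) _; first by rewrite ltr0n.
  by rewrite -mulrA -invfM -exprD addnS.
have m_gt : measurable [set v | (i < N x m%:R v)%N].
  rewrite (_ : [set v | _] = \bigcup_l A l); first exact: bigcupT_measurable.
  apply/seteqP; split => v /=; last by move=> [l _ ->]; rewrite ltnS leq_addr.
  by move=> h; exists (N x m%:R v - i.+1)%N => //=; rewrite /A /= -addSn subnKC.
apply: (@le_trans _ _ (\sum_(0 <= l <oo) P (A l))%E).
  apply: measure_sigma_subadditive => // v /= h.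
  by exists (N x m%:R v - i.+1)%N => //=; rewrite /A /= -addSn subnKC.
apply: (@le_trans _ _ (\sum_(0 <= l <oo) (expR m%:R / 2 ^+ i / 2 ^+ l.+1)%:E)%E).
  by apply: lee_nneseries => l // _; exact: pA.
have c0 : 0 <= expR m%:R / 2 ^+ i :> R by rewrite divr_ge0 ?expR_ge0// exprn_ge0.
apply: le_trans (geometric_series_le c0) _.
by rewrite lee_fin exprS le_eqVlt; apply/orP; left; apply/eqP; field; rewrite expf_neq0.
Qed.

(** The bound is [2 ^- k], written in the form summed by [geometric_series_le]. *)
Lemma prob_holding_gt x i (k : nat) :
  (P [set v | (k%:R < T x i v)%R] <= (2 / 2 ^+ k.+1)%:E)%E.
Proof.
rewrite (holding_tail hD)// lee_fin exprS invfM mulrA divff// mul1r.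
elim: k => [|k IH]; first by rewrite oppr0 expR0 expr0 invr1.
rewrite -natr1 opprD expRD exprS invfM mulrC ler_pM ?expR_ge0// expRN lef_pV2 ?posrE ?expR_gt0//.
by apply: le_trans (expR_ge1Dx 1).
Qed.

(** The work is at most the double sum over [i] and [k] of the indicators that there are more than
    [i] events and that holding time [i] exceeds [k]. Independence and two geometric series bound
    its mean. The constant is crude, but it does not depend on [x], so summable weights give the
    clock a finite mean. *)
Lemma mean_work x m : (0 < m)%N ->
  (\int[P]_v (wk v x m%:R)%:E <= (4 * expR m%:R)%:E)%E.
Proof.
move=> m0; pose A i := [set v | (i < N x m%:R v)%N].
pose B i k := [set v | (k%:R < T x i v)].
have mA i : measurable (A i).
  have := measurable_incr N x 0 m%:R (fun k => (i < k)%N); have [N0 _ _ _ _] := hN x.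
  by rewrite (_ : [set v | _] = A i)//; apply/seteqP; split => v; rewrite /A /= N0 subn0.
have mB i k : measurable (B i k).
  rewrite (_ : B i k = T x i @^-1` `]k%:R, +oo[%classic); last first.
    by apply/seteqP; split => v; rewrite /B /= in_itv/= andbT.
  by rewrite -[X in measurable X]setTI; exact: measurable_funP.
have mAB i k : measurable (A i `&` B i k) by exact: measurableI.
pose f i k v : \bar R := (\1_(A i `&` B i k) v)%:E.
have f0 i k v : (0 <= f i k v)%E by rewrite lee_fin.
have mf i k : measurable_fun setT (f i k).
  by apply/measurable_EFinP; exact: (measurable_indic (mAB i k)).
have mF i : measurable_fun setT (fun v => \sum_(0 <= k <oo) f i k v)%E.
  by apply: ge0_emeasurable_sum.
have F0 i v : (0 <= \sum_(0 <= k <oo) f i k v)%E by apply: nneseries_ge0.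
apply: (@le_trans _ _ (\int[P]_v (\sum_(0 <= i <oo) \sum_(0 <= k <oo) f i k v))%E).
  apply: ge0_le_integral => //.
  - by move=> v _; rewrite lee_fin; apply: work_ge0 => ? ?; exact: holding_ge0.
  - apply/measurable_EFinP; apply: measurable_work; first exact: measurable_holding.
    by move=> k; exact: measurable_count.
  - by apply: ge0_emeasurable_sum.
  move=> v _; apply: (@le_trans _ _ (\sum_(0 <= i < N x m%:R v) \sum_(0 <= k <oo) f i k v)%E); last first.
    by apply: nneseries_lim_ge => i _ _; exact: F0.
  rewrite big_mkord /work -sumEFin; apply: lee_sum => i _; rewrite /holding.
  have [h|h] := leP 0 (T x i v); last exact: F0.
  apply: le_trans (ler_unit_sum _) _; apply: lee_nneseries => k _; first by rewrite lee_fin.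
  rewrite /f indicE lee_fin; case: ltP => // h'.
  by have AB : (A i `&` B i k) v by [split => //; exact: ltn_ord]; rewrite (mem_set AB).
rewrite integral_nneseries//.
apply: (@le_trans _ _ (\sum_(0 <= i <oo) (4 * expR m%:R / 2 ^+ i.+1)%:E)%E); last first.
  by apply: geometric_series_le; rewrite mulr_ge0 ?expR_ge0.
apply: lee_nneseries => i _; first by move=> _; apply: integral_ge0 => v _; exact: F0.
rewrite integral_nneseries//.
apply: (@le_trans _ _ (\sum_(0 <= k <oo) (4 * expR m%:R / 2 ^+ i.+1 / 2 ^+ k.+1)%:E)%E); last first.
  by apply: geometric_series_le; rewrite divr_ge0// ?mulr_ge0 ?expR_ge0// exprn_ge0.
apply: lee_nneseries => k _; first by move=> _; apply: integral_ge0 => v _; exact: f0.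
rewrite /f integral_indic// setIT.
have hP : P (A i `&` B i k) = (P (A i) * P (B i k))%E.
  apply: (mutually_indep_pair (i := inl x) (j := inr (Some (x, i))) hI) => //.
  - exact: (@driving_count _ _ _ _ N T0 T x m%:R [set j | (i < j)%N]).
  - rewrite (_ : B i k = T x i @^-1` `]k%:R, +oo[%classic); first exact: driving_holding.
    by apply/seteqP; split => v; rewrite /B /= in_itv/= andbT.
apply: (@le_trans _ _ (P (A i) * P (B i k))%E); first by rewrite -hP.
have := lee_pmul (measure_ge0 P _) (measure_ge0 P _) (prob_count_gt x i m0) (prob_holding_gt x i k).
move=> /le_trans; apply; rewrite -EFinM lee_fin le_eqVlt; apply/orP; left; apply/eqP.
by move: (expR _) (_ ^+ i.+1) (_ ^+ k.+1) => x1 x2 x3; ring.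
Qed.

Variable g : nat -> R.
Hypotheses (g0 : forall x, 0 < g x) (gs : (\sum_(0 <= x <oo) (g x)%:E < +oo)%E).
Local Notation ck v := (clk g (fun x t => N x t v) (fun x i => holding x i v)).

Lemma measurable_clk_holding t : measurable_fun setT (fun v => ck v t).
Proof.
apply: measurable_clk => //.
- by move=> x; exact/ltW.
- by move=> x i v; exact: holding_ge0.
- exact: measurable_holding.
- by move=> x k; exact: measurable_count.
Qed.

Lemma ae_clk_fin : {ae P, forall v, forall t, 0 <= t -> (ck v t < +oo)%E}.
Proof.
suff : {ae P, forall v, forall m, (ck v m.+1%:R < +oo)%E}.
  apply: filterS2 (ae_counting hD) => v hc h t t0.
  apply: le_lt_trans (h (Num.truncn t)); apply: clk_le => //.
  - by move=> x; exact/ltW.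
  - by move=> x i; exact: holding_ge0.
  - exact/ltW/truncnS_gt.
apply: ae_foralln => m.
have ck0 v : (0 <= ck v m.+1%:R)%E.
  by apply: clk_ge0 => [x|x i]; [exact/ltW|exact: holding_ge0].
have ig : P.-integrable setT (fun v => ck v m.+1%:R).
  apply/integrableP; split; first exact: measurable_clk_holding.
  rewrite (eq_integral (fun v => ck v m.+1%:R)); last by move=> v _; rewrite gee0_abs.
  have w0 x v : (0 <= (wk v x m.+1%:R)%:E)%E.
    by rewrite lee_fin; apply: work_ge0 => ? ?; exact: holding_ge0.
  have mw x : measurable_fun setT (fun v => (wk v x m.+1%:R)%:E).
    apply/measurable_EFinP; apply: measurable_work; first exact: measurable_holding.
    by move=> k; exact: measurable_count.
  rewrite /clk integral_nneseries//; last 2 first.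
  - by move=> x; under eq_fun do rewrite EFinM; apply: emeasurable_funM => //; exact: measurable_cst.
  - by move=> x v _; rewrite EFinM mule_ge0// lee_fin ltW.
  apply: (@le_lt_trans _ _ (\sum_(0 <= x <oo) ((4 * expR m.+1%:R)%:E * (g x)%:E))%E).
    apply: lee_nneseries => x _.
      by move=> _; apply: integral_ge0 => v _; rewrite EFinM mule_ge0// lee_fin ltW.
    under eq_integral do rewrite EFinM.
    rewrite ge0_integralZl//; last by rewrite lee_fin ltW.
    rewrite muleC lee_pmul2r ?lte_fin//; exact: mean_work.
  rewrite nneseriesZl//; last by move=> x _; rewrite lee_fin ltW.
  by apply: lte_mul_pinfty; rewrite ?lee_fin ?mulr_ge0 ?expR_ge0.
have := integrable_ae measurableT ig.
by apply: filterS => v /(_ I); rewrite ge0_fin_numE.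
Qed.

End Simple.

Section Regular.
Context (R : realType) d (Omega : measurableType d) (P : probability Omega R).
Variables (N : nat -> R -> {RV P >-> nat}) (T0 : {RV P >-> R}).
Variable (T : nat -> nat -> {RV P >-> R}).
Hypothesis hD : driving_variables N T0 T.
Variable g : nat -> R.
Hypotheses (g0 : forall x, 0 < g x) (gs : (\sum_(0 <= x <oo) (g x)%:E < +oo)%E).
Local Notation nN v := (fun x t => N x t v).
Local Notation hT v := (fun x i => holding T x i v).

Let gge0 x : 0 <= g x. Proof. exact: ltW. Qed.

Lemma ae_clk_unbounded : {ae P, forall v,
  forall M : R, exists2 t, 0 <= t & (M%:E <= clk g (nN v) (hT v) t)%E}.
Proof.
apply: filterS2 (ae_counting hD) (ae_holding_large hD 0) => v hc h M.
have grow (K : nat) : exists n, K%:R <= \sum_(i < n) holding T 0 i v.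
  elim: K => [|K [n hn]]; first by exists 0%N; rewrite big_ord0.
  have [k hk] := h n; exists (n + k).+1.
  rewrite big_ord_recr/= -natr1 lerD//; last by rewrite /holding le_max (ltW hk) orbT.
  apply: le_trans hn _; rewrite -!(big_mkord xpredT (fun i => holding T 0 i v)).
  rewrite (@big_cat_nat _ _ _ n 0 (n + k))//= ?leq_addr// lerDl sumr_ge0// => i _.
  exact: holding_ge0.
have [n hn] := grow (Num.truncn (M / g 0%N)).+1.
have [t t0 nt] := cnt_ub hc 0 n; exists t => //.
apply: (@le_trans _ _ (g 0%N * work (nN v) (hT v) 0 t)%:E).
  rewrite lee_fin -ler_pdivrMl// mulrC; apply: le_trans (le_trans hn _).
    exact/ltW/truncnS_gt.
  rewrite /work -!(big_mkord xpredT (fun i => holding T 0 i v)).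
  rewrite (@big_cat_nat _ _ _ n 0 (N 0%N t v))//= lerDl sumr_ge0// => i _.
  exact: holding_ge0.
pose f x : \bar R := (g x * work (nN v) (hT v) x t)%:E.
apply: (@le_trans _ _ (\sum_(0 <= x < 1) f x)%E); first by rewrite big_nat1.
by apply: nneseries_lim_ge => x _ _; apply: gwork_ge0 => // y i; exact: holding_ge0.
Qed.

Lemma ae_regular : {ae P, forall v, regular g (nN v) (hT v)}.
Proof.
apply: filterS2 (ae_counting hD) (filterI (ae_clk_fin hD g0 gs)
  (filterI ae_clk_unbounded (ae_simple hD))) => v hc [hf [hu hs]].
by split => // x i; exact: holding_ge0.
Qed.

Lemma ae_service_gt0 : {ae P, forall v, forall x j, 0 < g x * holding T x j v}.
Proof.
apply: filterS (ae_holding_pos hD) => v h x j.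
by rewrite mulr_gt0// /holding lt_max h orbT.
Qed.

Lemma ae_clk_strict : {ae P, forall v, clk_strict g (nN v) (hT v)}.
Proof.
apply: filterS2 ae_regular (filterI ae_service_gt0 (ae_dense hD)) => v hr [hp hd] s t s0 st.
have hc := reg_cnt hr; have tau0 := reg_tau hr.
have [k /andP[sk kt]] := qdenseP s0 st.
have [l /andP[kl lt]] := qdenseP (qdense_ge0 R k) kt.
have [x hx] := hd k l kl.
have fin : clk g (nN v) (hT v) (qdense R k) \is a fin_num.
  by rewrite ge0_fin_numE ?clk_ge0// (reg_fin hr)// qdense_ge0.
apply: le_lt_trans (clk_le gge0 tau0 hc s0 (ltW sk)) _.
apply: lt_le_trans (clk_le gge0 tau0 hc (qdense_ge0 R l) (ltW lt)).
have := clk_jump gge0 tau0 hc (qdense_ge0 R k) (ltW kl) (i := N x (qdense R k) v) (x := x).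
rewrite leqnn hx => /(_ isT) /(lt_le_trans _); apply.
by rewrite lteDl// lte_fin.
Qed.

End Regular.

(** * A fixed time is almost surely visited *)

Section IndependentSection.
Context d (Omega : measurableType d) (R : realType) (P : probability Omega R).
Variable (C : set (set Omega)).
Hypothesis Cm : C `<=` measurable.
Local Notation OC := (g_sigma_algebraType C).

Let CM : <<s C >> `<=` measurable.
Proof. by apply: smallest_sub => //; exact: sigma_algebra_measurable. Qed.

(** The identity, read as a map into the same set with the smaller sigma-algebra generated by
    [C]. *)
Definition coarsen (v : Omega) : OC := v.

Let mcoarsen : measurable_fun setT coarsen.
Proof. by move=> _ B mB; rewrite setTI; exact: CM mB. Qed.

HB.instance Definition _ := isMeasurableFun.Build _ _ _ _ coarsen mcoarsen.

Variable X : {RV P >-> R}.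
Hypothesis indep : forall D B, <<s C >> D -> measurable B ->
  P (D `&` X @^-1` B) = (P D * P (X @^-1` B))%E.

(** By independence the pair of the coarsened sample point and [X] has a product law, so a set with
    almost surely null sections has probability 0. *)
Lemma indep_section_null (S : set (OC * R)) : measurable S ->
  {ae P, forall v, distribution P X (xsection S (v : OC)) = 0%E} ->
  {ae P, forall v, ~ S (v : OC, X v)}.
Proof.
move=> mS S0.
have mpair : measurable_fun setT (fun v => (coarsen v, X v)).
  by apply: measurable_fun_pair => //; exact: measurable_funP.
pose pr := distribution P (HB.pack_for {mfun Omega >-> (OC * R)%type}
   (fun v => (coarsen v, X v)) (isMeasurableFun.Build _ _ _ _ _ mpair)).
have h := @product_measure_unique _ _ OC R R (distribution P coarsen) (distribution P X) pr.
have null : (distribution P coarsen \x distribution P X)%E S = 0%E.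
  have mx : measurable_fun [set: OC] (fun y : OC => distribution P X (xsection S y)).
    exact: measurable_fun_xsection.
  rewrite /product_measure1 /= (ge0_integral_pushforward mcoarsen)//=.
  rewrite preimage_setT (ae_eq_integral (cst 0%E)) ?integral_cst ?mul0e//.
    apply: (measurableT_comp mx mcoarsen).
  by case: S0 => A [mA A0 sub]; exists A; split => // v /= hv; apply: sub => hv0; apply: hv => _.
have mpre : measurable ((fun v => (coarsen v, X v)) @^-1` S).
  by have := mpair measurableT S mS; rewrite setTI.
apply: (@ae_of_null _ _ _ P ((fun v => (coarsen v, X v)) @^-1` S)) => //.
rewrite -null h//.
Qed.

End IndependentSection.

Section AffineNull.
Context (R : realType).
Local Notation mu := (@lebesgue_measure R).

Lemma lebesgue_measure_affine (t c : R) (A : set (measurableTypeR R)) : 0 < c ->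
  measurable A -> (c%:E * mu [set r | A (t - c * r)%R])%E = mu A.
Proof.
move=> c0 mA; pose f (r : measurableTypeR R) : measurableTypeR R := t - c * r.
have mf : measurable_fun setT f.
  by apply: measurable_funB; [exact: measurable_cst|apply: measurable_funM => //; exact: measurable_cst].
pose m : {measure set (measurableTypeR R) -> \bar R} :=
  mscale (NngNum (ltW c0)) (pushforward mu f).
apply: esym; apply: (@lebesgue_measure_unique R (m mf)) => //.
move=> _ [[a b] _ <-]/=; rewrite /mscale/= /pushforward.
have -> : f @^-1` `]a, b]%classic = `[(t - b) / c, (t - a) / c[%classic.
  apply/seteqP; split => r /=; rewrite !in_itv/= /f ler_pdivrMr// ltr_pdivlMr// mulrC => /andP[h1 h2].
    by apply/andP; split; lra.
  by apply/andP; split; lra.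
rewrite !lebesgue_measure_itv/= !lte_fin ltr_pM2r ?invr_gt0//.
rewrite (_ : (t - b < t - a) = (a < b)); last by rewrite ltrD2l ltrN2.
case: ifP => // _; last by rewrite mule0.
by rewrite -!EFinB -EFinM; congr EFin; field; rewrite gt_eqF.
Qed.

End AffineNull.

Lemma exponential_prob_null (R : realType) (A : set R) :
  measurable (A : set (measurableTypeR R)) ->
  lebesgue_measure ((A : set (measurableTypeR R)) `&` `[0, +oo[%classic) = 0%E ->
  exponential_prob 1 A = 0%E.
Proof.
move=> mA A0; rewrite /exponential_prob.
have mp : measurable_fun setT (EFin \o exponential_pdf (1 : R)).
  by apply/measurable_EFinP; exact: measurable_exponential_pdf.
have mI : measurable (`[0, +oo[%classic : set (measurableTypeR R)) by exact: measurable_itv.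
pose B : set (measurableTypeR R) := (A : set (measurableTypeR R)) `&` `[0, +oo[%classic.
transitivity (\int[lebesgue_measure]_(x in B) (exponential_pdf 1 x)%:E)%E.
  rewrite [RHS]integral_mkcond [LHS]integral_mkcond; apply: eq_integral => x _.
  rewrite /patch /B in_setI; case: (x \in A) => //=.
  have [h|h] := leP 0 x; first by rewrite mem_set//= in_itv/= h.
  by rewrite lt0_exponential_pdf//; case: ifP.
apply: null_set_integral => //; [exact: measurableI|exact: measurable_funTS].
Qed.

Section Covered.
Context (R : realType) d (Omega : measurableType d) (P : probability Omega R).
Variables (N : nat -> R -> {RV P >-> nat}) (T0 : {RV P >-> R}).
Variable (T : nat -> nat -> {RV P >-> R}).
Hypothesis hD : driving_variables N T0 T.
Variable g : nat -> R.
Hypotheses (g0 : forall x, 0 < g x) (gs : (\sum_(0 <= x <oo) (g x)%:E < +oo)%E).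
Local Notation nN v := (fun x t => N x t v).
Local Notation hT v := (fun x i => holding T x i v).
Local Notation mu := (@lebesgue_measure R).

Let gge0 x : 0 <= g x. Proof. exact: ltW. Qed.
Let hI : mutually_indep P (driving_sigma N T0 T). Proof. by case: hD. Qed.

Section fixed.
Variables (t : R) (x : nat).
Hypothesis t0 : 0 < t.

Let i0 : nat + option (nat * nat) := inr (Some (x, 0%N)).
Let C := cylinders (driving_sigma N T0 T) i0 [set setT].
Let dT v := drop_first x (hT v).

Let F0F : [set setT] `<=` driving_sigma N T0 T i0.
Proof. by move=> _ ->; exact: driving_sigmaT. Qed.

Let Cm : C `<=` measurable.
Proof. by apply: cylinders_measurable F0F; exact: driving_sigma_measurable. Qed.

Let Csub i A : i != i0 -> driving_sigma N T0 T i A -> <<s C >> A.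
Proof.
move=> ii FA; apply: sub_sigma_algebra; apply: cylinders_other ii _ FA => //.
Qed.

(** The sample point and the value of the first holding time of [x] are decoupled: the visits are
    those of the modified clock, which is measurable with respect to the remaining components. *)
Let S : set (g_sigma_algebraType C * R) := [set p |
  0 <= t - g x * Num.max 0 p.2 /\
  forall y j, ~ (vstart g (nN p.1) (dT p.1) y j <= t - g x * Num.max 0 p.2 <
                 vend g (nN p.1) (dT p.1) y j)].

Let tau y i (v : g_sigma_algebraType C) : R := dT v y i.

Let tau_ge0 y i v : 0 <= tau y i v.
Proof. by rewrite /tau /dT /drop_first; case: ifP => // _; exact: holding_ge0. Qed.

Let mtau y i : measurable_fun setT (tau y i).
Proof.
rewrite /tau /dT /drop_first; case: (boolP ((y == x) && (i == 0%N))) => yi; first exact: measurable_cst.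
apply: measurable_maxr; first exact: measurable_cst.
move=> _ B mB; rewrite setTI.
apply: (Csub (i := inr (Some (y, i)))); last exact: driving_holding.
by apply: contra yi => /eqP; rewrite /i0 => -[-> ->]; rewrite !eqxx.
Qed.

Let mn y s k : 0 <= s -> measurable [set v : g_sigma_algebraType C | N y s v = k].
Proof. by move=> s0; apply: (Csub (i := inl y)) => //; exact: (@driving_count _ _ _ _ N T0 T y s [set k] s0). Qed.

Let mS : measurable S.
Proof.
pose r (p : g_sigma_algebraType C * R) : R := t - g x * Num.max 0 p.2.
have mr : measurable_fun setT r.
  apply: measurable_funB; first exact: measurable_cst.
  apply: measurable_funM; first exact: measurable_cst.
  by apply: measurable_maxr; [exact: measurable_cst|exact: measurable_snd].
have mp (b : bool) (f : g_sigma_algebraType C * R -> bool) : measurable_fun setT f -> measurable [set p | f p].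
  by move=> mf; have := mf measurableT [set true] I; rewrite setTI.
rewrite (_ : S = [set p | 0 <= r p] `&` \bigcap_y \bigcap_j
    ~` [set p | (vstart g (nN p.1) (dT p.1) y j <= r p) && (r p < vend g (nN p.1) (dT p.1) y j)]).
  apply: measurableI.
    by apply: (mp true); apply: measurable_fun_ler => //; exact: measurable_cst.
  apply: bigcapT_measurable => y; apply: bigcapT_measurable => j; apply: measurableC.
  apply: (mp true); apply: measurable_and.
    apply: measurable_fun_ler => //.
    exact: (measurableT_comp (measurable_vstart gge0 tau_ge0 mtau mn y j) measurable_fst).
  apply: measurable_fun_ltr => //.
  exact: (measurableT_comp (measurable_vend gge0 tau_ge0 mtau mn y j) measurable_fst).
apply/seteqP; split => p /= [h1 h2]; split => //.
  by move=> y _ j _; exact: h2.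
by move=> y j; exact: h2.
Qed.

(** For a fixed sample point, the times unvisited by the modified process form a Lebesgue-null set.
    Its preimage under [r |-> t - g x * r] is null because [g x > 0], and the exponential law has a
    density. *)
Lemma ae_unvisited_drop_first : {ae P, forall v, ~ (0 <= t - g x * holding T x 0 v /\
   forall y j, ~~ visit g (nN v) (dT v) y j (t - g x * holding T x 0 v))}.
Proof.
have ind D B : <<s C >> D -> measurable B ->
    P (D `&` T x 0 @^-1` B) = (P D * P (T x 0 @^-1` B))%E.
  move=> hDD mB; apply: (indep_cylinders hI (@driving_sigmaT _ _ _ _ N T0 T)
    (@driving_sigmaI _ _ _ _ N T0 T) (@driving_sigma_measurable _ _ _ _ N T0 T) _ _ F0F) hDD => //.
  - by move=> _ _ -> ->; rewrite setTI.
  - by rewrite -[X in measurable X]setTI; exact: measurable_funP.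
  - by move=> _ ->; rewrite setTI probability_setT mul1e; split => //; exact: driving_holding.
have := indep_section_null Cm ind mS.
case; last first.
  move=> A [mA A0 sub]; exists A; split => // v /= h; apply: sub => /= hS; apply: h => -[h1 h2].
  apply: hS; split => // y j hv; have := h2 y j; rewrite /visit.
  by move: hv; rewrite /holding /= => ->.
apply: filterS (ae_regular hD g0 gs) => v hr.
have hr' := regular_drop_first gge0 hr x.
have mX : measurable (xsection S v) by exact: measurable_xsection.
have [_ _ hT _] := hD; rewrite (hT x 0%N _ mX).
pose U : set (measurableTypeR R) := `[0, +oo[%classic `\`
  \bigcup_y \bigcup_j [set` `[vstart g (nN v) (dT v) y j, vend g (nN v) (dT v) y j[].
have mU : measurable U.
  apply: measurableD; first exact: measurable_itv.
  by apply: bigcupT_measurable => y; apply: bigcupT_measurable => j; exact: measurable_itv.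
have U0 : mu U = 0%E := visited_full gge0 hr'.
apply: exponential_prob_null; first exact: mX.
have mV : measurable ([set r | U (t - g x * r)] : set (measurableTypeR R)).
  have mf : measurable_fun setT (fun r : measurableTypeR R => (t - g x * r : measurableTypeR R)).
    by apply: measurable_funB; [exact: measurable_cst|apply: measurable_funM => //; exact: measurable_cst].
  by have := mf measurableT U mU; rewrite setTI.
have V0 : mu [set r | U (t - g x * r)] = 0%E.
  have := lebesgue_measure_affine t (g0 x) mU; rewrite U0 => /eqP.
  by rewrite mule_eq0 => /orP[|/eqP//]; rewrite eqe gt_eqF.
apply/eqP; rewrite eq_le measure_ge0 andbT -V0.
apply: le_measure; rewrite ?inE//.
  by apply: measurableI; [exact: mX|exact: measurable_itv].
move=> r [/xsectionP[/= h1 h2]]; rewrite /= in_itv/= andbT => r0.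
rewrite (max_idPr r0) in h1 h2; split; first by rewrite /= in_itv/= h1.
by move=> [y _ [j _]]; rewrite /= in_itv/=; exact: h2.
Qed.
End fixed.

Lemma ae_covered t : 0 < t -> {ae P, forall v, exists x j, visit g (nN v) (hT v) x j t}.
Proof.
move=> t0.
have h : {ae P, forall v, forall x, ~ (0 <= t - g x * holding T x 0 v /\
   forall y j, ~~ visit g (nN v) (drop_first x (hT v)) y j (t - g x * holding T x 0 v))}.
  by apply: ae_foralln => x; exact: ae_unvisited_drop_first.
apply: filterS2 h (filterI (ae_regular hD g0 gs) (ae_clk_strict hD g0 gs)) => v h [hr hs].
apply: contrapT => hn; have [|x] := unvisited_drop_first gge0 hr hs t0; last exact: h.
by move=> x j; apply/negP => hv; apply: hn; exists x, j.
Qed.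
End Covered.

(** * Returns are unlikely *)

Section LimBounds.
Context (R : realType) d (Omega : measurableType d) (P : probability Omega R).

Lemma measurable_lim_inf (F : nat -> set Omega) : (forall m, measurable (F m)) ->
  measurable (\bigcup_M \bigcap_(m in [set m | (M <= m)%N]) F m).
Proof.
move=> mF; apply: bigcupT_measurable => M.
by apply: bigcap_measurable => [|m _]; [exists M => /=|exact: mF].
Qed.

Lemma measurable_lim_sup (F : nat -> set Omega) : (forall m, measurable (F m)) ->
  measurable (\bigcap_M \bigcup_(m in [set m | (M <= m)%N]) F m).
Proof.
by move=> mF; apply: bigcapT_measurable => M; apply: bigcup_measurable => m _; exact: mF.
Qed.

Lemma lim_inf_le_lim_sup (F A : nat -> set Omega) (c : R) : 0 <= c ->
  (forall m, measurable (F m)) -> (forall m, measurable (A m)) ->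
  (forall m, (P (F m) <= c%:E * P (A m))%E) ->
  (P (\bigcup_M \bigcap_(m in [set m | (M <= m)%N]) F m) <=
   c%:E * P (\bigcap_M \bigcup_(m in [set m | (M <= m)%N]) A m))%E.
Proof.
move=> c0 mF mA FA; set x := (_ * _)%E.
pose G M := \bigcap_(m in [set m | (M <= m)%N]) F m.
pose H M := \bigcup_(m in [set m | (M <= m)%N]) A m.
have mG M : measurable (G M).
  by apply: bigcap_measurable => [|m _]; [exists M => /=|exact: mF].
have mH M : measurable (H M) by apply: bigcup_measurable => m _; exact: mA.
(* Comparing both events at the common index [maxn M K] decouples [M] from [K], which can then tend
   to infinity separately. *)
have GH M K : (P (G M) <= c%:E * P (H K))%E.
  apply: (@le_trans _ _ (P (F (maxn M K)))).
    by apply: le_measure; rewrite ?inE// => v; apply; rewrite /= leq_maxl.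
  apply: le_trans (FA _) _; apply: lee_wpmul2l; first by rewrite lee_fin.
  by apply: le_measure; rewrite ?inE// => v h; exists (maxn M K) => //=; rewrite leq_maxr.
have cH : (P \o H) n @[n --> \oo] --> P (\bigcap_M H M).
  apply: (nonincreasing_cvg_mu _ mH (bigcapT_measurable mH)).
    exact: (le_lt_trans (probability_le1 P (mH 0%N)) (ltry 1)).
  move=> n m nm; apply/subsetPset => v [k /= mk hk]; exists k => //=; exact: leq_trans mk.
have cG : (P \o G) n @[n --> \oo] --> P (\bigcup_M G M).
  apply: nondecreasing_cvg_mu => //; first exact: bigcupT_measurable.
  move=> n m nm; apply/subsetPset => v h k /= mk; apply: h => /=; exact: leq_trans mk.
have GM M : (P (G M) <= x)%E.
  have cc : (c%:E * P (H n))%E @[n --> \oo] --> x by apply: cvgeZl.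
  rewrite -(cvg_lim _ cc)//; apply: lime_ge; first by apply/cvg_ex; exists x.
  by apply: nearW => n; exact: GH.
rewrite -(cvg_lim _ cG)//; apply: lime_le; first by apply/cvg_ex; eexists; exact: cG.
by apply: nearW => n; exact: GM.
Qed.

Lemma sum_prob_ae_disjoint (A : nat -> set Omega) : (forall x, measurable (A x)) ->
  {ae P, forall v, forall x y, A x v -> A y v -> x = y} ->
  (\sum_(0 <= x <oo) P (A x) <= 1)%E.
Proof.
move=> mA [Z [mZ Z0 sub]].
pose A' x := A x `\` Z.
have mA' x : measurable (A' x) by exact: measurableD.
have AA' x : (P (A x) <= P (A' x))%E.
  apply: (@le_trans _ _ (P (A' x `|` Z))).
    apply: le_measure; rewrite ?inE//; first exact: measurableU.
    by move=> v Av; have [|] := pselect (Z v); [right|left].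
  by apply: le_trans (measureU2 _ _ _) _ => //; rewrite [X in (_ + X)%E]Z0 adde0.
apply: (@le_trans _ _ (\sum_(0 <= x <oo) P (A' x))%E); first by apply: lee_nneseries.
have tA' : trivIset setT A'.
  apply/trivIsetP => x y _ _ xy; apply/seteqP; split => v //= -[[h1 h2] [h3 _]].
  move/eqP: xy; apply; have : (~` Z) v by [].
  by move/subsetC: sub => /(_ v) h /h /= /contrapT; apply.
have := measure_semi_bigcup P mA' tA' (bigcupT_measurable _ mA').
by move=> <-; exact/probability_le1/bigcupT_measurable.
Qed.

End LimBounds.

(** * Grids in the argument of the clock *)

Section Cells.
Context (R : realType).

Let step_le (a b c q : R) : a < c -> b < q - c -> a + b <= q.
Proof. lra. Qed.

Let step_ge (a b c p : R) : c <= a + b -> b < c - p -> p <= a.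
Proof. lra. Qed.

Variables (g : nat -> R) (n : nat -> R -> nat) (tau : nat -> nat -> R).
Hypotheses (g0 : forall x, 0 <= g x) (H : regular g n tau).
Variable (delta : R).
Hypothesis delta0 : 0 < delta.
Local Notation clk := (clk g n tau).

Definition grid (m k : nat) : R := k%:R * (delta / m.+1%:R).

Lemma grid_ge0 m k : 0 <= grid m k.
Proof. by rewrite mulr_ge0// divr_ge0// ltW. Qed.

Lemma gridS m k : grid m k.+1 = grid m k + delta / m.+1%:R.
Proof. by rewrite /grid -natr1 mulrDl mul1r. Qed.

Lemma grid_last m : grid m m.+1 = delta.
Proof. by rewrite /grid mulrCA divff ?mulr1// pnatr_eq0. Qed.

Lemma grid_le m k l : (k <= l)%N -> grid m k <= grid m l.
Proof. by move=> kl; rewrite ler_wpM2r ?ler_nat// divr_ge0// ltW. Qed.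

Lemma grid_fine (h : R) : 0 < h -> exists M, forall m, (M <= m)%N -> delta / m.+1%:R < h.
Proof.
move=> h0; exists (Num.truncn (delta / h)) => m Mm.
rewrite ltr_pdivrMr// mulrC -ltr_pdivrMr//; apply: lt_le_trans (truncnS_gt _) _.
by rewrite ler_nat ltnS.
Qed.

Lemma grid_cell m s : 0 < s -> s <= delta ->
  exists2 k, (k < m.+1)%N & grid m k < s <= grid m k.+1.
Proof.
move=> s0 sd; have ex : exists k, s <= grid m k.+1 by exists m; rewrite grid_last.
case: (ex_minnP ex) => k rk kmin; exists k; first by apply: kmin; rewrite grid_last.
rewrite rk andbT; case: k kmin {rk} => [|k] kmin; first by rewrite /grid mul0r.
by rewrite ltNge; apply/negP => /kmin; rewrite ltnn.
Qed.

Variable t : R.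

(** Apart from the other components, this involves only the counts of [x] at the two ends of the
    cell, which is what makes it independent of later increments of [x]. *)
Definition crossing x m k : Prop :=
  [/\ (clk (grid m k) <= t%:E)%E, (t%:E < clk (grid m k.+1))%E
    & (0 < n x (grid m k.+1) - n x (grid m k))%N].

Lemma crossing_visit x j : visit g n tau x j t -> forall p q, 0 <= p -> 0 <= q ->
  (clk p <= t%:E)%E -> (t%:E < clk q)%E -> p < evt n x j.+1 <= q.
Proof.
move=> hv p q p0 q0 hp hq; rewrite (visit_evt g0 H hv p0 hp)/= leNgt; apply/negP => qs.
have := clk_vstart g0 H q0 qs; rewrite leNgt => /negP; apply; apply: le_lt_trans hq.
by rewrite lee_fin; case/andP: hv.
Qed.

Lemma visit_crossing x j p q : visit g n tau x j t -> 0 <= p -> 0 <= q ->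
  p < evt n x j.+1 -> evt n x j.+1 <= q -> (clk p <= t%:E)%E /\ (t%:E < clk q)%E.
Proof.
move=> /andP[h1 h2] p0 q0 ps sq; split.
  by apply: le_trans (clk_vstart g0 H p0 ps) _; rewrite lee_fin.
apply: lt_le_trans (clk_le g0 (reg_tau H) (reg_cnt H) (evt_ge0 (reg_cnt H) _ _) sq).
by rewrite -vendE// lte_fin.
Qed.

(** The cell containing the event is a crossing of [t]. Once the grid is fine enough,
    right-continuity makes the cell end before the count of [x] changes again, so the later event
    falls after the cell. *)
Lemma crossing_ev x j : visit g n tau x j t -> evt n x j.+1 <= delta ->
  (n x (evt n x j.+1) < n x delta)%N ->
  exists M, forall m, (M <= m)%N -> exists2 k, (k < m.+1)%N &
    crossing x m k /\ (0 < n x delta - n x (grid m k.+1))%N.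
Proof.
move=> hv; set s := evt n x j.+1 => sd ns; have hn := reg_cnt H.
have s0 : 0 < s := evt_gt0 hn x j.
have : exists2 q, s < q & n x q = n x s.
  near s^'+ => q; exists q => //; near: q; exact: (cnt_rc hn x (ltW s0)).
move=> [q sq nq]; have [M hM] : exists M, forall m, (M <= m)%N -> delta / m.+1%:R < q - s.
  by apply: grid_fine; rewrite subr_gt0.
exists M => m Mm; have [k km /andP[k1 k2]] := grid_cell m s0 sd; exists k => //.
have [c1 c2] := visit_crossing hv (grid_ge0 m k) (grid_ge0 m k.+1) k1 k2.
have kq : grid m k.+1 <= q by rewrite gridS; exact: step_le k1 (hM m Mm).
split; first split => //; rewrite subn_gt0.
  by apply: (@leq_trans j.+1); [rewrite ltnS -ltnS -(lt_evt hn)// grid_ge0|rewrite -(evt_le hn)// grid_ge0].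
by apply: leq_ltn_trans ns; rewrite -nq; apply: (cnt_le hn); rewrite ?grid_ge0.
Unshelve. all: by end_near.
Qed.

(** Crossing cells contain the event of [y] and shrink to it; if [x] differed from [y], then [x]
    would have no event there, hence none in small enough cells. *)
Lemma crossing_io x y j : visit g n tau y j t ->
  (forall M, exists2 m, (M <= m)%N & exists k, crossing x m k) -> x = y.
Proof.
move=> hv hx; apply: contrapT => xy; have hn := reg_cnt H.
set s := evt n y j.+1; have s0 : 0 < s := evt_gt0 hn y j.
have [q sq nq] : exists2 q, s < q & n x q = n x s.
  near s^'+ => q; exists q => //; near: q; exact: (cnt_rc hn x (ltW s0)).
have [p /andP[p0 ps] np] : exists2 p, 0 <= p < s & n x p = n x s.
  apply: contrapT => hp; have [|i si] := jump_evt hn s0 (x := x).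
    move=> p /andP[p0 ps]; rewrite ltn_neqAle (cnt_le hn _ p0 (ltW ps)) andbT.
    by apply/eqP => E; apply: hp; exists p; rewrite ?p0.
  by case: (reg_simple H si) => yx _; apply: xy.
have [M1 hM1] : exists M, forall m, (M <= m)%N -> delta / m.+1%:R < q - s.
  by apply: grid_fine; rewrite subr_gt0.
have [M2 hM2] : exists M, forall m, (M <= m)%N -> delta / m.+1%:R < s - p.
  by apply: grid_fine; rewrite subr_gt0.
have [m hm [k [c1 c2 c3]]] := hx (maxn M1 M2); rewrite geq_max in hm; case/andP: hm => m1 m2.
have /andP[k1 k2] := crossing_visit hv (grid_ge0 m k) (grid_ge0 m k.+1) c1 c2.
have g1 : p <= grid m k by have := hM2 m m2; rewrite gridS in k2; exact: step_ge k2.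
have g2 : grid m k.+1 <= q by rewrite gridS; exact: step_le k1 (hM1 m m1).
move: c3; rewrite subn_gt0 ltnNge => /negP; apply.
apply: (@leq_trans (n x q)); first by apply: (cnt_le hn); rewrite ?grid_ge0.
by rewrite nq -np; apply: (cnt_le hn).
Unshelve. all: by end_near.
Qed.

End Cells.

Lemma crossing_uniq (R : realType) (g : nat -> R) n tau (delta t : R) x m k l :
  (forall x, 0 <= g x) -> (forall x i, 0 <= tau x i) ->
  (forall x s t, 0 <= s -> s <= t -> (n x s <= n x t)%N) -> 0 < delta ->
  crossing g n tau delta t x m k -> crossing g n tau delta t x m l -> k = l.
Proof.
move=> g0 tau0 mono d0; suff half i j :
    crossing g n tau delta t x m i -> crossing g n tau delta t x m j -> (j <= i)%N.
  by move=> hk hl; apply/eqP; rewrite eqn_leq !half.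
move=> [_ h1 _] [h2 _ _]; rewrite leqNgt; apply/negP => ij.
suff : (clk g n tau (grid delta m i.+1) <= clk g n tau (grid delta m j))%E.
  by rewrite leNgt (le_lt_trans h2 h1).
apply: lee_nneseries => y _; first by move=> _; exact: gwork_ge0.
by rewrite lee_fin ler_wpM2l// work_le// mono ?grid_ge0// grid_le.
Qed.

Section Increments.
Context (R : realType) d (Omega : measurableType d) (P : probability Omega R).
Variable N : R -> {RV P >-> nat}.
Hypothesis hN : poisson_process 1 N.

Lemma poisson_later_increment (a b c : R) (Q : nat -> nat -> Prop) (Q' : nat -> Prop) :
  0 <= a -> a <= b -> b <= c ->
  P ([set v | Q (N a v) (N b v)] `&` [set v | Q' (N c v - N b v)%N]) =
  (P [set v | Q (N a v) (N b v)] * P [set v | Q' (N c v - N b v)%N])%E.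
Proof.
move=> a0 ab bc; have [N0 mono _ inc _] := hN.
(* The counts at [a] and [b] are recovered from the increments over the first two steps of this
   sequence; the third step is the later increment. *)
pose u (i : nat) : R := match i with 0%N => 0 | 1%N => a | 2%N => b | _ => c end.
have ind := inc u (lexx 0) _.
pose F (i : nat) := sigma_generated [set: unit] (fun _ w => (N (u i.+1) w - N (u i) w)%N).
have mI i : measurable_fun setT (fun w => (N (u i.+1) w - N (u i) w)%N).
  move=> _ B mB; rewrite setTI.
  exact: (measurable_incr (fun=> N) 0%N (u i) (u i.+1) (fun k => B k)).
have Fm i : F i `<=` measurable by apply: sigma_generated_measurable.
have Fp i B : F i [set w | B (N (u i.+1) w - N (u i) w)%N].
  exact: (@sigma_generated_preimage _ _ _ _ _ _
    (fun _ w => (N (u i.+1) w - N (u i) w)%N) tt B).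
have F0F : [set setT] `<=` F 2%N by move=> _ ->; exact: sigma_generatedT.
have sub i A : i != 2%N -> F i A -> <<s cylinders F 2%N [set setT] >> A.
  move=> i2 FA; apply: sub_sigma_algebra; apply: cylinders_other i2 _ FA => //.
apply: (indep_cylinders (i0 := 2%N) (F0 := [set setT]) (F := F) _ _ _ Fm _ _ F0F).
- by apply: ind => -[|[|[|i]]] /=.
- by move=> i; exact: sigma_generatedT.
- by move=> i; exact: sigma_generatedI.
- by [].
- by move=> _ _ -> ->; rewrite setTI.
- exact: (measurable_incr (fun=> N) 0%N b c Q').
- move=> _ ->; rewrite setTI probability_setT mul1e; split => //; exact: (Fp 2%N Q').
rewrite (_ : [set v | Q (N a v) (N b v)] = \bigcup_i \bigcup_l
    ([set v | (N a v - N 0 v)%N = i] `&` [set v | (N b v - N a v)%N = l /\ Q i (i + l)%N])).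
  apply: (@bigcupT_measurable _ (g_sigma_algebraType (cylinders F 2%N [set setT]))) => i.
  apply: (@bigcupT_measurable _ (g_sigma_algebraType (cylinders F 2%N [set setT]))) => l.
  apply: (@measurableI _ (g_sigma_algebraType (cylinders F 2%N [set setT]))).
    by apply: (sub 0%N) => //; exact: (Fp 0%N (fun k => k = i)).
  by apply: (sub 1%N) => //; exact: (Fp 1%N (fun k => k = l /\ Q i (i + l)%N)).
apply/seteqP; split => [v h|v [i _ [l _ /= []]]].
  exists (N a v) => //; exists (N b v - N a v)%N => //=.
  by rewrite N0 subn0 subnKC ?mono// a0.
by rewrite N0 subn0 => <- [<-]; rewrite subnKC ?mono// a0.
Qed.

End Increments.

Section Return.
Context (R : realType) d (Omega : measurableType d) (P : probability Omega R).
Variables (N : nat -> R -> {RV P >-> nat}) (T0 : {RV P >-> R}).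
Variable (T : nat -> nat -> {RV P >-> R}).
Hypothesis hD : driving_variables N T0 T.
Variable g : nat -> R.
Hypotheses (g0 : forall x, 0 < g x) (gs : (\sum_(0 <= x <oo) (g x)%:E < +oo)%E).
Local Notation nN v := (fun x t => N x t v).
Local Notation hT v := (fun x i => holding T x i v).

Let gge0 x : 0 <= g x. Proof. exact: ltW. Qed.
Let hI : mutually_indep P (driving_sigma N T0 T). Proof. by case: hD. Qed.

Section cell.
Variables (t delta : R) (x : nat).
Hypothesis delta0 : 0 < delta.

Definition crossed m k : set Omega := [set v | crossing g (nN v) (hT v) delta t x m k].

Definition later m k : set Omega :=
  [set v | (0 < N x delta v - N x (grid delta m k.+1) v)%N].

Section mk.
Variables m k : nat.
Let a := grid delta m k.
Let b := grid delta m k.+1.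
Let i0 : nat + option (nat * nat) := inl x.
(** The part of the component [x] that [crossing] involves; the component as a whole also contains
    the later increment. *)
Let F0 : set (set Omega) :=
  [set C | exists Q : nat -> nat -> Prop, C = [set v | Q (N x a v) (N x b v)]].
Let C := cylinders (driving_sigma N T0 T) i0 F0.

Let a0 : 0 <= a. Proof. exact: grid_ge0. Qed.
Let b0 : 0 <= b. Proof. exact: grid_ge0. Qed.

Let F0F : F0 `<=` driving_sigma N T0 T i0.
Proof.
move=> _ [Q ->].
have -> : [set v | Q (N x a v) (N x b v)] = \bigcup_i \bigcup_l
    (N x a @^-1` [set j | j = i /\ Q i l] `&` N x b @^-1` [set l]).
  apply/seteqP; split => [v h|v [i _ [l _ /= [[-> q] ->]]]//].
  by exists (N x a v) => //; exists (N x b v).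
have [_ _ SU] : sigma_algebra setT (driving_sigma N T0 T i0).
  exact: sigma_generated_sigma_algebra.
apply: (SU) => i; apply: (SU) => l; apply: driving_sigmaI.
  exact: (@driving_count _ _ _ _ N T0 T x a).
exact: (@driving_count _ _ _ _ N T0 T x b).
Qed.

Let Csub i A : i != i0 -> driving_sigma N T0 T i A -> <<s C >> A.
Proof.
move=> ii FA; apply: sub_sigma_algebra; apply: cylinders_other ii _ FA => //.
by exists (fun _ _ => True); apply/seteqP; split.
Qed.

Let Cown A : F0 A -> <<s C >> A.
Proof. by move=> h; apply: sub_sigma_algebra; exact: (cylinders_own (@driving_sigmaT _ _ _ _ N T0 T) _ h). Qed.

Let tau y i (v : g_sigma_algebraType C) : R := holding T y i v.

Let mtau y i : measurable_fun setT (tau y i).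
Proof.
apply: measurable_maxr; first exact: measurable_cst.
move=> _ B mB; rewrite setTI.
by apply: (Csub (i := inr (Some (y, i)))) => //; exact: driving_holding.
Qed.

Let mnc y s l : s = a \/ s = b -> measurable [set v : g_sigma_algebraType C | N y s v = l].
Proof.
move=> hs; have [->|yx] := eqVneq y x.
  by apply: Cown; case: hs => ->; [exists (fun i _ => i = l)|exists (fun _ i => i = l)].
apply: (Csub (i := inl y)); first by apply: contra yx => /eqP[->].
by case: hs => ->; exact: (@driving_count _ _ _ _ N T0 T y _ [set l]).
Qed.

Let mclkC s : s = a \/ s = b -> measurable_fun setT
  (fun v : g_sigma_algebraType C => clk g (nN v) (hT v) s).
Proof.
move=> hs; apply: (measurable_clk gge0 _ mtau).
  by move=> y i v; exact: holding_ge0.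
by move=> y l; exact: mnc.
Qed.

Let mcrossedC : measurable (crossed m k : set (g_sigma_algebraType C)).
Proof.
rewrite (_ : crossed m k = [set v | (clk g (nN v) (hT v) a <= t%:E)%E] `&`
   [set v | (t%:E < clk g (nN v) (hT v) b)%E] `&` [set v | (0 < N x b v - N x a v)%N]).
  apply: measurableI; first apply: measurableI.
  - rewrite -[X in measurable X]setTI.
    exact: (emeasurable_fun_infty_c _ (mclkC (or_introl erefl))).
  - rewrite -[X in measurable X]setTI.
    exact: (emeasurable_fun_o_infty _ (mclkC (or_intror erefl))).
  - by apply: Cown; exists (fun i j => (0 < j - i)%N).
by apply/seteqP; split => [v [h1 h2 h3]|v [[h1 h2] h3]].
Qed.

Lemma measurable_crossed : measurable (crossed m k).
Proof.
have : C `<=` measurable.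
  by apply: cylinders_measurable F0F; exact: driving_sigma_measurable.
move=> Cm; have : <<s C >> `<=` measurable.
  by apply: smallest_sub => //; exact: sigma_algebra_measurable.
by apply; exact: mcrossedC.
Qed.

Lemma measurable_later : measurable (later m k).
Proof. exact: (measurable_incr N x _ _ (fun j => (0 < j)%N)). Qed.

Lemma crossed_later : (k < m.+1)%N ->
  (P (crossed m k `&` later m k) <= delta%:E * P (crossed m k))%E.
Proof.
move=> km; have hNx : poisson_process 1 (N x) by case: hD.
have bd : b <= delta by rewrite -[leRHS](grid_last _ m) grid_le.
have ab : a <= b by exact: grid_le.
have -> : P (crossed m k `&` later m k) = (P (crossed m k) * P (later m k))%E.
  apply: (indep_cylinders hI (@driving_sigmaT _ _ _ _ N T0 T)
    (@driving_sigmaI _ _ _ _ N T0 T) (@driving_sigma_measurable _ _ _ _ N T0 T) _ _ F0F);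
    last exact: mcrossedC.
  - by exists (fun _ _ => True); apply/seteqP; split.
  - move=> _ _ [Q1 ->] [Q2 ->]; exists (fun i j => Q1 i j /\ Q2 i j).
    by apply/seteqP; split.
  - exact: measurable_later.
  - move=> _ [Q ->]; split.
      apply: driving_sigmaI; first by apply: F0F; exists Q.
      by apply: (@driving_incr _ _ _ _ N T0 T x b delta (fun j => (0 < j)%N)) => //; exact: ltW.
    exact: (poisson_later_increment hNx Q (fun j => (0 < j)%N)).
rewrite muleC; apply: lee_wpmul2r; first exact: measure_ge0.
(* The increment bound requires a nondegenerate interval; after the last cell there is nothing left
   and [later] is empty. *)
have [bd'|] := ltP b delta.
  apply: le_trans (prob_incr_ge1 hD x b0 bd') _.
  by rewrite lee_fin gerBl.
move=> db; have -> : later m k = set0.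
  apply/seteqP; split => v //=; rewrite /later /= (_ : grid delta m k.+1 = delta) ?subnn//.
  by apply/eqP; rewrite eq_le bd db.
by rewrite measure0 lee_fin ltW.
Qed.

End mk.

Let A m := \bigcup_(k < m.+1) crossed m k.
Let F m := \bigcup_(k < m.+1) (crossed m k `&` later m k).

Let mA m : measurable (A m).
Proof. by apply: bigcup_measurable => k _; exact: measurable_crossed. Qed.

Let mF m : measurable (F m).
Proof.
by apply: bigcup_measurable => k _; apply: measurableI; [exact: measurable_crossed|exact: measurable_later].
Qed.

(* In a fixed cell, the crossing of [t] is independent of the later increment.
   As the grid is refined, [recross] contains the event that [x] covers [t] and
   has a later event before [delta], and [cross_io] is contained almost surely
   in the event that [x] covers [t]. *)
Definition recross := \bigcup_M \bigcap_(m in [set m | (M <= m)%N]) F m.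
Definition cross_io := \bigcap_M \bigcup_(m in [set m | (M <= m)%N]) A m.

Lemma measurable_recross : measurable recross.
Proof. exact: measurable_lim_inf. Qed.

Lemma measurable_cross_io : measurable cross_io.
Proof. exact: measurable_lim_sup. Qed.

(** For each grid the cells are summed: a union bound on one side, and on the other disjointness of
    crossings in different cells by [crossing_uniq]. *)
Lemma prob_recross : (P recross <= delta%:E * P cross_io)%E.
Proof.
apply: lim_inf_le_lim_sup => // [|m]; first exact: ltW.
pose G k := crossed m k `&` later m k.
apply: (@le_trans _ _ (\sum_(k < m.+1) P (G k))%E).
  rewrite /F bigcup_mkord; apply: (@Boole_inequality _ _ _ P G) => k _.
  by apply: measurableI; [exact: measurable_crossed|exact: measurable_later].
apply: (@le_trans _ _ (\sum_(k < m.+1) (delta%:E * P (crossed m k)))%E).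
  by apply: lee_sum => k _; exact: crossed_later.
rewrite -ge0_sume_distrr; last by move=> k _; exact: measure_ge0.
apply: lee_wpmul2l; first by rewrite lee_fin ltW.
rewrite /A bigcup_mkord measure_bigsetU//.
- by move=> k; exact: measurable_crossed.
- apply/trivIsetP => i j _ _ ij; apply/seteqP; split => v //= [hi hj].
  move/eqP: ij; apply; apply: (crossing_uniq _ _ _ delta0 hi hj) => //.
    by move=> y l; exact: holding_ge0.
  move=> y s u s0 su; have [hN _ _ _] := hD; have [_ mono _ _ _] := hN y.
  by apply: mono; rewrite s0.
Qed.

Lemma recross_of_visit v j : regular g (nN v) (hT v) ->
  visit g (nN v) (hT v) x j t -> evt (nN v) x j.+1 <= delta ->
  (N x (evt (nN v) x j.+1) v < N x delta v)%N -> recross v.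
Proof.
move=> hr hv sd ns; have [M hM] := crossing_ev gge0 hr delta0 hv sd ns.
by exists M => // m /hM.
Qed.

Lemma cross_io_visit v y j : regular g (nN v) (hT v) ->
  visit g (nN v) (hT v) y j t -> cross_io v -> x = y.
Proof.
move=> hr hv h; apply: (crossing_io gge0 hr delta0 hv) => M.
by have [m /= Mm [k _ hk]] := h M I; exists m => //; exists k.
Qed.

End cell.

Hypothesis hcov : forall t, 0 < t ->
  {ae P, forall v, exists x j, visit g (nN v) (hT v) x j t}.

Lemma sum_cross_io t delta : 0 < t -> 0 < delta ->
  (\sum_(0 <= x <oo) P (cross_io t delta x) <= 1)%E.
Proof.
move=> t0 d0; apply: sum_prob_ae_disjoint => [x|]; first exact: measurable_cross_io.
apply: filterS2 (ae_regular hD g0 gs) (hcov t0) => v hr [z [j hv]] x y hx hy.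
by rewrite (cross_io_visit d0 hr hv hx) (cross_io_visit d0 hr hv hy).
Qed.

Let mclk t : measurable_fun setT (fun v => clk g (nN v) (hT v) t).
Proof. exact: (measurable_clk_holding N T g0). Qed.

Lemma clk_small (delta c e : R) : 0 < delta -> 0 < c -> 0 < e -> \forall t \near 0^'+,
  (P [set v | (clk g (nN v) (hT v) delta <= (c * t)%:E)%E] <= e%:E)%E.
Proof.
move=> d0 c0 e0; pose B (s : R) := [set v | (clk g (nN v) (hT v) delta <= s%:E)%E].
pose F n := B n.+1%:R^-1.
have mB s : measurable (B s).
  rewrite -[X in measurable X]setTI; exact: (emeasurable_fun_infty_c _ (mclk delta)).
have Ble s u : s <= u -> B s `<=` B u.
  by move=> su v /= h; apply: (le_trans h); rewrite lee_fin.
have dF : {homo F : n m / (n <= m)%N >-> (m <= n)%O}.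
  move=> n m nm; apply/subsetPset; apply: Ble.
  by rewrite lef_pV2 ?posrE// ler_nat ltnS.
have P0 : P (\bigcap_n F n) = 0%E.
  apply/negligibleP; first by apply: bigcapT_measurable => n; exact: mB.
  apply: negligibleS (filterI (ae_regular hD g0 gs) (ae_clk_strict hD g0 gs)) => v hv [hr hs].
  have := hs 0 delta (lexx 0) d0; rewrite clk0; last exact: reg_cnt hr.
  rewrite ltNge => /negP; apply; apply/lee_addgt0Pr => r r0; rewrite add0e.
  have h := hv (Num.truncn r^-1) I; apply: (le_trans h); rewrite lee_fin.
  by rewrite -[leRHS]invrK lef_pV2 ?posrE ?invr_gt0//; exact/ltW/truncnS_gt.
have cv : (P \o F) x @[x --> \oo] --> 0%E.
  have mF n : measurable (F n) by exact: mB.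
  rewrite -P0; apply: (nonincreasing_cvg_mu _ mF (bigcapT_measurable mF) dF).
  exact: (le_lt_trans (probability_le1 P (mF 0%N)) (ltry 1)).
have e0' : (0%:E < e%:E)%E by rewrite lte_fin.
have [n _ hn] := cv _ (open_ereal_lt' e0').
have n0 : (0 : R) < n.+1%:R^-1 / c by rewrite divr_gt0// invr_gt0.
apply: filterS (nbhs_right_lt n0) => t tn; apply: le_trans (ltW (hn n (leqnn n))).
apply: le_measure; rewrite ?inE; [exact: mB|exact: mB|].
by apply: Ble; rewrite mulrC -ler_pdivlMr// ltW.
Qed.

(** The bad event has two parts: the clock at [delta] has not passed [(1 + theta) * t], or some
    state covering [t] has another event before [delta]. The second has probability at most [delta],
    since the events [cross_io] of different states are almost surely disjoint. Hence
    [delta = e / 2]. *)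
Lemma ret_unlikely (theta e : R) : 0 < theta -> 0 < e -> \forall t \near 0^'+,
  exists B, [/\ measurable B, (P B <= e%:E)%E &
   {ae P, forall v, B v \/ forall x j k, visit g (nN v) (hT v) x j t ->
       vend g (nN v) (hT v) x j <= vstart g (nN v) (hT v) x k ->
       t + theta * t < vstart g (nN v) (hT v) x k}].
Proof.
move=> th0 e0; pose delta := e / 2; have d0 : 0 < delta by rewrite divr_gt0.
have c0 : 0 < 1 + theta by rewrite addr_gt0.
have hs := clk_small d0 c0 d0.
near=> t; have t0 : 0 < t by near: t; exact: nbhs_right_gt.
have hst : (P [set v | (clk g (nN v) (hT v) delta <= ((1 + theta) * t)%:E)%E] <= delta%:E)%E.
  by near: t; exact: hs.
pose B0 := [set v | (clk g (nN v) (hT v) delta <= ((1 + theta) * t)%:E)%E].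
have mB0 : measurable B0.
  rewrite -[X in measurable X]setTI; exact: (emeasurable_fun_infty_c _ (mclk delta)).
pose B1 := \bigcup_x recross t delta x.
have mB1 : measurable B1 by apply: bigcupT_measurable => x; exact: measurable_recross.
exists (B0 `|` B1); split; first exact: measurableU.
  apply: le_trans (measureU2 _ mB0 mB1) _.
  have -> : e%:E = (delta%:E + delta%:E)%E by rewrite -EFinD /delta -splitr.
  apply: leeD; first exact: hst.
  apply: (@le_trans _ _ (\sum_(0 <= x <oo) P (recross t delta x))%E).
    apply: measure_sigma_subadditive => // x; exact: measurable_recross.
  apply: (@le_trans _ _ (\sum_(0 <= x <oo) (delta%:E * P (cross_io t delta x)))%E).
    by apply: lee_nneseries => // x _; exact: prob_recross.
  rewrite nneseriesZl; last by move=> x _; exact: measure_ge0.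
  rewrite -[leRHS]mule1; apply: lee_wpmul2l; first by rewrite lee_fin ltW.
  exact: sum_cross_io.
apply: filterS (ae_regular hD g0 gs) => v hr.
have hn := reg_cnt hr.
have [hB0|hB0] := pselect (B0 v); first by left; left.
have [hB1|hB1] := pselect (B1 v); first by left; right.
right=> x j k hv ba; set s := evt (nN v) x j.+1.
have big : ((t + theta * t)%:E < clk g (nN v) (hT v) delta)%E.
  by rewrite ltNge; apply/negP => h; apply: hB0; rewrite /B0 /= mulrDl mul1r.
have tt : (t%:E < clk g (nN v) (hT v) delta)%E.
  by apply: le_lt_trans big; rewrite lee_fin lerDl mulr_ge0// ltW.
have sd : s <= delta.
  have : (clk g (nN v) (hT v) 0 <= t%:E)%E by rewrite (clk0 _ _ hn) lee_fin ltW.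
  by move=> h; have /andP[] := crossing_visit gge0 hr hv (lexx 0) (ltW d0) h tt.
have Ns : (N x delta v <= N x s v)%N.
  rewrite leqNgt; apply/negP => ns; apply: hB1; exists x => //.
  exact: recross_of_visit hr hv sd ns.
have jk : (j < k)%N.
  rewrite ltnNge; apply/negP => kj; move: ba; rewrite leNgt => /negP; apply.
  have ek : evt (nN v) x k.+1 <= s by apply: le_evt.
  apply: (@le_lt_trans _ _ t).
    apply: (vstart_le gge0 hr (ltW t0)) => p p0 pk.
    apply: le_trans (clk_vstart gge0 hr p0 (lt_le_trans pk ek)) _.
    by rewrite lee_fin; case/andP: hv.
  by case/andP: hv.
(* Off the bad event [x] has no event between [s] and [delta], so the event of a later visit exceeds
   [delta], and that visit starts no earlier than the clock at [delta]. *)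
rewrite -lte_fin; apply: (lt_le_trans big); apply: (clk_vstart gge0 hr (ltW d0)).
rewrite (lt_evt hn) ?(ltW d0)//.
apply: leq_ltn_trans Ns _; rewrite -(lt_evt hn) ?evt_ge0//.
rewrite lt_neqAle le_evt 1?ltnW// andbT; apply/eqP => E.
by have [_ E'] := reg_simple hr E; rewrite E' ltnn in jk.
Unshelve. all: by end_near.
Qed.

End Return.

(** * Trajectories and weights *)

Section Trajectories.
Context (R : realType) d (Omega : measurableType d) (P : probability Omega R).
Variables (N : nat -> R -> {RV P >-> nat}) (T0 : {RV P >-> R}).
Variable (T : nat -> nat -> {RV P >-> R}).
Variable g : nat -> R.
Local Notation nN v := (fun x t => N x t v).
Local Notation hT v := (fun x i => holding T x i v).

Lemma clock_infty v : (forall x i, 0 <= T x i v) ->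
  clock g 0 None N T0 T v = clk g (nN v) (hT v).
Proof.
move=> Tp; apply/funext => t; rewrite /clock /= !mul0r add0e adde0 /clk.
apply: eq_eseriesr => x _; congr ((g x * _)%:E).
by apply: eq_bigr => i _; rewrite /holding (max_idPr (Tp x i)).
Qed.

Lemma Kprocess_some v t x : (forall x, 0 < g x) -> (forall x i, 0 <= T x i v) ->
  regular g (nN v) (hT v) -> 0 <= t ->
  Kprocess g 0 None N T0 T v t = Some x <-> exists j, visit g (nN v) (hT v) x j t.
Proof.
move=> g0 Tp hr t0; have gge0 y : 0 <= g y by exact: ltW.
rewrite /Kprocess clock_infty// /= mul0r [t < 0]ltNge t0 /= ?andbF.
have E y : (exists j : nat, [/\ (1 <= j)%N,
    (lim (clk g (nN v) (hT v) s @[s --> (event_time (N y) j v)^'-]) <= t%:E)%E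
  & (t%:E < clk g (nN v) (hT v) (event_time (N y) j v))%E]) <->
  exists j, visit g (nN v) (hT v) y j t.
  split => [[j [j1 h1 h2]]|[j hj]].
    case: j j1 h1 h2 => [//|j] _ h1 h2.
    by exists j; apply/(visitP gge0 hr y j t0).
  by have /(visitP gge0 hr y j t0)[h1 h2] := hj; exists j.+1.
case: xgetP => [y -> [z /E[j hz] <-]|none].
  split => [[<-]|[i hx]]; first by exists j.
  by have [->] := visit_inj gge0 hr hx hz.
split=> // hx; exfalso; apply: (none (Some x)); exists x => //=; exact/E.
Qed.

Lemma regular_visits_ok v : (forall x, 0 < g x) ->
  (forall x j, 0 < g x * holding T x j v) ->
  regular g (nN v) (hT v) -> clk_strict g (nN v) (hT v) ->
  visits_ok (fun x j => vstart g (nN v) (hT v) x j) (fun x j => vend g (nN v) (hT v) x j).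
Proof.
move=> g0 gt hr hs; have gge0 y : 0 <= g y by exact: ltW.
split.
- exact: vstart_gt0.
- by move=> x y i j t; exact: visit_inj.
- exact: vstart_locfin.
- by move=> x j y k; exact: vend_unvisited.
- by move=> s t; exact: visit_dense.
Qed.

Lemma Kpath_describes v : (forall x, 0 < g x) -> (forall x i, 0 < T x i v) ->
  regular g (nN v) (hT v) -> clk_strict g (nN v) (hT v) ->
  visits_ok (fun x j => vstart g (nN v) (hT v) x j) (fun x j => vend g (nN v) (hT v) x j) /\
  describes (fun x j => vstart g (nN v) (hT v) x j) (fun x j => vend g (nN v) (hT v) x j)
    (Kpath g 0 None N T0 T v).
Proof.
move=> g0 Tp hr hs.
have ok : visits_ok (fun x j => vstart g (nN v) (hT v) x j) (fun x j => vend g (nN v) (hT v) x j).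
  by apply: regular_visits_ok => // x j; rewrite mulr_gt0// /holding lt_max Tp orbT.
have hK : describes (fun x j => vstart g (nN v) (hT v) x j) (fun x j => vend g (nN v) (hT v) x j)
    (Kprocess g 0 None N T0 T v).
  by move=> t x t0; apply: Kprocess_some => // y i; exact: ltW.
split => //; rewrite /Kpath /to_path.
by case: pselect => // h; exfalso; apply: h; exact: (describes_cadlag ok hK).
Qed.

Lemma Kpath_zero v t : 0 <= t -> Kpath (fun=> 0) 0 None N T0 T v t = None.
Proof.
move=> t0; rewrite /Kpath /to_path; case: pselect => //= _.
rewrite /Kprocess /= mul0r [t < 0]ltNge t0 /= ?andbF.
case: xgetP => // y -> [x [j [_ _ +]] _]; rewrite /clock /= !mul0r add0e adde0.
rewrite eseries0; last by move=> z _ _; rewrite mul0r.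
(* With zero weights the clock is identically 0 and never exceeds a nonnegative [t]. *)
by rewrite ltNge lee_fin t0.
Qed.

End Trajectories.

(** * Positivity and summability of the weights *)

Section Weights.
Context (R : realType).

(** Either [gamma] has its default value, or its terms are the masses of distinct atoms and add up
    to at most the mass of a bounded interval. *)
Lemma gamma_cases (V : cumulative R R) : gamma V = (fun=> 0) \/
  (forall i, 0 < gamma V i) /\ (\sum_(0 <= i <oo) (gamma V i)%:E < +oo)%E.
Proof.
rewrite /gamma; case: xgetP => [g _ [z [zinj zr zg _]]|]; [right|by left].
have zP i : 0 <= z i <= 1 /\ (0 < rho V [set z i])%E.
  by have : range z (z i) by []; rewrite zr.
split => [i|]; first by have [_] := zP i; rewrite zg lte_fin.
have m1 i : measurable ([set z i] : set (measurableTypeR R)) by exact: measurable_set1.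
have tz : trivIset setT (fun i => [set z i]).
  apply/trivIsetP => i j _ _ ij; apply/seteqP; split => u //= [-> /zinj e].
  by rewrite e eqxx in ij.
under eq_eseriesr do rewrite -zg.
rewrite -(measure_semi_bigcup (rho V) m1 tz)//; last exact: bigcupT_measurable.
(* A half-open interval, where [rho] is an increment of [V]; it extends below 0 to include a
   possible atom at 0. *)
have oc : rho V `]-1, 1]%classic = (V 1 - V (-1))%:E.
  rewrite /rho/= /lebesgue_stieltjes_measure /measure_extension/=.
  by rewrite measurable_mu_extE/= ?wlength_itv_bnd//; exact: is_ocitv.
apply: (@le_lt_trans _ _ (rho V `]-1, 1]%classic)); last by rewrite oc ltry.
apply: le_measure; rewrite ?inE//; first exact: bigcupT_measurable.
move=> u [i _ /= ->]; rewrite in_itv/=; have [/andP[h1 h2] _] := zP i.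
by rewrite h2 andbT; apply: lt_le_trans h1; lra.
Qed.

End Weights.

(** * Decay of Lambda *)

Section LambdaDecay.
Context (R : realType).
Local Notation mu := (@lebesgue_measure R).
Local Notation R' := (measurableTypeR R).

Let h (alpha theta w : R) : R := expR (- theta / w) * w `^ (- (1 + alpha)).

Let mh (alpha theta : R) : measurable_fun (`]0, +oo[%classic : set R') (h alpha theta).
Proof.
have m0 : measurable_fun setT (fun w : R => expR (- theta * w `^ (-1)) * w `^ (- (1 + alpha))).
  apply: measurable_funM; last exact: measurable_powR.
  apply: measurableT_comp => //; apply: measurable_funM; first exact: measurable_cst.
  exact: measurable_powR.
apply: (eq_measurable_fun (fun w : R => expR (- theta * w `^ (-1)) * w `^ (- (1 + alpha)))).
  by move=> w; rewrite inE/= in_itv/= andbT => w0; rewrite /h powR_inv1 ?ltW.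
exact: measurable_funTS.
Qed.

Let Rint_ge0 (D : set R) (f : R -> R) : (forall x, D x -> 0 <= f x) -> 0 <= \int[mu]_(x in D) f x.
Proof. by move=> f0; apply: Rintegral_ge0. Qed.

(** The subtracted double integral is nonnegative, so [Lambda] is at most a constant times the first
    integral in its numerator, which tends to 0 as [theta] grows. *)
Lemma Lambda_not_one (alpha : R) : exists2 theta : R, 0 < theta & Lambda alpha theta <> 1.
Proof.
apply: contrapT => no; have one theta : 0 < theta -> Lambda alpha theta = 1.
  by move=> t0; apply: contrapT => ne; apply: no; exists theta.
pose D : set R' := `]0, +oo[%classic.
have mD : measurable D by exact: measurable_itv.
pose I theta := \int[mu]_(w in D) h alpha theta w.
pose c : R := (Gfun alpha)^-1 / \int[mu]_(w in D) (w / (1 + w) * w `^ (- (1 + alpha))).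
have c0 : 0 <= c.
  apply: mulr_ge0; rewrite invr_ge0.
    apply: Rint_ge0 => w _; by rewrite mulr_ge0 ?powR_ge0 ?expR_ge0.
  apply: Rint_ge0 => w; rewrite /D /= in_itv/= andbT => w0.
  by rewrite mulr_ge0 ?powR_ge0// divr_ge0// ?ltW// addr_gt0.
have le1 theta : 0 < theta -> 1 <= c * I theta.
  move=> t0; rewrite -(one _ t0) /Lambda /c -mulrA; apply: ler_wpM2l.
    rewrite invr_ge0; apply: Rint_ge0 => w _; by rewrite mulr_ge0 ?powR_ge0 ?expR_ge0.
  rewrite mulrC ler_wpM2l//.
    rewrite invr_ge0; apply: Rint_ge0 => w; rewrite /D /= in_itv/= andbT => w0.
    by rewrite mulr_ge0 ?powR_ge0// divr_ge0// ?ltW// addr_gt0.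
  rewrite gerBl; apply: Rint_ge0 => s _; apply: Rint_ge0 => w _.
  by rewrite !mulr_ge0 ?powR_ge0 ?expR_ge0.
have h0 theta w : (0 <= (h alpha theta w)%:E)%E by rewrite lee_fin mulr_ge0 ?expR_ge0 ?powR_ge0.
have mhE theta : measurable_fun D (fun w => (h alpha theta w)%:E).
  by apply/measurable_EFinP; exact: mh.
(* [Rintegral] sends an infinite integral to 0, contradicting [le1]. *)
have fin : (\int[mu]_(w in D) (h alpha 1 w)%:E < +oo)%E.
  rewrite ltey; apply/eqP => oo; have := le1 1 ltr01.
  by rewrite /I /Rintegral oo /= mulr0 ler10.
have ig : mu.-integrable D (fun w => (h alpha 1 w)%:E).
  apply/integrableP; split; first exact: mhE.
  by under eq_integral do rewrite gee0_abs//.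
have hle n w : D w -> h alpha n.+1%:R w <= h alpha 1 w.
  rewrite /D /= in_itv/= andbT => w0; rewrite ler_wpM2r ?powR_ge0// ler_expR.
  by rewrite ler_pM2r ?invr_gt0// lerN2 ler1n.
have cvh w : D w -> (h alpha n.+1%:R w)%:E @[n --> \oo] --> 0%E.
  rewrite /D /= in_itv/= andbT => w0.
  have -> : 0%E = (0 * w `^ (- (1 + alpha)))%:E :> \bar R by rewrite mul0r.
  apply/fine_cvgP; split; first by apply: nearW.
  apply: cvgMl; apply/cvgrPdist_lt => e e0.
  have [M hM] : exists M : nat, forall n, (M <= n)%N -> expR (- n.+1%:R / w) < e.
    exists (Num.truncn (w / e)) => n Mn.
    have q0 : 0 < n.+1%:R / w by rewrite divr_gt0.
    rewrite mulNr expRN invf_plt ?posrE ?expR_gt0//.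
    apply: lt_le_trans (expR_ge1Dx _); apply: ltr_pwDl => //.
    rewrite ler_pdivlMr// mulrC; apply/ltW/(lt_le_trans (truncnS_gt _)).
    by rewrite ler_nat ltnS.
  near=> n; rewrite sub0r normrN gtr0_norm ?expR_gt0//; apply: hM.
  by near: n; exact: nbhs_infty_ge.
have ae1 : {ae mu, forall w, D w -> (h alpha n.+1%:R w)%:E @[n --> \oo] --> 0%E} by exact: aeW.
have ae2 : {ae mu, forall w n, D w -> (`|(h alpha n.+1%:R w)%:E| <= (h alpha 1 w)%:E)%E}.
  by apply: aeW => w n Dw; rewrite gee0_abs// lee_fin hle.
have [_ _] := dominated_convergence mD (fun n => mhE n.+1%:R) (measurable_cst 0%E) ae1 ig ae2.
rewrite integral0 => cv; have c10 : 0 < (c + 1)^-1 by rewrite invr_gt0 ltr_wpDl.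
have c10' : (0%:E < ((c + 1)^-1)%:E)%E by rewrite lte_fin.
have [n _ hn] := cv _ (open_ereal_lt' c10').
have := hn n (leqnn n); rewrite /= => hn'.
have In : I n.+1%:R < (c + 1)^-1.
  by rewrite /I /Rintegral -lte_fin fineK// ge0_fin_numE ?(lt_trans hn') ?ltry//; apply: integral_ge0 => w _; exact: h0.
have := le1 n.+1%:R (ltr0Sn _ _); rewrite leNgt => /negP; apply.
apply: (@le_lt_trans _ _ (c / (c + 1))); first by rewrite ler_wpM2l// ltW.
by rewrite ltr_pdivrMr ?ltr_wpDl// mul1r ltrDl.
Unshelve. all: by end_near.
Qed.

End LambdaDecay.

Theorem corollary5p15 (R : realType) (alpha : R) (halpha : 0 < alpha < 1)
  (* the environment *)
  (d : measure_display) (Omega : measurableType d) (P : probability Omega R)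
  (V : Omega -> cumulative R R) (hV : stable_subordinator P alpha V)
  (* the randomness driving the K-process *)
  (d' : measure_display) (Omega' : measurableType d')
  (P' : probability Omega' R)
  (N : nat -> R -> {RV P' >-> nat}) (T0 : {RV P' >-> R})
  (T : nat -> nat -> {RV P' >-> R}) (hD : driving_variables N T0 T)
  (Phi : R -> R -> path_space R -> R) (Psi1 : R -> R)
  (Xi : R -> nbar -> R -> (R -> nbar) -> R) (Psi2 : R -> R -> R)
  (hPhi : path_measurable Phi)
  (hA1 : assumption_A1 Phi) (hA2 : assumption_A2 Phi)
  (hA3 : assumption_A3 Phi Psi1) (hA4 : assumption_A4 Phi Xi)
  (hXi : Xi_on_segments Xi)
  (hA5i : assumption_A5i Xi) (hA5ii : assumption_A5ii Xi)
  (hA5iii : assumption_A5iii Xi) (hA6 : assumption_A6 Xi Psi2) :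
  let Y (w : Omega) : Omega' -> path_space R :=
    Kpath (gamma (V w)) 0 None N T0 T in
  {ae P, forall w : Omega,
    (forall theta : R, 0 < theta ->
       \int[P']_w' \1_([set v : Omega' | forall s : R,
                          t <= s <= t + theta * t -> Y w v s = Y w v t]) w'
         @[t --> 0^'+] --> Lambda alpha theta) ->
    (forall theta : R, 0 < theta ->
       \int[P']_w' Phi t (theta * t) (Y w w')
         @[t --> 0^'+] -->
       Psi2 0 theta
       + (Psi1 theta - Psi2 theta theta) * Lambda alpha theta
       + \int[lebesgue_measure]_(s in `[0, theta])
           (derive1 (Psi2 ^~ theta) s * Lambda alpha s))}.
Proof.
move=> Y; apply: aeW => w hret theta theta0; rewrite {}/Y in hret *.
have [g0|[gpos gsum]] := gamma_cases (V w).
  (* With zero weights the path stays at infinity and the probability of constancy is 1 for every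
     [t]. *)
  exfalso; have [u u0] := Lambda_not_one alpha; apply.
  have cst1 : \int[P']_w' \1_([set v : Omega' | forall s : R, t <= s <= t + u * t ->
      Kpath (gamma (V w)) 0 None N T0 T v s = Kpath (gamma (V w)) 0 None N T0 T v t]) w'
      @[t --> 0^'+] --> (1 : R).
    apply: cvg_near_cst; near=> t; have t0 : 0 < t by near: t; exact: nbhs_right_gt.
    rewrite (_ : [set v | _] = setT); last first.
      apply/seteqP; split => // v _ s /andP[ts _].
      by rewrite g0 !Kpath_zero// ?(le_trans (ltW t0))// ltW.
    rewrite /Rintegral integral_indic// setIT.
    by rewrite (_ : _ setT = 1%E)//; exact: probability_setT.
  exact: (cvg_unique _ (hret u u0) cst1).
have gge0 x : 0 <= gamma (V w) x by exact: ltW.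
have mn x t k : 0 <= t -> measurable [set v | N x t v = k] by move=> _; exact: measurable_count.
have tau0 x i v : 0 <= holding T x i v by exact: holding_ge0.
have mtau x i : measurable_fun setT (holding T x i) by exact: measurable_holding.
have hcov t : 0 < t -> {ae P', forall v, exists x j, visit (gamma (V w))
    (fun x t => N x t v) (fun x i => holding T x i v) x j t}.
  by move=> t0; exact: (ae_covered hD gpos gsum t0).
apply: (Phi_limit (a := fun x j v => vstart (gamma (V w)) (fun x t => N x t v) (fun x i => holding T x i v) x j)
  (b := fun x j v => vend (gamma (V w)) (fun x t => N x t v) (fun x i => holding T x i v) x j)
  _ _ _ hPhi hA2 hA3 hA4 hA5i hA5ii hA5iii hA6 hcov theta0 _ hret).
- by move=> x j; exact: (measurable_vstart gge0 tau0 mtau mn).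
- by move=> x j; exact: (measurable_vend gge0 tau0 mtau mn).
- apply: filterS2 (ae_regular hD gpos gsum) (filterI (ae_clk_strict hD gpos gsum) (ae_holding_pos hD)) => v hr [hs Tp].
  exact: Kpath_describes.
- by move=> e e0; exact: (ret_unlikely hD gpos gsum hcov theta0 e0).
Unshelve. all: by end_near.
Qed.
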